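(* For the determinantal random point process in the plane $\mathbb C\cong\mathbb R^2$ with correlation kernel $$K(x,y)=e^{-\frac\pi2\left(|x|^2+|y|^2-2x\overline y\right)}$$ one has $$\lim_{N\to\infty}\mathrm{Var}(\mathcal W_N)=0 .$$
   Context: A point process with random configuration $\{a_i\}$ is determinantal with kernel $K$ if its correlation functions are $\rho_k(x_1,\dots,x_k)=\det(K(x_i,x_j))_{i,j=1}^k$ for all $k\ge 1$, where $\rho_k$ is characterized by $\mathbb E\sum_{i_1,\dots,i_k\text{ pairwise distinct}}F(a_{i_1},\dots,a_{i_k})=\int F\rho_k$. For $N\ge1$ and $x\in\mathbb C$ let $$E_N(x)=\sum_{(m,n)\in\mathbb Z^2\setminus\{0\}}e^{2i\pi\left(m\,\mathrm{Re}(x)/N+n\,\mathrm{Im}(x)/N\right)}\frac{1}{m^2+n^2}$$ (understood as the Fourier series of an $(N\mathbb Z)^2$-periodic $L^2_{loc}$ function, smooth away from $(N\mathbb Z)^2$; equivalently, $\frac1{2\pi}E_N$ is the zero-average solution $G$ of $-\Delta G=2\pi(\delta_0-\frac1{N^2})$ on $\mathbb R^2/(N\mathbb Z)^2$). Let $\eta(\tau)=q^{1/24}\prod_{k\ge1}(1-q^k)$, $q=e^{2i\pi\tau}$, be the Dedekind eta function. For a configuration $\{a_i\}\subset\mathbb C$, $$\mathcal W_N=\frac1{2\pi N^2}\sum_{i\neq j,\ a_i,a_j\in[0,N]^2}E_N(a_i-a_j)+\log\frac{N}{2\pi\eta(i)^2},$$ where in $\eta(i)$ the symbol $i$ is the imaginary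 unit. *)

(* Defs.v *)
From HB Require Import structures.
From mathcomp Require Import all_boot all_order all_algebra.
From mathcomp Require Import all_classical all_reals all_analysis.
From mathcomp Require Import measurable_realfun complex.

Set Implicit Arguments.
Unset Strict Implicit.
Unset Printing Implicit Defensive.

Import Order.TTheory GRing.Theory Num.Theory.
Import numFieldNormedType.Exports.

Local Open Scope classical_set_scope.
Local Open Scope complex_scope.
Local Open Scope ring_scope.

(* The plane C = R^2 is R * R, which carries the measurable and topological
   structures used below; [toC] is the identification with R[i]. *)
Definition toC (R : realType) (p : R * R) : R[i] := p.1 +i* p.2.

Definition cexp (R : realType) (z : R[i]) : R[i] :=
  (expR (complex.Re z))%:C * (cos (complex.Im z) +i* sin (complex.Im z)).

(* q^(1/24) is read as exp(2 i pi tau / 24).  [numFieldType] provides the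
   topology of R[i] used by [lim]. *)
Definition dedekind_eta (R : realType) (tau : R[i]) : R[i] :=
  let q := cexp (2 * 'i * pi%:C * tau) in
  cexp (2 * 'i * pi%:C * tau / 24) *
  lim ((fun n : nat => \prod_(1 <= k < n) (1 - q ^+ k) : (R[i] : numFieldType)) @ \oo).

Definition lebesgue_plane (R : realType) :
    {measure set (measurableTypeR R * measurableTypeR R) -> \bar R} :=
  ((@lebesgue_measure R) \x (@lebesgue_measure R))%E.

(* Integral over (R^2)^k, as an iterated integral; by Tonelli this is the
   integral against the k-fold product of Lebesgue measure for the
   nonnegative measurable integrands to which it is applied. *)
Fixpoint integral_plane_pow (R : realType) (k : nat) :
    (k.-tuple (R * R) -> \bar R) -> \bar R :=
  match k with
  | 0 => fun F => F [tuple]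
  | k'.+1 => fun F => (\int[lebesgue_plane R]_x
      integral_plane_pow (fun t : k'.-tuple (R * R) => F [tuple of x :: t]))%E
  end.

(* A point process on the plane: a random, possibly finite, locally finite
   family of points, measurably enumerated.  The configuration at omega is
   {pp_pt X i omega | omega \in pp_dom X i}, with multiplicities. *)
Record point_process (R : realType) (d : measure_display)
    (Omega : measurableType d) := PointProcess {
  pp_dom : nat -> set Omega ;
  pp_pt : nat -> Omega -> R * R ;
  pp_dom_measurable : forall i, measurable (pp_dom i) ;
  pp_pt_measurable : forall i, measurable_fun setT (pp_pt i) ;
  pp_locally_finite : forall (omega : Omega) (r : R),
    finite_set [set i | pp_dom i omega /\
                        `|toC (pp_pt i omega)| <= r%:C] }.

(* i ranges over the k-tuples of pairwise distinct indices of points. *)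
Definition is_correlation_function (R : realType) (d : measure_display)
    (Omega : measurableType d) (P : probability Omega R)
    (X : point_process R Omega) (k : nat) (rho : k.-tuple (R * R) -> R) :=
  [/\ measurable_fun setT rho,
      (forall x, 0 <= rho x) &
      forall F : k.-tuple (R * R) -> \bar R,
        measurable_fun setT F -> (forall x, 0 <= F x)%E ->
        (\int[P]_omega
           (\esum_(i in [set i : k.-tuple nat |
                        uniq i /\ forall j, pp_dom X (tnth i j) omega])
             F [tuple pp_pt X (tnth i j) omega | j < k])
         = integral_plane_pow (fun x => F x * (rho x)%:E))%E].

Definition determinantal (R : realType) (d : measure_display)
    (Omega : measurableType d) (P : probability Omega R)
    (X : point_process R Omega) (K : R[i] -> R[i] -> R[i]) :=
  forall k : nat, (1 <= k)%N ->
    exists2 rho : k.-tuple (R * R) -> R,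
      is_correlation_function P X rho &
      forall x : k.-tuple (R * R),
        (rho x)%:C = \det (\matrix_(i < k, j < k)
                             K (toC (tnth x i)) (toC (tnth x j))).

Definition ginibre_kernel (R : realType) (x y : R[i]) : R[i] :=
  cexp (- (pi / 2)%:C * (`|x| ^+ 2 + `|y| ^+ 2 - 2 * x * y^*)).

(* Partial sum over max(|m|, |n|) <= M of the Fourier series of E_N; the
   indices i, j encode m = i - M and n = j - M. *)
Definition E_partial_sum (R : realType) (N M : nat) (x : R * R) : R[i] :=
  \sum_(i < M.*2.+1) \sum_(j < M.*2.+1
      | (i%:Z - M%:Z, j%:Z - M%:Z) != (0, 0))
    let m : R := (i%:Z - M%:Z)%:~R in
    let n : R := (j%:Z - M%:Z)%:~R in
    cexp (2 * 'i * pi%:C * (m * x.1 / N%:R + n * x.2 / N%:R)%:C)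
      * (1 / (m ^+ 2 + n ^+ 2))%:C.

Definition square (R : realType) (N : nat) : set (R * R) :=
  [set x | 0 <= x.1 <= N%:R /\ 0 <= x.2 <= N%:R].

Definition lattice (R : realType) (N : nat) : set (R * R) :=
  [set x | exists m n : int, x = (m%:~R * N%:R, n%:~R * N%:R)].

(* The series does not converge absolutely, so E_N is specified as the sum of
   its Fourier series in L^2 of the period cell.  Periodicity and continuity
   off the lattice then select the smooth representative: it is unique outside
   the lattice, and its value at lattice points is left unspecified. *)
Definition is_E (R : realType) (N : nat) (E : R * R -> R) :=
  [/\ forall x l : R * R, lattice N l -> E (x + l) = E x,
      forall x : R * R, ~ lattice N x -> {for x, continuous E} &
      (fun M : nat => \int[lebesgue_plane R]_(x in @square R N)
         ((complex.Re `|(E x)%:C - E_partial_sum N M x|) ^+ 2)%:E)%E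
        @ \oo --> 0%E].

(* eta(i) is real, hence the real part. The sum over pairs has finitely many
   terms because the process is locally finite. *)
Definition renormalized_energy (R : realType) (d : measure_display)
    (Omega : measurableType d) (X : point_process R Omega)
    (N : nat) (E : R * R -> R) (omega : Omega) : R :=
  1 / (2 * pi * N%:R ^+ 2) *
    (\sum_(p \in [set p : nat * nat |
          [/\ p.1 != p.2,
              pp_dom X p.1 omega /\ square N (pp_pt X p.1 omega) &
              pp_dom X p.2 omega /\ square N (pp_pt X p.2 omega)]])
       E (pp_pt X p.1 omega - pp_pt X p.2 omega))
  + ln (N%:R / (2 * pi * complex.Re (dedekind_eta ('i : R[i])) ^+ 2)).

(* Main.v *)
(* Up to affine normalization W_N is the pair sum T = sum_{i <> j} f (a_i, a_j)
   with f (x, y) = g (x - y) restricted to the square, where g is the even part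
   of E_N.  E T^2 splits into integrals of f f against rho_4, rho_3, rho_2, and
   the determinants expand into products of Gaussians.  Since g has mean zero
   over a period, every term with a point entering only through f vanishes.
   Writing q = exp (- pi |x - y|^2), what is left of the variance is
     4 (\int f^2 - \int f (x, y) f (x, z) q (y, z))
   plus terms bounded by \int f^2 r with r a Gaussian in x - y.  As q has
   integral one, the bracket is controlled by the variation of g at unit scale:
   g is close in L^2 to a Fourier partial sum s_M, which is Lipschitz with
   constant O (1 / N), and ||g - s_M||^2 over the square is at most 2 N^2 delta_M,
   with delta_M -> 0 independent of N.  Hence Var W_N <= C delta_M + C_M / N. *)

Require Import Defs.
From HB Require Import structures.
From mathcomp Require Import all_boot all_order all_algebra.
From mathcomp Require Import all_classical all_reals all_analysis.
From mathcomp Require Import measurable_realfun complex ring lra.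

Set Implicit Arguments.
Unset Strict Implicit.
Unset Printing Implicit Defensive.

Import Order.TTheory GRing.Theory Num.Theory.
Import numFieldNormedType.Exports.

Local Open Scope classical_set_scope.
Local Open Scope ring_scope.

(** * Lebesgue integrals on the line and on the plane *)

(** The squared prefactor of the pair sum is of order [N^-4], while [\int f^2] is of order [N^4].
    Size alone never suffices for the bracket: its two terms must cancel to leading order, whereas
    the terms in [f^2 r] may be estimated with losses. The cancellation comes from polarization, [2
    f (x, y) f (x, z) = f (x, y)^2 + f (x, z)^2 - (g (x - y) - g (x - z))^2] inside the square; the
    two squares give back [\int f^2] except for the mass that [q] sends out of the square, an edge
    effect of order [N^3]. The obstacle is the logarithmic singularity of [E_N], known only through
    an L2 series: no pointwise bound on [g] is used, only square integrals. Products of two values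
    of [f] therefore become squares by Young's inequality, and the Gaussians are powers of a wider
    one, [q = r^8] and [|K| = r^4], so that a cycle of the determinant can give up a factor [r]
    between the two points of [f] and remain integrable in the other points. That [delta_M] does not
    depend on [N] comes from scaling: [E_N] and [E_1 (x / N)] have the same partial sums. *)

Section LineIntegrals.
Context {R : realType}.
Local Notation mu := (@lebesgue_measure R).
Implicit Types f : R -> \bar R.

(** Lebesgue measure is determined by its values on half-open intervals, and [c] times its image
    under [x |-> c x + b] takes the same values there; the rest is integration against an image
    measure. *)
Lemma ge0_integral_affine (c b : R) f : 0 < c ->
  measurable_fun setT f -> (forall x, 0 <= f x)%E ->
  (\int[mu]_x f (c * x + b)%R = c^-1%:E * \int[mu]_x f x)%E.
Proof.
move=> c0 mf f0.
pose phi : measurableTypeR R -> measurableTypeR R := fun x => c * x + b.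
have mphi : measurable_fun setT phi.
  by apply: measurable_funD => //; apply: measurable_funM.
have c0' : 0 <= c by exact: ltW.
pose nu : {measure set (measurableTypeR R) -> \bar R} :=
  mscale (NngNum c0') (pushforward mu phi).
have muE A : measurable A -> mu A = nu mphi A.
  apply: lebesgue_measure_unique => _ [[u v] _ <-].
  rewrite /nu /= /mscale/= /pushforward.
  rewrite (_ : phi @^-1` _ = `](u - b) / c, (v - b) / c]%classic); last first.
    apply/seteqP; split => x /=; rewrite !in_itv/= /phi ltr_pdivrMr// ler_pdivlMr//.
      by rewrite ltrBlDr lerBrDr mulrC.
    by rewrite ltrBlDr lerBrDr mulrC.
  rewrite !lebesgue_measure_itv/= !lte_fin ltr_pM2r ?invr_gt0// ltrD2r.
  case: ifP => uv; last by rewrite mule0.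
  rewrite -!EFinD -EFinM; congr EFin.
  by rewrite -mulrBl mulrCA divff ?gt_eqF// mulr1; lra.
have -> : (\int[mu]_x f x = \int[nu mphi]_x f x)%E.
  by apply: eq_measure_integral => A mA _; exact: muE.
rewrite /nu ge0_integral_mscale//=.
rewrite ge0_integral_pushforward// preimage_setT muleA -EFinM mulVf ?gt_eqF//.
by rewrite mul1e.
Qed.

Lemma ge0_integral_reflect f :
  measurable_fun setT f -> (forall x, 0 <= f x)%E ->
  (\int[mu]_x f (- x)%R = \int[mu]_x f x)%E.
Proof.
move=> mf f0.
have -> : (\int[mu]_x f x = \int[pushforward mu (-%R : _ -> measurableTypeR R)]_x f x)%E.
  by apply: eq_measure_integral => A mA _; exact/esym/lebesgue_measureN.
by rewrite ge0_integral_pushforward// preimage_setT.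
Qed.

Lemma ge0_integral_sub (a : R) f :
  measurable_fun setT f -> (forall x, 0 <= f x)%E ->
  (\int[mu]_x f (a - x)%R = \int[mu]_x f x)%E.
Proof.
move=> mf f0.
transitivity (\int[mu]_x (f \o +%R a) (- x)%R)%E; first by [].
rewrite ge0_integral_reflect; [|by apply: (measurableT_comp mf); exact: measurable_funD|by move=> x /=].
rewrite -[RHS](@mul1e _ (\int[mu]_x f x)%E).
rewrite -[X in (X%:E * _)%E](invr1 R) -(@ge0_integral_affine 1 a)//.
by apply: eq_integral => x _ /=; rewrite mul1r addrC.
Qed.

End LineIntegrals.

Section Periodic.
Context {R : realType}.
Local Notation mu := (@lebesgue_measure R).
Implicit Types f k : R -> \bar R.

Lemma ge0_integral_itv_shift (u v s : R) k :
  measurable_fun setT k -> (forall x, 0 <= k x)%E ->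
  (\int[mu]_(x in `[(u + s)%R, (v + s)%R[) k x
   = \int[mu]_(x in `[u, v[) k (x + s)%R)%E.
Proof.
move=> mk k0; rewrite integral_mkcond [RHS]integral_mkcond.
transitivity (\int[mu]_x (k \_ `[(u + s)%R, (v + s)%R[) (1 * x + s)%R)%E.
  rewrite ge0_integral_affine//; first by rewrite invr1 mul1e.
    apply/(measurable_restrictT _ _).1 => //; exact: measurable_funTS.
  by move=> x; rewrite patchE; case: ifP.
apply: eq_integral => x _; rewrite !patchE mul1r.
rewrite (_ : (x + s \in `[u + s, v + s[%classic) = (x \in `[u, v[%classic))//.
by apply/idP/idP; rewrite !inE/= !in_itv/= lerD2r ltrD2r.
Qed.

(** Shifting by [floor (b / N)] periods moves the window to [[r, r + N[] with [0 <= r < N]; the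
    piece beyond [N] goes back by one more period and becomes [[0, r[]. *)
Lemma ge0_integral_itv_periodic (N b : R) k : 0 < N ->
  measurable_fun setT k -> (forall x, 0 <= k x)%E ->
  (forall (n : int) x, k (x + n%:~R * N)%R = k x) ->
  (\int[mu]_(x in `[b, (b + N)%R[) k x = \int[mu]_(x in `[0%R, N[) k x)%E.
Proof.
move=> N0 mk k0 kN.
pose n := Num.floor (b / N); pose r := b - n%:~R * N.
have r0 : 0 <= r.
  by rewrite /r subr_ge0 -ler_pdivlMr// floor_le.
have rN : r < N.
  by rewrite /r ltrBlDr -{1}(mul1r N) -mulrDl addrC -ltr_pdivrMr// -intrD1 floorD1_gt.
have -> : (\int[mu]_(x in `[b, (b + N)%R[) k x = \int[mu]_(x in `[r, (r + N)%R[) k x)%E.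
  rewrite -[X in _ = X](_ : (\int[mu]_(x in `[r, (r + N)%R[) k (x + n%:~R * N)%R = _)%E).
    rewrite -ge0_integral_itv_shift// /r.
    have -> : b - n%:~R * N + n%:~R * N = b by ring.
    by have -> : b - n%:~R * N + N + n%:~R * N = b + N by ring.
  by apply: eq_integral => x _; rewrite kN.
have splitI (u v w : R) : u <= v -> v <= w ->
    (\int[mu]_(x in `[u, w[) k x
     = \int[mu]_(x in `[u, v[) k x + \int[mu]_(x in `[v, w[) k x)%E.
  move=> uv vw.
  rewrite -ge0_integral_setU//=.
  - congr integral; apply/seteqP; split => x /=; rewrite !in_itv/=.
      by move=> /andP[ux xw]; case: (ltP x v) => xv; [left; rewrite ux|right].
    by move=> [] /andP[h1 h2]; rewrite ?h1 ?h2 ?andbT /=;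
      [apply: lt_le_trans vw|apply: le_trans h1].
  - exact: measurable_funTS.
  - apply/disj_setPRL => x /=; rewrite !in_itv/= => /andP[vx _].
    by apply/negP; rewrite -leNgt vx orbT || (rewrite negb_and -!leNgt vx orbT).
have rNN : N <= r + N by rewrite lerDr.
have rN' := ltW rN.
rewrite (splitI r N (r + N))//.
rewrite [RHS](splitI 0 r N)// addeC; congr (_ + _)%E.
rewrite -[X in `[X, _[](add0r N) ge0_integral_itv_shift//.
apply: eq_integral => x _.
by rewrite -[in RHS](kN 1) mul1r.
Qed.

Lemma ge0_integral_periodic_sub (N a : R) k : 0 < N ->
  measurable_fun setT k -> (forall x, 0 <= k x)%E ->
  (forall (n : int) x, k (x + n%:~R * N)%R = k x) ->
  (\int[mu]_(x in `[0%R, N]) k (a - x)%R = \int[mu]_(x in `[0%R, N]) k x)%E.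
Proof.
move=> N0 mk k0 kN.
(* Periodicity is stated for half-open windows, whose orientation a reflection reverses; closed
   windows are stable under it and differ by a null endpoint. *)
rewrite -[RHS]integral_itv_bndo_bndc; last exact: measurable_funTS.
rewrite -(@ge0_integral_itv_periodic N (a - N))// subrK.
rewrite [RHS]integral_itv_bndo_bndc; last exact: measurable_funTS.
rewrite integral_mkcond [RHS]integral_mkcond -[RHS](ge0_integral_sub a).
- apply: eq_integral => x _; rewrite !patchE.
  rewrite (_ : (a - x \in `[a - N, a]%classic) = (x \in `[0, N]%classic))//.
  by apply/idP/idP; rewrite !inE/= !in_itv/= => /andP[h1 h2]; apply/andP; split; lra.
- apply/(measurable_restrictT _ _).1 => //; exact: measurable_funTS.
- by move=> x; rewrite patchE; case: ifP.
Qed.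
End Periodic.

(* The library instance of [sigma_finite_measure] on [m1 \x m2] is shadowed by the one for subprobabilities, hence this copy. *)
Section SigmaFiniteProduct.
Context d1 d2 (T1 : measurableType d1) (T2 : measurableType d2) (R : realType).
Variables (m1 : {sigma_finite_measure set T1 -> \bar R})
  (m2 : {sigma_finite_measure set T2 -> \bar R}).

Definition sigma_finite_product : set (T1 * T2) -> \bar R := (m1 \x m2)%E.

HB.instance Definition _ := Measure.on sigma_finite_product.

Lemma sigma_finite_productT : sigma_finite setT sigma_finite_product.
Proof.
have /sigma_finiteP[F [TF ndF Foo]] := sigma_finiteT m1.
have /sigma_finiteP[G [TG ndG Goo]] := sigma_finiteT m2.
exists (fun n => F n `*` G n).
  rewrite -setXTT TF TG predeqE => -[x y]; split.
    move=> [/= [n _ Fnx] [k _ Gky]]; exists (maxn n k) => //; split.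
      exact: (subsetPset _ _ (ndF _ _ (leq_maxl n k))).
    exact: (subsetPset _ _ (ndG _ _ (leq_maxr n k))).
  by move=> [n _ []/= ? ?]; split; exists n.
move=> k; have [mF Fk] := Foo k; have [mG Gk] := Goo k.
split; first exact: measurableX.
by rewrite /sigma_finite_product product_measure1E// lte_mul_pinfty// ge0_fin_numE.
Qed.

HB.instance Definition _ := Measure_isSigmaFinite.Build _ _ _
  sigma_finite_product sigma_finite_productT.

End SigmaFiniteProduct.

Notation "m1 \xs m2" := (sigma_finite_product m1 m2) (at level 40, left associativity) : ereal_scope.

Section IntegrationComplements.
Context d1 d2 (T1 : measurableType d1) (T2 : measurableType d2) (R : realType).
Variables (m1 : {sigma_finite_measure set T1 -> \bar R})
  (m2 : {sigma_finite_measure set T2 -> \bar R}).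

Lemma integrable_mul_bounded (m : {measure set T1 -> \bar R}) (f g : T1 -> R)
    (M : R) : m.-integrable setT (EFin \o f) -> measurable_fun setT g ->
    (forall x, `|g x| <= M) ->
  m.-integrable setT (EFin \o (fun x => f x * g x)).
Proof.
move=> fi mg gM; have M0 : 0 <= M := le_trans (normr_ge0 _) (gM point).
have /integrableP[mf _] := fi.
apply: (@le_integrable _ _ _ _ _ _ _ (fun x => M%:E * (EFin \o f) x)%E) => //.
- by apply/measurable_EFinP; apply: measurable_funM => //; exact/measurable_EFinP.
- move=> x _ /=; rewrite lee_fin !normrM mulrC ler_wpM2r//.
  by rewrite (le_trans (gM x))// ler_norm.
- exact: integrableZl.
Qed.

Lemma ge0_integrable_prod (f : T1 * T2 -> R) :
  measurable_fun setT f -> (forall z, 0 <= f z) ->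
  (\int[m1 \xs m2]_z (f z)%:E < +oo)%E ->
  (m1 \xs m2)%E.-integrable setT (EFin \o f).
Proof.
move=> mf f0 foo; apply/integrableP; split; first exact/measurable_EFinP.
by under eq_integral => z _ do rewrite /= ger0_norm//.
Qed.

Lemma Rintegral_prod_eq0l (F : T1 * T2 -> R) :
  (m1 \xs m2)%E.-integrable setT (EFin \o F) ->
  (forall x, \int[m2]_y F (x, y) = 0) ->
  (forall x, m2.-integrable setT (EFin \o (fun y => F (x, y)))) ->
  \int[(m1 \xs m2)%E]_z F z = 0.
Proof.
move=> Fi F0 F1; rewrite /Rintegral -integral12_prod_meas1//.
rewrite integral0_eq// => x _; rewrite /fubini_F.
rewrite -[LHS]fineK; last by exact: (integrable_fin_num measurableT (F1 x)).
by congr EFin; exact: F0.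
Qed.

Lemma Rintegral_prod_eq0r (F : T1 * T2 -> R) :
  (m1 \xs m2)%E.-integrable setT (EFin \o F) ->
  (forall y, \int[m1]_x F (x, y) = 0) ->
  (forall y, m1.-integrable setT (EFin \o (fun x => F (x, y)))) ->
  \int[(m1 \xs m2)%E]_z F z = 0.
Proof.
move=> Fi F0 F1; rewrite /Rintegral -integral21_prod_meas1//.
rewrite integral0_eq// => x _; rewrite /fubini_G.
rewrite -[LHS]fineK; last by exact: (integrable_fin_num measurableT (F1 x)).
by congr EFin; exact: F0.
Qed.

Lemma integrable_prod_mul (f : T1 -> R) (g : T2 -> R) :
  m1.-integrable setT (EFin \o f) -> m2.-integrable setT (EFin \o g) ->
  (m1 \xs m2)%E.-integrable setT (EFin \o (fun z => f z.1 * g z.2)).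
Proof.
move=> fi gi; have /integrableP[mf foo] := fi; have /integrableP[mg goo] := gi.
have mfg : measurable_fun setT (fun z : T1 * T2 => f z.1 * g z.2).
  apply: measurable_funM.
    by apply: (measurableT_comp _ measurable_fst); exact/measurable_EFinP.
  by apply: (measurableT_comp _ measurable_snd); exact/measurable_EFinP.
apply/integrable12ltyP; first exact/measurable_EFinP.
under eq_integral => x _.
  rewrite (_ : (\int[m2]_y _ = `|f x|%:E * \int[m2]_y `|(EFin \o g) y|)%E); last first.
    rewrite -ge0_integralZl//; last exact: (measurableT_comp _ mg).
    by apply: eq_integral => y _; rewrite /= normrM EFinM.
  over.
rewrite ge0_integralZr//.
- apply: lte_mul_pinfty => //; first exact: integral_ge0.
  by rewrite ge0_fin_numE//; exact: integral_ge0.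
- by apply/measurable_EFinP; apply: measurableT_comp => //; exact/measurable_EFinP.
- exact: integral_ge0.
Qed.

Lemma Rintegral_prod_mul (f : T1 -> R) (g : T2 -> R) :
  m1.-integrable setT (EFin \o f) -> m2.-integrable setT (EFin \o g) ->
  \int[(m1 \xs m2)%E]_z (f z.1 * g z.2)
  = (\int[m1]_x f x) * (\int[m2]_y g y).
Proof.
move=> fi gi; rewrite {1}/Rintegral -(integral12_prod_meas1 (integrable_prod_mul fi gi)).
rewrite /fubini_F/=.
transitivity (\int[m1]_x (f x * \int[m2]_y g y)); last by rewrite RintegralZr.
congr fine; apply: eq_integral => x _ /=.
rewrite -RintegralZl// /Rintegral fineK//.
exact: (integrable_fin_num measurableT (integrableZl measurableT (f x) gi)).
Qed.

End IntegrationComplements.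

Lemma ge0_integral_prod_swap d (T : measurableType d) (R : realType)
    (m : {sigma_finite_measure set T -> \bar R}) (h : T * T -> \bar R) :
  measurable_fun setT h -> (forall z, 0 <= h z)%E ->
  (\int[m \xs m]_z h (z.2, z.1) = \int[m \xs m]_z h z)%E.
Proof.
move=> mh h0; rewrite [RHS]fubini_tonelli1// fubini_tonelli2//.
apply: (measurableT_comp mh); apply: measurable_fun_pair.
  exact: measurable_snd.
exact: measurable_fst.
Qed.

(** * Upper bounds for integrals of nonnegative functions *)

Section IntegralBound.
Context d (T : measurableType d) (R : realType).

(** Measurability and sign travel with the bound, so that the side conditions of Tonelli's theorem
    are paid once; since [a] is a real number, integrability follows. *)
Definition integral_le (m : set T -> \bar R) (f : T -> R) (a : R) :=
  [/\ measurable_fun setT f, (forall x, 0 <= f x) & (\int[m]_x (f x)%:E <= a%:E)%E].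

Variable m : {measure set T -> \bar R}.

Lemma integral_leD f g a b : integral_le m f a -> integral_le m g b ->
  integral_le m (fun x => f x + g x) (a + b).
Proof.
move=> [mf f0 fa] [mg g0 gb]; split; first exact: measurable_funD.
  by move=> x; rewrite addr_ge0.
under eq_integral => x _ do rewrite EFinD.
rewrite ge0_integralD//; [by rewrite EFinD leeD|by move=> x _; rewrite lee_fin|
  exact/measurable_EFinP|by move=> x _; rewrite lee_fin|exact/measurable_EFinP].
Qed.

Lemma integral_leZ c f a : 0 <= c -> integral_le m f a ->
  integral_le m (fun x => c * f x) (c * a).
Proof.
move=> c0 [mf f0 fa]; split; first exact: measurable_funM.
  by move=> x; rewrite mulr_ge0.
under eq_integral => x _ do rewrite EFinM.
rewrite ge0_integralZl//; last 2 first.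
- exact/measurable_EFinP.
- by move=> x _; rewrite lee_fin.
by rewrite EFinM lee_wpmul2l.
Qed.

Lemma integral_le_le (f g : T -> R) a : measurable_fun setT f -> (forall x, 0 <= f x) ->
  (forall x, f x <= g x) -> integral_le m g a -> integral_le m f a.
Proof.
move=> mf f0 fg [mg g0 ga]; split => //; apply: le_trans ga.
apply: ge0_le_integral => //.
- by move=> x _; rewrite lee_fin.
- exact/measurable_EFinP.
- exact/measurable_EFinP.
- by move=> x _; rewrite lee_fin.
Qed.

Lemma integral_le_integrable f a : integral_le m f a ->
  m.-integrable setT (EFin \o f).
Proof.
move=> [mf f0 fa]; apply/integrableP; split; first exact/measurable_EFinP.
under eq_integral => z _ do rewrite /= ger0_norm//.
by rewrite (le_lt_trans fa)// ltry.
Qed.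

Lemma integral_le_Rintegral f a : integral_le m f a -> \int[m]_x f x <= a.
Proof.
move=> fa; have fi := integral_le_integrable fa; case: fa => _ _.
by rewrite -lee_fin fineK//; exact: (integrable_fin_num measurableT fi).
Qed.

End IntegralBound.

Section IntegralBoundProduct.
Context d (T : measurableType d) d' (T' : measurableType d') (R : realType).
Variables (m : {sigma_finite_measure set T -> \bar R})
  (m' : {sigma_finite_measure set T' -> \bar R}).

(** Tonelli with the inner integral replaced by a majorant, so that inner integrals need not be
    computed. *)
Lemma integral_le_prod (h : T * T' -> R) (G : T -> R) a :
  measurable_fun setT h -> (forall x, integral_le m' (fun y => h (x, y)) (G x)) ->
  integral_le m G a -> integral_le (m \xs m')%E h a.
Proof.
move=> mh hG [mG G0 Ga]; have h0 z : 0 <= h z by case: z => x y; case: (hG x).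
split => //; rewrite fubini_tonelli1//; last exact/measurable_EFinP.
apply: le_trans Ga; apply: ge0_le_integral => //.
- by move=> x _; apply: integral_ge0 => y _; rewrite lee_fin.
- apply: (measurable_fun_fubini_tonelli_F (EFin \o h)) => //.
  exact/measurable_EFinP.
- exact/measurable_EFinP.
- by move=> x _; case: (hG x).
Qed.

(** The inner bound is uniform in the outer point; iterating this integrates out a chain of kernels
    point by point and multiplies the bounds. *)
Lemma integral_le_mul (a : T -> R) (b : T * T' -> R) A B :
  measurable_fun setT b -> 0 <= B ->
  integral_le m a A -> (forall x, integral_le m' (fun y => b (x, y)) B) ->
  integral_le (m \xs m')%E (fun z => a z.1 * b z) (A * B).
Proof.
move=> mb B0 aA bB; apply: (@integral_le_prod _ (fun x => a x * B)).
- apply: measurable_funM => //; case: aA => ma _ _.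
  exact: (measurableT_comp ma measurable_fst).
- by move=> x /=; apply: integral_leZ => //; case: aA.
- rewrite (_ : (fun x => a x * B) = (fun x => B * a x)); last first.
    by apply/funext => x; rewrite mulrC.
  by rewrite mulrC; apply: integral_leZ.
Qed.

End IntegralBoundProduct.

Section IntegralBoundTriple.
Context d (T : measurableType d) (R : realType).
Variables (m : {sigma_finite_measure set T -> \bar R}).

Lemma integral_le_swap (h : T * T -> R) a : integral_le (m \xs m)%E h a ->
  integral_le (m \xs m)%E (fun z => h (z.2, z.1)) a.
Proof.
move=> [mh h0 ha]; split => //.
  apply: (measurableT_comp mh); apply: measurable_fun_pair.
    exact: measurable_snd.
  exact: measurable_fst.
rewrite (@ge0_integral_prod_swap _ _ _ m (EFin \o h))//.
exact/measurable_EFinP.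
Qed.

(** In the nesting [(x, (y, z))] the pair [(x, y)] is not a factor of the product, so
    [integral_le_prod] does not integrate out [z] directly; Tonelli is opened on both sides
    instead. *)
Lemma integral_le_triple (h : T * (T * T) -> R) (k : T * T -> R) a :
  measurable_fun setT h ->
  (forall x y, integral_le m (fun z => h (x, (y, z))) (k (x, y))) ->
  integral_le (m \xs m)%E k a -> integral_le (m \xs (m \xs m))%E h a.
Proof.
move=> mh hk [mk k0 ka].
have h0 v : 0 <= h v by case: v => x [y z]; case: (hk x y).
split => //; apply: le_trans ka.
have mEh : measurable_fun setT (EFin \o h) by exact/measurable_EFinP.
have mEk : measurable_fun setT (EFin \o k) by exact/measurable_EFinP.
have E0 v : (0 <= (EFin \o h) v)%E by rewrite lee_fin.
have K0 v : (0 <= (EFin \o k) v)%E by rewrite lee_fin.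
rewrite fubini_tonelli1// [leRHS]fubini_tonelli1//.
apply: ge0_le_integral => //.
- by move=> x _; rewrite /fubini_F; apply: integral_ge0 => y _; exact: E0.
- exact: (measurable_fun_fubini_tonelli_F (EFin \o h)).
- exact: (measurable_fun_fubini_tonelli_F (EFin \o k)).
move=> x _; rewrite /fubini_F.
have mhx : measurable_fun setT (fun y => (EFin \o h) (x, y)).
  by apply: (measurableT_comp mEh); apply: measurable_fun_pair.
rewrite fubini_tonelli1//; last by move=> y; exact: E0.
apply: ge0_le_integral => //.
- by move=> y _; rewrite /fubini_F; apply: integral_ge0 => z _; exact: E0.
- exact: (measurable_fun_fubini_tonelli_F (fun y => (EFin \o h) (x, y))).
- by apply: (measurableT_comp mEk); apply: measurable_fun_pair.
- by move=> y _; case: (hk x y).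
Qed.

Lemma integral_le_triple_swap (h : T * (T * T) -> R) a :
  integral_le (m \xs (m \xs m))%E h a ->
  integral_le (m \xs (m \xs m))%E (fun v => h (v.1, (v.2.2, v.2.1))) a.
Proof.
move=> [mh h0 ha].
have mEh : measurable_fun setT (EFin \o h) by exact/measurable_EFinP.
have mh' : measurable_fun setT (fun v : T * (T * T) => h (v.1, (v.2.2, v.2.1))).
  apply: (measurableT_comp mh); apply: measurable_fun_pair => //.
  apply: measurable_fun_pair.
    exact: (measurableT_comp measurable_snd measurable_snd).
  exact: (measurableT_comp measurable_fst measurable_snd).
split => //; apply: le_trans ha.
have E0 v : (0 <= (EFin \o h) v)%E by rewrite lee_fin.
rewrite (fubini_tonelli1 (fun v => (h (v.1, (v.2.2, v.2.1)))%:E))//; last 2 first.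
- exact/measurable_EFinP.
- by move=> v; exact: E0.
rewrite [leRHS](fubini_tonelli1 (EFin \o h))//.
rewrite le_eqVlt; apply/orP; left; apply/eqP; apply: eq_integral => x _.
rewrite /fubini_F/= (@ge0_integral_prod_swap _ _ _ m (fun z => (EFin \o h) (x, z)))//.
by apply: (measurableT_comp mEh); apply: measurable_fun_pair.
Qed.

End IntegralBoundTriple.

(** * Changes of variables and periodicity in the plane *)

Section PlaneIntegrals.
Context {R : realType}.
Local Notation mu := (@lebesgue_measure R).
Local Notation leb2 := (mu \xs mu)%E.
Implicit Types (h : R * R -> \bar R) (k : R -> \bar R).

Lemma ge0_integral_plane h :
  measurable_fun setT h -> (forall z, 0 <= h z)%E ->
  (\int[leb2]_z h z = \int[mu]_x \int[mu]_y h (x, y))%E.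
Proof. by move=> mh h0; rewrite fubini_tonelli1. Qed.

Lemma measurable_pair1 h (x : R) :
  measurable_fun setT h -> measurable_fun setT (fun y => h (x, y)).
Proof. by move=> mh; apply: (measurableT_comp mh); exact: measurable_pair1. Qed.

Lemma measurable_square N : measurable (@square R N).
Proof.
rewrite (_ : @square R N = `[0, N%:R]%classic `*` `[0, N%:R]%classic).
  exact: measurableX.
by apply/seteqP; split => -[x y]; rewrite /square/= !in_itv.
Qed.

Lemma ge0_integral_square N h :
  measurable_fun setT h -> (forall z, 0 <= h z)%E ->
  (\int[leb2]_(z in @square R N) h z
   = \int[mu]_(x in `[0%R, N%:R]) \int[mu]_(y in `[0%R, N%:R]) h (x, y))%E.
Proof.
move=> mh h0; rewrite integral_mkcond ge0_integral_plane; last 2 first.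
- apply/(measurable_restrictT _ _).1; first exact: measurable_square.
  exact: measurable_funTS.
- by move=> z; rewrite patchE; case: ifP.
rewrite [RHS]integral_mkcond; apply: eq_integral => x _.
rewrite patchE; case: ifPn => [|xN].
  rewrite inE/= in_itv/= => xN; rewrite [RHS]integral_mkcond.
  apply: eq_integral => y _; rewrite !patchE.
  rewrite (_ : ((x, y) \in square N) = (y \in `[0, N%:R]%classic))//.
  by apply/idP/idP; rewrite !inE/= in_itv /square/= xN; [case|].
rewrite integral0_eq// => y _; rewrite patchE ifF//.
apply/negbTE; apply: contra xN; rewrite !inE/= in_itv /square/=.
by case.
Qed.

Lemma ge0_integral_plane_affine (c a b : R) h : 0 < c ->
  measurable_fun setT h -> (forall z, 0 <= h z)%E ->
  (\int[leb2]_z h (c * z.1 + a, c * z.2 + b)%R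
   = (c^-1 ^+ 2)%:E * \int[leb2]_z h z)%E.
Proof.
move=> c0 mh h0.
have maff (s : R) : measurable_fun setT (fun x : R => c * x + s).
  by apply: measurable_funD => //; apply: measurable_funM.
rewrite ge0_integral_plane//; last first.
  apply: (measurableT_comp mh); apply/measurable_fun_pairP; split => /=.
    exact: (measurableT_comp (maff a)).
  exact: (measurableT_comp (maff b)).
under eq_integral => x _.
  rewrite /= (@ge0_integral_affine _ c b (fun y => h (c * x + a, y)))//; last first.
    exact: measurable_pair1.
  over.
have mF : measurable_fun setT (fun x => \int[mu]_y h (x, y))%E.
  exact: (@measurable_fun_fubini_tonelli_F _ _ _ _ _ mu h mh h0).
have F0 x : (0 <= \int[mu]_y h (x, y))%E by exact: integral_ge0.
rewrite ge0_integralZl//; last 2 first.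
- exact: (measurableT_comp mF (maff a)).
- by rewrite lee_fin invr_ge0 ltW.
rewrite (@ge0_integral_affine _ c a (fun x => \int[mu]_y h (x, y))%E)//.
by rewrite muleA -EFinM -expr2 ge0_integral_plane.
Qed.

Lemma ge0_integral_plane_sub (a : R * R) h :
  measurable_fun setT h -> (forall z, 0 <= h z)%E ->
  (\int[leb2]_z h (a - z)%R = \int[leb2]_z h z)%E.
Proof.
move=> mh h0.
rewrite ge0_integral_plane//; last first.
  apply: (measurableT_comp mh); apply/measurable_fun_pairP; split => /=;
  by apply: measurable_funB.
under eq_integral => x _.
  rewrite (@ge0_integral_sub _ a.2 (fun y => h (a.1 - x, y)))//; last first.
    exact: measurable_pair1.
  over.
have mF : measurable_fun setT (fun x => \int[mu]_y h (x, y))%E.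
  exact: (@measurable_fun_fubini_tonelli_F _ _ _ _ _ mu h mh h0).
rewrite (@ge0_integral_sub _ a.1 (fun x => \int[mu]_y h (x, y))%E)//; last first.
  by move=> x; exact: integral_ge0.
by rewrite ge0_integral_plane.
Qed.

Lemma ge0_integral_plane_mul (k1 k2 : R -> R) :
  measurable_fun setT k1 -> (forall x, 0 <= k1 x) ->
  measurable_fun setT k2 -> (forall x, 0 <= k2 x) ->
  (\int[leb2]_z (k1 z.1 * k2 z.2)%:E
   = (\int[mu]_x (k1 x)%:E) * \int[mu]_x (k2 x)%:E)%E.
Proof.
move=> mk1 k10 mk2 k20; rewrite ge0_integral_plane; last 2 first.
- apply/measurable_EFinP; apply: measurable_funM.
    exact: (measurableT_comp mk1).
  exact: (measurableT_comp mk2).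
- by move=> z; rewrite lee_fin mulr_ge0.
transitivity (\int[mu]_x ((k1 x)%:E * \int[mu]_y (k2 y)%:E))%E.
  apply: eq_integral => x _; rewrite -ge0_integralZl//; last 3 first.
  - exact/measurable_EFinP.
  - by move=> y _; rewrite lee_fin.
  - by rewrite lee_fin.
rewrite ge0_integralZr//.
- exact/measurable_EFinP.
- by move=> x _; rewrite lee_fin.
- by apply: integral_ge0 => x _; rewrite lee_fin.
Qed.

Lemma ge0_integral_square_periodic (N : nat) (a : R * R) h : (0 < N)%N ->
  measurable_fun setT h -> (forall z, 0 <= h z)%E ->
  (forall z l : R * R, lattice N l -> h (z + l) = h z) ->
  (\int[leb2]_(z in @square R N) h (a - z)%R
   = \int[leb2]_(z in @square R N) h z)%E.
Proof.
move=> N0 mh h0 hN; have N0' : 0 < N%:R :> R by rewrite ltr0n.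
rewrite ge0_integral_square//; last first.
  apply: (measurableT_comp mh); apply/measurable_fun_pairP; split => /=;
  by apply: measurable_funB.
under eq_integral => x _.
  rewrite (@ge0_integral_periodic_sub _ N%:R a.2 (fun y => h (a.1 - x, y)))//; last 2 first.
  - exact: measurable_pair1.
  - move=> n y; rewrite -(hN (a.1 - x, y) (0, n%:~R * N%:R)); last first.
      by exists 0, n; rewrite mul0r.
    by congr h; congr pair; rewrite /= addr0.
  over.
have mF : measurable_fun setT (fun x => \int[mu]_(y in `[0%R, N%:R]) h (x, y))%E.
  (* Restricting [h] to a horizontal strip turns the integral over an interval into an integral over
     a whole section, whose measurability is part of Tonelli's theorem. *)
  rewrite (_ : (fun _ => _) = (fun x => \int[mu]_y (h \_ (setT `*` `[0%R, N%:R])) (x, y)))%E.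
    apply: (measurable_fun_fubini_tonelli_F (m2 := mu)).
      apply/(measurable_restrictT _ _).1; first exact: measurableX.
      exact: measurable_funTS.
    by move=> z; rewrite patchE; case: ifP.
  apply/funext => x; rewrite integral_mkcond; apply: eq_integral => y _.
  rewrite !patchE; congr (if _ then _ else _).
  by apply/idP/idP; rewrite !inE//=; case.
rewrite (@ge0_integral_periodic_sub _ N%:R a.1
  (fun x => \int[mu]_(y in `[0%R, N%:R]) h (x, y))%E)//; last 2 first.
- by move=> x; exact: integral_ge0.
- move=> n x; apply: eq_integral => y _.
  rewrite -(hN (x, y) (n%:~R * N%:R, 0)); last first.
    by exists n, 0; rewrite mul0r.
  by congr h; congr pair; rewrite /= addr0.
by rewrite ge0_integral_square.
Qed.

Lemma ge0_integral_square_scale (N : nat) h : (0 < N)%N ->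
  measurable_fun setT h -> (forall z, 0 <= h z)%E ->
  (\int[leb2]_(z in @square R N) h (z.1 / N%:R, z.2 / N%:R)%R
   = (N%:R ^+ 2)%:E * \int[leb2]_(z in @square R 1) h z)%E.
Proof.
move=> N0 mh h0; have N0' : 0 < N%:R :> R by rewrite ltr0n.
rewrite integral_mkcond [in RHS]integral_mkcond.
rewrite -[N%:R in X in (X%:E * _)%E](invrK N%:R) -(ge0_integral_plane_affine 0 0) ?invr_gt0//.
- apply: eq_integral => z _; rewrite !patchE !addr0 ![N%:R^-1 * _]mulrC.
  congr (if _ then _ else _).
  by apply/idP/idP; rewrite !inE/square/= !ler_pdivrMr// !mul1r !(pmulr_lge0 _ (_ : 0 < N%:R^-1)) ?invr_gt0.
- apply/(measurable_restrictT _ _).1; first exact: measurable_square.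
  exact: measurable_funTS.
- by move=> z; rewrite patchE; case: ifP.
Qed.

End PlaneIntegrals.

(** * Correlation functions of the Ginibre process *)

Section SmallDeterminants.
Context {S : comNzRingType}.
Implicit Types F : nat -> nat -> S.

Let D n F := \det (\matrix_(i < n, j < n) F i j).

(** Entries given by a function on [nat] are stable under cofactor expansion: a minor is again of
    this form, so the expansion iterates down to size 0. *)
Let DS n F : D n.+1 F
  = \sum_(j < n.+1) (-1) ^+ j * F 0 j * D n (fun i k => F i.+1 (bump j k)).
Proof.
rewrite /D (expand_det_row _ ord0); apply: eq_bigr => j _.
rewrite mxE /cofactor add0n mulrCA mulrA; congr (_ * \det _).
by apply/matrixP => i k; rewrite !mxE.
Qed.

Let D2 F : D 2 F = F 0 0 * F 1 1 - F 0 1 * F 1 0.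
Proof.
have D0 G : D 0 G = 1 by exact: det_mx00.
rewrite DS !big_ord_recl big_ord0 !DS !big_ord_recl !big_ord0 !D0 /= /bump /=; ring.
Qed.

Let D3 F : D 3 F =
  F 0 0 * (F 1 1 * F 2 2 - F 1 2 * F 2 1)
  - F 0 1 * (F 1 0 * F 2 2 - F 1 2 * F 2 0)
  + F 0 2 * (F 1 0 * F 2 1 - F 1 1 * F 2 0).
Proof. by rewrite DS !big_ord_recl big_ord0 !D2 /= /bump /=; ring. Qed.

Lemma det_mx_nat2 F :
  \det (\matrix_(i < 2, j < 2) F i j) = F 0 0 * F 1 1 - F 0 1 * F 1 0.
Proof. exact: D2. Qed.

Lemma det_mx_nat3 F :
  \det (\matrix_(i < 3, j < 3) F i j) =
  F 0 0 * (F 1 1 * F 2 2 - F 1 2 * F 2 1)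
  - F 0 1 * (F 1 0 * F 2 2 - F 1 2 * F 2 0)
  + F 0 2 * (F 1 0 * F 2 1 - F 1 1 * F 2 0).
Proof. exact: D3. Qed.

Lemma det_mx_nat4 F :
  let D a b c := F 1 a * (F 2 b * F 3 c - F 2 c * F 3 b)
    - F 1 b * (F 2 a * F 3 c - F 2 c * F 3 a)
    + F 1 c * (F 2 a * F 3 b - F 2 b * F 3 a) in
  \det (\matrix_(i < 4, j < 4) F i j) =
  F 0 0 * D 1 2 3 - F 0 1 * D 0 2 3 + F 0 2 * D 0 1 3 - F 0 3 * D 0 1 2.
Proof.
by rewrite -/(D 4 F) DS !big_ord_recl big_ord0 !D3 /= /bump /=; ring.
Qed.

End SmallDeterminants.

Section GinibreKernel.
Context {R : realType}.
Implicit Types x y z : R * R.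

Definition gauss2 (c : R) (z : R * R) : R := expR (- (c * (z.1 ^+ 2 + z.2 ^+ 2))).

(** This is [pi] times the imaginary part of [x y^*], an argument of the kernel, whose modulus is
    the Gaussian of parameter [pi / 2]. *)
Definition ginibre_phase x y : R := pi * (x.2 * y.1 - x.1 * y.2).

Local Notation p x y := (gauss2 (pi / 2) (x - y)).
Local Notation t := ginibre_phase.

Lemma ginibre_kernelE x y : ginibre_kernel (toC x) (toC y) =
  ((p x y * cos (t x y)) +i* (p x y * sin (t x y)))%C.
Proof.
case: x y => [a b] [c e]; rewrite /ginibre_kernel /toC /gauss2 /ginibre_phase/=.
rewrite !normCK /cexp.
set w := - _ * _.
have -> : complex.Re w = - (pi / 2 * ((a - c) ^+ 2 + (b - e) ^+ 2)).
  by rewrite /w/=; field.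
have -> : complex.Im w = pi * (b * c - a * e).
  by rewrite /w/=; field.
by apply/eqP; rewrite eq_complex/=; apply/andP; split; apply/eqP; ring.
Qed.

Lemma ginibre_phaseC x y : t y x = - t x y.
Proof. by rewrite /ginibre_phase; ring. Qed.

Lemma ginibre_phasexx x : t x x = 0.
Proof. by rewrite /ginibre_phase; ring. Qed.

Lemma gauss2N c z : gauss2 c (- z) = gauss2 c z.
Proof. by rewrite /gauss2/= !sqrrN. Qed.

Lemma gauss2C c x y : gauss2 c (x - y) = gauss2 c (y - x).
Proof. by rewrite -gauss2N opprB. Qed.

Lemma gauss20 c : gauss2 c 0 = 1.
Proof. by rewrite /gauss2/= expr0n addr0 mulr0 oppr0 expR0. Qed.

Lemma gauss2_ge0 c z : 0 <= gauss2 c z. Proof. exact: expR_ge0. Qed.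

Lemma gauss2X c z n : gauss2 c z ^+ n = gauss2 (n%:R * c) z.
Proof. by rewrite /gauss2 -expRM_natl; congr expR; rewrite mulrN mulrA. Qed.

Lemma ginibre_kernelxx x : ginibre_kernel (toC x) (toC x) = 1.
Proof.
rewrite ginibre_kernelE subrr gauss20 ginibre_phasexx cos0 sin0.
by rewrite !mul1r.
Qed.

Lemma ginibre_kernelC x y : ginibre_kernel (toC y) (toC x) =
  ((p x y * cos (t x y)) -i* (p x y * sin (t x y)))%C.
Proof.
by rewrite ginibre_kernelE gauss2C ginibre_phaseC cosN sinN mulrN.
Qed.

(** The real part of [K (x, y) K (y, z) K (z, x)]. The kernel is Hermitian, so the two orientations
    of a cycle are conjugate and together contribute twice this number. *)
Definition cycle3 x y z : R := p x y * p y z * p z x * cos (t x y + t y z + t z x).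

Definition cycle4 x y z w : R :=
  p x y * p y z * p z w * p w x * cos (t x y + t y z + t z w + t w x).

Lemma cycle3_le x y z : `|cycle3 x y z| <= p x y * p y z * p z x.
Proof.
rewrite /cycle3 normrM ger0_norm ?mulr_ge0 ?gauss2_ge0//.
rewrite ler_piMr ?mulr_ge0 ?gauss2_ge0//.
by rewrite ler_norml cos_geN1 cos_le1.
Qed.

Lemma cycle4_le x y z w : `|cycle4 x y z w| <= p x y * p y z * p z w * p w x.
Proof.
rewrite /cycle4 normrM ger0_norm ?mulr_ge0 ?gauss2_ge0//.
rewrite ler_piMr ?mulr_ge0 ?gauss2_ge0//.
by rewrite ler_norml cos_geN1 cos_le1.
Qed.

(** Used from right to left: once squared moduli are split this way, both sides of a determinant
    identity are polynomials in moduli, cosines and sines, and [ring] compares them. *)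
Let sq1 (u v : R) : (u * cos v) ^+ 2 + (u * sin v) ^+ 2 = u ^+ 2.
Proof. by rewrite !exprMn -mulrDr cos2Dsin2 mulr1. Qed.

Lemma ginibre_rho2 (rho : R) x y :
  rho%:C%C = \det (\matrix_(i < 2, j < 2)
     ginibre_kernel (toC (tnth [tuple x; y] i)) (toC (tnth [tuple x; y] j))) ->
  rho = 1 - p x y ^+ 2.
Proof.
under eq_mx do rewrite !(tnth_nth x).
rewrite (det_mx_nat2 (fun i j => ginibre_kernel (toC (nth x [:: x; y] i)) (toC (nth x [:: x; y] j)))) /=.
rewrite !ginibre_kernelxx (ginibre_kernelC x y) (ginibre_kernelE x y).
move=> /(congr1 (@complex.Re R))/= ->; rewrite -(sq1 (p x y) (t x y)); ring.
Qed.

Lemma ginibre_rho3 (rho : R) x y z :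
  rho%:C%C = \det (\matrix_(i < 3, j < 3)
     ginibre_kernel (toC (tnth [tuple x; y; z] i)) (toC (tnth [tuple x; y; z] j))) ->
  rho = 1 - p x y ^+ 2 - p x z ^+ 2 - p y z ^+ 2 + 2 * cycle3 x y z.
Proof.
under eq_mx do rewrite !(tnth_nth x).
rewrite (det_mx_nat3 (fun i j => ginibre_kernel (toC (nth x [:: x; y; z] i)) (toC (nth x [:: x; y; z] j)))) /=.
rewrite !ginibre_kernelxx (ginibre_kernelC x y) (ginibre_kernelE x y).
rewrite (ginibre_kernelC x z) (ginibre_kernelE x z) (ginibre_kernelC y z) (ginibre_kernelE y z).
move=> /(congr1 (@complex.Re R))/= ->.
rewrite -(sq1 (p x y) (t x y)) -(sq1 (p x z) (t x z)) -(sq1 (p y z) (t y z)).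
rewrite /cycle3 (gauss2C _ z x) (ginibre_phaseC x z) !(cosD, sinD) cosN sinN; ring.
Qed.

(** Expansion by cycle type: six transpositions, eight 3-cycles in four conjugate pairs, three
    double transpositions and six 4-cycles in three conjugate pairs, each with the sign of the
    permutation. *)
Lemma ginibre_rho4 (rho : R) x y z w :
  rho%:C%C = \det (\matrix_(i < 4, j < 4)
     ginibre_kernel (toC (tnth [tuple x; y; z; w] i)) (toC (tnth [tuple x; y; z; w] j))) ->
  rho = 1 - p x y ^+ 2 - p x z ^+ 2 - p x w ^+ 2 - p y z ^+ 2 - p y w ^+ 2 - p z w ^+ 2
   + 2 * (cycle3 x y z + cycle3 x y w + cycle3 x z w + cycle3 y z w)
   + p x y ^+ 2 * p z w ^+ 2 + p x z ^+ 2 * p y w ^+ 2 + p x w ^+ 2 * p y z ^+ 2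
   - 2 * (cycle4 x y z w + cycle4 x y w z + cycle4 x z y w).
Proof.
under eq_mx do rewrite !(tnth_nth x).
rewrite (det_mx_nat4 (fun i j => ginibre_kernel (toC (nth x [:: x; y; z; w] i)) (toC (nth x [:: x; y; z; w] j)))) /=.
rewrite !ginibre_kernelxx (ginibre_kernelC x y) (ginibre_kernelE x y).
rewrite (ginibre_kernelC x z) (ginibre_kernelE x z) (ginibre_kernelC y z) (ginibre_kernelE y z).
rewrite (ginibre_kernelC x w) (ginibre_kernelE x w) (ginibre_kernelC y w) (ginibre_kernelE y w).
rewrite (ginibre_kernelC z w) (ginibre_kernelE z w).
move=> /(congr1 (@complex.Re R))/= ->.
rewrite -(sq1 (p x y) (t x y)) -(sq1 (p x z) (t x z)) -(sq1 (p y z) (t y z)).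
rewrite -(sq1 (p x w) (t x w)) -(sq1 (p y w) (t y w)) -(sq1 (p z w) (t z w)).
rewrite /cycle3 /cycle4 (gauss2C _ z x) (ginibre_phaseC x z) (gauss2C _ w x) (ginibre_phaseC x w).
rewrite (gauss2C _ z y) (ginibre_phaseC y z) (gauss2C _ w y) (ginibre_phaseC y w).
rewrite (gauss2C _ w z) (ginibre_phaseC z w).
rewrite !(cosD, sinD) !(cosN, sinN).
ring.
Qed.

End GinibreKernel.

(** * Gaussian integrals in the plane and near the sides of the square *)

Section PlaneGaussian.
Context {R : realType}.
Local Notation mu := (@lebesgue_measure R).
Local Notation leb2 := (mu \xs mu)%E.
Implicit Types x y z : R * R.

Lemma integral_expR_sqr (c : R) : 0 < c ->
  (\int[mu]_x (expR (- (c * x ^+ 2)))%:E = (Num.sqrt (pi / c))%:E)%E.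
Proof.
move=> c0; have sc0 : 0 < Num.sqrt c by rewrite sqrtr_gt0.
transitivity (\int[mu]_x (EFin \o gauss_fun) (Num.sqrt c * x + 0)%R)%E.
  apply: eq_integral => x _ /=; rewrite /gauss_fun addr0 exprMn sqr_sqrtr ?ltW//.
rewrite ge0_integral_affine//; last 2 first.
- by apply/measurable_EFinP; exact: measurable_gauss_fun.
- by move=> x; rewrite lee_fin gauss_fun_ge0.
by rewrite integralT_gauss -EFinM -sqrtrV ?ltW// -sqrtrM ?invr_ge0 ?ltW// mulrC.
Qed.

Lemma measurable_gauss2 (c : R) : measurable_fun setT (gauss2 c).
Proof.
apply: measurableT_comp => //; apply: measurable_funN.
apply: measurable_funM => //; apply: measurable_funD; apply: measurable_funX.
  exact: measurable_fst.
exact: measurable_snd.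
Qed.

Lemma gauss2_prod (c : R) z :
  gauss2 c z = expR (- (c * z.1 ^+ 2)) * expR (- (c * z.2 ^+ 2)).
Proof. by rewrite /gauss2 mulrDr opprD expRD. Qed.

Lemma measurable_expR_sqr (c : R) : measurable_fun setT (fun x : R => expR (- (c * x ^+ 2))).
Proof.
apply: measurableT_comp => //; apply: measurable_funN.
by apply: measurable_funM => //; apply: measurable_funX.
Qed.

Lemma integral_gauss2 (c : R) : 0 < c -> (\int[leb2]_z (gauss2 c z)%:E = (pi / c)%:E)%E.
Proof.
move=> c0; under eq_integral => z _ do rewrite gauss2_prod.
rewrite (@ge0_integral_plane_mul _ (fun u => expR (- (c * u ^+ 2))) (fun u => expR (- (c * u ^+ 2)))).
- rewrite integral_expR_sqr// -EFinM -expr2 sqr_sqrtr//.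
  by rewrite divr_ge0 ?pi_ge0// ltW.
- exact: measurable_expR_sqr.
- by move=> u; rewrite expR_ge0.
- exact: measurable_expR_sqr.
- by move=> u; rewrite expR_ge0.
Qed.

Lemma measurable_gauss2_sub (c : R) : measurable_fun setT (fun z : (R * R) * (R * R) => gauss2 c (z.1 - z.2)).
Proof.
apply: (measurableT_comp (measurable_gauss2 c)).
apply: measurable_fun_pair; apply: measurable_funB.
- exact: (measurableT_comp measurable_fst measurable_fst).
- exact: (measurableT_comp measurable_fst measurable_snd).
- exact: (measurableT_comp measurable_snd measurable_fst).
- exact: (measurableT_comp measurable_snd measurable_snd).
Qed.

Lemma measurable_plane_sub x : measurable_fun setT (fun y : R * R => x - y).
Proof. by apply: measurable_fun_pair; apply: measurable_funB. Qed.

Lemma integral_gauss2_sub (c : R) x : 0 < c ->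
  (\int[leb2]_y (gauss2 c (x - y))%:E = (pi / c)%:E)%E.
Proof.
move=> c0; rewrite (@ge0_integral_plane_sub _ x (EFin \o gauss2 c)).
- exact: integral_gauss2.
- by apply/measurable_EFinP; exact: measurable_gauss2.
- by move=> z; rewrite lee_fin gauss2_ge0.
Qed.

Lemma integral_le_gauss2 (c : R) x : 0 < c ->
  integral_le leb2 (fun y => gauss2 c (x - y)) (pi / c).
Proof.
move=> c0; split; last by rewrite integral_gauss2_sub.
- exact: (measurableT_comp (measurable_gauss2 c) (measurable_plane_sub x)).
- by move=> y; exact: gauss2_ge0.
Qed.

Lemma gauss2_le1 (c : R) z : 0 <= c -> gauss2 c z <= 1.
Proof.
move=> c0; by rewrite /gauss2 -expR0 ler_expR oppr_le0 mulr_ge0// addr_ge0 ?sqr_ge0.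
Qed.

(** The exponents compare by [|x - y|^2 <= 2 |x - z|^2 + 2 |z - y|^2]. Decay along a path through
    [z] is thus exchanged for decay between its end points. *)
Lemma gauss2_triangle (c : R) x y z : 0 <= c ->
  gauss2 c (x - z) ^+ 2 * gauss2 c (z - y) ^+ 2 <= gauss2 c (x - y).
Proof.
move=> c0; rewrite !gauss2X /gauss2 -expRD ler_expR/=.
rewrite -opprD lerN2 -!mulrA -!mulrDr mulrCA ler_wpM2l//.
have := sqr_ge0 ((x.1 - z.1) - (z.1 - y.1)).
have := sqr_ge0 ((x.2 - z.2) - (z.2 - y.2)).
rewrite -!/(_ ^+ 2); nra.
Qed.

(** Half of the Gaussian absorbs the quadratic factor, by [t <= exp t] for [t = c |z|^2]. *)
Lemma gauss2_sqr_le (c : R) z : 1 <= c ->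
  (z.1 ^+ 2 + z.2 ^+ 2) * gauss2 (2 * c) z <= gauss2 c z.
Proof.
move=> c1; rewrite /gauss2 -[leRHS]mul1r.
have -> : - (2 * c * (z.1 ^+ 2 + z.2 ^+ 2)) =
   - (c * (z.1 ^+ 2 + z.2 ^+ 2)) + - (c * (z.1 ^+ 2 + z.2 ^+ 2)) by ring.
rewrite expRD mulrA ler_wpM2r ?expR_ge0//.
rewrite expRN ler_pdivrMr ?expR_gt0// mul1r.
apply: le_trans (expR_ge1Dx _); rewrite -[leLHS]add0r lerD//.
by rewrite -[leLHS]mul1r ler_wpM2r ?addr_ge0 ?sqr_ge0.
Qed.

(** Gaussians of the distances to the four lines carrying the sides: not small only near these
    lines, so that the integral over the square has order [N] and not [N^2]. *)
Definition edge_weight (N : nat) z : R :=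
  let G u := expR (- (pi / 2 * u ^+ 2)) in
  G z.1 + G (z.1 - N%:R) + G z.2 + G (z.2 - N%:R).

Lemma edge_weight_ge0 N z : 0 <= edge_weight N z.
Proof. by rewrite !addr_ge0 ?expR_ge0. Qed.

Lemma measurable_edge_weight N : measurable_fun setT (edge_weight N).
Proof.
have mG := measurable_expR_sqr (pi / 2).
have mu1 : measurable_fun setT (fun z : R * R => z.1) by exact: measurable_fst.
have mu2 : measurable_fun setT (fun z : R * R => z.2) by exact: measurable_snd.
by rewrite /edge_weight/=; do !apply: measurable_funD;
  apply: (measurableT_comp mG) => //; apply: measurable_funB.
Qed.

(* A point [y] outside the square is at distance at least [min (x_i) (N - x_i)] from [x] in some coordinate [i]. *)
Lemma gauss2_pi_le_edge N x y : @square R N x ->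
  gauss2 pi (x - y) <= \1_(@square R N) y * gauss2 pi (x - y)
    + edge_weight N x * gauss2 (pi / 2) (x - y).
Proof.
move=> [/andP[x10 x1N] /andP[x20 x2N]].
case: (boolP (y \in @square R N)) => [|]yN; rewrite indicE.
  by rewrite yN mul1r lerDl mulr_ge0 ?gauss2_ge0 ?edge_weight_ge0.
rewrite (negbTE yN) mul0r add0r.
have -> : gauss2 pi (x - y) = gauss2 (pi / 2) (x - y) * gauss2 (pi / 2) (x - y).
  by rewrite -expr2 gauss2X mulrC divfK.
rewrite ler_wpM2r ?gauss2_ge0//.
have pi20 : 0 <= pi / 2 :> R by rewrite divr_ge0 ?pi_ge0.
have H (u : R) : u ^+ 2 <= (x - y).1 ^+ 2 + (x - y).2 ^+ 2 ->
    gauss2 (pi / 2) (x - y) <= expR (- (pi / 2 * u ^+ 2)).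
  by move=> h; rewrite /gauss2 ler_expR lerN2 ler_wpM2l.
rewrite /edge_weight/=.
have G0 (u : R) : 0 <= expR (- (pi / 2 * u ^+ 2)) by exact: expR_ge0.
have s1 := sqr_ge0 (x - y).1; have s2 := sqr_ge0 (x - y).2.
have := G0 x.1; have := G0 (x.1 - N%:R); have := G0 x.2; have := G0 (x.2 - N%:R).
have sq2 (a b : R) : 0 <= a -> a <= b -> a ^+ 2 <= b ^+ 2.
  by move=> a0 ab; rewrite ler_sqr// nnegrE//; exact: le_trans ab.
move: yN; rewrite notin_setE/= /square/= => /not_andP[|] /negP; rewrite negb_and -!ltNge => /orP[h|h].
- suff : gauss2 (pi / 2) (x - y) <= expR (- (pi / 2 * x.1 ^+ 2)) by lra.
  apply: H; have := sq2 x.1 (x - y).1 x10; rewrite /= => h1.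
  by apply: le_trans (h1 _) _; lra.
- suff : gauss2 (pi / 2) (x - y) <= expR (- (pi / 2 * (x.1 - N%:R) ^+ 2)) by lra.
  apply: H; have := sq2 (N%:R - x.1) (- (x - y).1); rewrite /= => h1.
  by rewrite -sqrrN opprB; apply: le_trans (h1 _ _) _; rewrite ?sqrrN /=; lra.
- suff : gauss2 (pi / 2) (x - y) <= expR (- (pi / 2 * x.2 ^+ 2)) by lra.
  apply: H; have := sq2 x.2 (x - y).2 x20; rewrite /= => h1.
  by apply: le_trans (h1 _) _; lra.
- suff : gauss2 (pi / 2) (x - y) <= expR (- (pi / 2 * (x.2 - N%:R) ^+ 2)) by lra.
  apply: H; have := sq2 (N%:R - x.2) (- (x - y).2); rewrite /= => h1.
  by rewrite -sqrrN opprB; apply: le_trans (h1 _ _) _; rewrite ?sqrrN /=; lra.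
Qed.

Lemma integral_le_indic_itv (N : nat) :
  integral_le mu (\1_(`[0, N%:R]%classic : set R)) N%:R.
Proof.
split; [exact: measurable_indic|by move=> u; rewrite indicE ler0n|].
have E : (mu (`[0%R, N%:R]%classic : set R) <= N%:R%:E)%E.
  rewrite lebesgue_measure_itv/= lte_fin.
  by case: ifP => _; rewrite ?oppr0 ?adde0// lee_fin.
by apply: le_trans E; rewrite integral_indic// setIT.
Qed.

Lemma indic_squareE (N : nat) z : \1_(@square R N) z
  = \1_(`[0, N%:R]%classic : set R) z.1 * \1_(`[0, N%:R]%classic : set R) z.2 :> R.
Proof.
rewrite !indicE -natrM mulnb; congr (_%:R); congr nat_of_bool.
by apply/idP/andP; rewrite !inE/= /square/= !in_itv/=.
Qed.

Lemma integral_le_square (N : nat) : integral_le leb2 (\1_(@square R N) : R * R -> R) (N%:R ^+ 2).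
Proof.
have i1 := integral_le_indic_itv N.
have m2 : measurable_fun setT (fun z : R * R => \1_(`[0, N%:R]%classic : set R) z.2 : R).
  exact: (measurableT_comp (measurable_indic _) measurable_snd).
have := @integral_le_mul _ _ _ _ _ mu mu _ _ _ _ m2 (ler0n _ _) i1 (fun _ => i1).
rewrite -expr2; congr integral_le; apply/funext => z; exact/esym/indic_squareE.
Qed.

(** Each of the four terms contributes at most [2 N]: the Gaussian across the side has integral
    [sqrt 2 <= 2], and the side has length [N]. *)
Lemma integral_edge_weight (N : nat) :
  integral_le leb2 (fun z => \1_(@square R N) z * edge_weight N z) (8 * N%:R).
Proof.
have iG (a : R) : integral_le mu (fun u => expR (- (pi / 2 * (u - a) ^+ 2))) 2.
  have mG : measurable_fun setT (fun u : R => expR (- (pi / 2 * (u - a) ^+ 2))).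
    by apply: (measurableT_comp (measurable_expR_sqr (pi / 2))); apply: measurable_funB.
  split => //.
  have -> : (\int[mu]_x (expR (- (pi / 2 * (x - a) ^+ 2)))%:E
    = \int[mu]_x (fun u => (expR (- (pi / 2 * u ^+ 2)))%:E) (1 * x + - a)%R)%E.
    by apply: eq_integral => u _; rewrite mul1r.
  rewrite (@ge0_integral_affine _ 1 (- a) (fun u => (expR (- (pi / 2 * u ^+ 2)))%:E))//; last first.
    by apply/measurable_EFinP; exact: measurable_expR_sqr.
  rewrite invr1 mul1e integral_expR_sqr ?divr_gt0 ?pi_gt0// lee_fin.
  rewrite (_ : pi / (pi / 2) = 2); last first.
    by rewrite invfM invrK mulrA divff ?mul1r// gt_eqF ?pi_gt0.
  rewrite -[leRHS]ger0_norm// -sqrtr_sqr ler_sqrt//; lra.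
have i1 := integral_le_indic_itv N; have sqE := @indic_squareE N.
have H1 (a : R) : integral_le leb2 (fun z => \1_(@square R N) z * expR (- (pi / 2 * (z.1 - a) ^+ 2))) (2 * N%:R).
  have m2 : measurable_fun setT (fun z : R * R => \1_(`[0, N%:R]%classic : set R) z.2 : R).
    exact: (measurableT_comp (measurable_indic _) measurable_snd).
  apply: (integral_le_le _ _ _ (@integral_le_mul _ _ _ _ _ mu mu _ _ _ _ m2 (ler0n _ _) (iG a) (fun _ => i1))).
  - apply: measurable_funM; first by apply: measurable_indic; exact: measurable_square.
    by case: (iG a) => m _ _; exact: (measurableT_comp m measurable_fst).
  - by move=> z; rewrite mulr_ge0 ?expR_ge0// indicE ler0n.
  - move=> z; rewrite sqE mulrC ler_wpM2l ?expR_ge0// ler_piMl ?indicE ?ler0n//.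
    by case: (_ \in _).
have H2 (a : R) : integral_le leb2 (fun z => \1_(@square R N) z * expR (- (pi / 2 * (z.2 - a) ^+ 2))) (2 * N%:R).
  have := integral_le_swap (H1 a).
  congr integral_le; apply/funext => -[u v] /=; congr (_ * _).
  by rewrite !sqE mulrC.
have := integral_leD (integral_leD (integral_leD (H1 0) (H1 N%:R)) (H2 0)) (H2 N%:R).
rewrite (_ : _ + _ = 8 * N%:R); last by ring.
by congr integral_le; apply/funext => z; rewrite /edge_weight/= !subr0; ring.
Qed.

End PlaneGaussian.

(** * Fourier partial sums and the Green function of the torus *)

Section TrigonometricSums.
Context {R : realType}.
Local Notation mu := (@lebesgue_measure R).
Local Notation leb2 := (mu \xs mu)%E.
Implicit Types (x y z : R * R) (N M : nat).

Lemma cos_lipschitz (a b : R) : `|cos a - cos b| <= `|a - b|.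
Proof.
wlog ab : a b / a <= b => [H|].
  by case: (leP a b) => [/H//|/ltW/H]; rewrite distrC [in leRHS]distrC.
have dcos (u : R) : u \in `]a, b[ -> is_derive u 1 (@cos R) (- sin u).
  by move=> _; exact: is_derive_cos.
have ccos : {within `[a, b], continuous (@cos R)}.
  by apply: continuous_subspaceT => u; exact: continuous_cos.
have [c _ E] := MVT_segment ab dcos ccos.
rewrite distrC E distrC normrM normrN ler_piMl// .
by rewrite ler_norml sin_geN1 sin_le1.
Qed.

Lemma cosD2pi_nat (a : R) (n : nat) : cos (a + 2 * pi * n%:R) = cos a.
Proof.
elim: n => [|n IH]; first by rewrite mulr0 addr0.
rewrite -[n.+1%:R]natr1 mulrDr mulr1 addrA -[RHS]IH.
by rewrite [2 * pi]mulr_natl mulr2n addrA !cosDpi opprK.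
Qed.

Lemma cosD2pi_int (a : R) (k : int) : cos (a + 2 * pi * k%:~R) = cos a.
Proof.
case: k => n; first exact: cosD2pi_nat.
by rewrite NegzE mulrNz mulrN -[LHS](cosD2pi_nat _ n.+1) -addrA addNr addr0.
Qed.

(** The real part of the character of frequency [(m, n)]. As [E] is real, passing to real parts can
    only decrease the L2 error. *)
Definition wave N (m n : int) x : R :=
  cos (2 * pi * (m%:~R * x.1 / N%:R + n%:~R * x.2 / N%:R)).

Definition wave_weight (m n : int) : R := 1 / (m%:~R ^+ 2 + n%:~R ^+ 2).

Definition trig_sum N M x : R :=
  \sum_(i < M.*2.+1) \sum_(j < M.*2.+1
      | (i%:Z - M%:Z, j%:Z - M%:Z) != (0, 0))
    wave N (i%:Z - M%:Z) (j%:Z - M%:Z) x * wave_weight (i%:Z - M%:Z) (j%:Z - M%:Z).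

Lemma Re_E_partial_sum N M x : complex.Re (E_partial_sum N M x) = trig_sum N M x.
Proof.
rewrite /E_partial_sum /trig_sum raddf_sum/=; apply: eq_bigr => i _.
rewrite raddf_sum/=; apply: eq_bigr => j _.
rewrite /cexp /wave /wave_weight /=.
set m : R := _%:~R; set n : R := _%:~R.
rewrite !(mulr0, mul0r, addr0, add0r, subr0, sub0r, oppr0, mul1r, expR0).
congr (_ * _); congr cos; ring.
Qed.

Lemma wave_le1 N m n x : `|wave N m n x| <= 1.
Proof. by rewrite /wave ler_norml cos_geN1 cos_le1. Qed.

Lemma waveN N m n x : wave N m n (- x) = wave N m n x.
Proof.
by rewrite /wave -[RHS]cosN; congr cos; rewrite /=; ring.
Qed.

Lemma wave_periodic N m n x l : (0 < N)%N -> @lattice R N l ->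
  wave N m n (x + l) = wave N m n x.
Proof.
move=> N0 [a [b ->]]; rewrite /wave /= -[RHS](cosD2pi_int _ (m * a + n * b)).
have N0' : N%:R != 0 :> R by rewrite pnatr_eq0 -lt0n.
by congr cos; rewrite intrD !intrM; field.
Qed.

Lemma wave_scale N m n x : wave N m n x = wave 1 m n (x.1 / N%:R, x.2 / N%:R).
Proof. by rewrite /wave/= !divr1 -!mulrA. Qed.

Lemma measurable_wave N m n : measurable_fun setT (wave N m n).
Proof.
rewrite /wave; apply: (measurableT_comp (continuous_measurable_fun (@continuous_cos R))).
have m1 : measurable_fun setT (fun z : R * R => z.1) by exact: measurable_fst.
have m2 : measurable_fun setT (fun z : R * R => z.2) by exact: measurable_snd.
apply: measurable_funM => //; apply: measurable_funD;
by apply: measurable_funM => //; apply: measurable_funM.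
Qed.

Lemma wave_lipschitz N m n x y : (0 < N)%N -> `|wave N m n x - wave N m n y|
  <= 2 * pi * (`|m%:~R| + `|n%:~R|) / N%:R * (`|x.1 - y.1| + `|x.2 - y.2|).
Proof.
move=> N0; have N0' : 0 < N%:R :> R by rewrite ltr0n.
apply: (le_trans (cos_lipschitz _ _)).
set A := `|_|; set B := _ * _.
have -> : A = `|2 * pi / N%:R * (m%:~R * (x.1 - y.1) + n%:~R * (x.2 - y.2))|.
  by rewrite /A; congr `|_|; ring.
have -> : B = 2 * pi / N%:R * ((`|m%:~R| + `|n%:~R|) * (`|x.1 - y.1| + `|x.2 - y.2|)).
  by rewrite /B; ring.
rewrite normrM ger0_norm ?divr_ge0 ?mulr_ge0 ?pi_ge0// ler_wpM2l ?divr_ge0 ?mulr_ge0 ?pi_ge0//.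
apply: (le_trans (ler_normD _ _)); rewrite !normrM.
rewrite mulrDl !mulrDr.
have := normr_ge0 (m%:~R : R); have := normr_ge0 (n%:~R : R).
have := normr_ge0 (x.1 - y.1); have := normr_ge0 (x.2 - y.2).
nra.
Qed.

Definition trig_bound M : R :=
  \sum_(i < M.*2.+1) \sum_(j < M.*2.+1
      | (i%:Z - M%:Z, j%:Z - M%:Z) != (0, 0))
    wave_weight (i%:Z - M%:Z) (j%:Z - M%:Z).

(** [2 pi (|m| + |n|)] bounds the slope of a wave of period 1. The period is kept out, so that this
    depends on [M] alone and the Lipschitz constant at period [N] is [trig_lip M / N]. *)
Definition trig_lip M : R :=
  \sum_(i < M.*2.+1) \sum_(j < M.*2.+1
      | (i%:Z - M%:Z, j%:Z - M%:Z) != (0, 0))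
    2 * pi * (`|(i%:Z - M%:Z)%:~R| + `|(j%:Z - M%:Z)%:~R|)
    * wave_weight (i%:Z - M%:Z) (j%:Z - M%:Z).

Lemma wave_weight_ge0 m n : 0 <= wave_weight m n.
Proof. by rewrite divr_ge0// addr_ge0// sqr_ge0. Qed.

Lemma trig_sum_le N M x : `|trig_sum N M x| <= trig_bound M.
Proof.
apply: (le_trans (ler_norm_sum _ _ _)); apply: ler_sum => i _.
apply: (le_trans (ler_norm_sum _ _ _)); apply: ler_sum => j _.
by rewrite normrM [`|wave_weight _ _|]ger0_norm ?wave_weight_ge0//
  ler_piMl ?wave_weight_ge0// wave_le1.
Qed.

Lemma trig_sumN N M x : trig_sum N M (- x) = trig_sum N M x.
Proof.
by apply: eq_bigr => i _; apply: eq_bigr => j _; rewrite waveN.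
Qed.

Lemma trig_sum_periodic N M x l : (0 < N)%N -> @lattice R N l ->
  trig_sum N M (x + l) = trig_sum N M x.
Proof.
by move=> N0 Nl; apply: eq_bigr => i _; apply: eq_bigr => j _; rewrite wave_periodic.
Qed.

(** The period enters only through [x / N], which is why the L2 errors for all [N] reduce to the
    error for [N = 1]. *)
Lemma trig_sum_scale N M x : trig_sum N M x = trig_sum 1 M (x.1 / N%:R, x.2 / N%:R).
Proof.
by apply: eq_bigr => i _; apply: eq_bigr => j _; rewrite wave_scale.
Qed.

Lemma measurable_trig_sum N M : measurable_fun setT (trig_sum N M).
Proof.
apply: measurable_sum => i; under eq_fun do rewrite big_mkcond /=.
apply: (@measurable_sum _ _ _ _ _ _ (fun (j : 'I_M.*2.+1) x => if (i%:Z - M%:Z, j%:Z - M%:Z) != (0, 0)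
  then wave N (i%:Z - M%:Z) (j%:Z - M%:Z) x * wave_weight (i%:Z - M%:Z) (j%:Z - M%:Z) else 0)) => j.
case: (_ != _) => //.
by apply: measurable_funM => //; exact: measurable_wave.
Qed.

Lemma trig_lip_ge0 M : 0 <= trig_lip M.
Proof.
apply: sumr_ge0 => i _; apply: sumr_ge0 => j _.
apply: mulr_ge0; last exact: wave_weight_ge0.
by apply: mulr_ge0; [rewrite mulr_ge0 ?pi_ge0|rewrite addr_ge0].
Qed.

(** Squared and in the Euclidean distance, the form that [gauss2_sqr_le] can absorb; the factor 2 is
    [(a + b)^2 <= 2 (a^2 + b^2)]. *)
Lemma trig_sum_lipschitz N M x y : (0 < N)%N ->
  (trig_sum N M x - trig_sum N M y) ^+ 2
  <= 2 * (trig_lip M / N%:R) ^+ 2 * ((x - y).1 ^+ 2 + (x - y).2 ^+ 2).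
Proof.
move=> N0; have N0' : 0 < N%:R :> R by rewrite ltr0n.
have H : `|trig_sum N M x - trig_sum N M y|
    <= trig_lip M / N%:R * (`|x.1 - y.1| + `|x.2 - y.2|).
  rewrite /trig_sum -sumrB /trig_lip mulr_suml mulr_suml.
  apply: (le_trans (ler_norm_sum _ _ _)); apply: ler_sum => i _.
  rewrite -sumrB mulr_suml mulr_suml.
  apply: (le_trans (ler_norm_sum _ _ _)); apply: ler_sum => j _.
  rewrite -mulrBl normrM [`|wave_weight _ _|]ger0_norm ?wave_weight_ge0//.
  apply: le_trans (ler_wpM2r (wave_weight_ge0 _ _) (wave_lipschitz _ _ _ _ N0)) _.
  by rewrite le_eqVlt; apply/orP; left; apply/eqP; ring.
rewrite -real_normK ?num_real//.
apply: (le_trans (lerXn2r 2 _ _ H)).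
- by rewrite nnegrE.
- by rewrite nnegrE mulr_ge0 ?addr_ge0// divr_ge0 ?trig_lip_ge0// ltW.
rewrite exprMn -[leRHS]mulrA [leRHS]mulrCA ler_wpM2l ?sqr_ge0//=.
rewrite -(real_normK (num_real (x.1 - y.1))) -(real_normK (num_real (x.2 - y.2))).
have := sqr_ge0 (`|x.1 - y.1| - `|x.2 - y.2|); nra.
Qed.

End TrigonometricSums.

(** * Measurability of functions continuous off the lattice *)

Section PlaneMeasurability.
Context {R : realType}.
Implicit Types x y z : R * R.

(** The measurable structure is that of the product, so an open set is exhausted by the countably
    many rational squares that it contains. *)
Lemma open_plane_measurable (U : set (R * R)) : open U -> measurable U.
Proof.
move=> oU.
pose box (t : rat * rat * rat) : set (R * R) :=
  `](ratr t.1.1 - ratr t.2), (ratr t.1.1 + ratr t.2)[%classic `*`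
  `](ratr t.1.2 - ratr t.2), (ratr t.1.2 + ratr t.2)[%classic.
rewrite (_ : U = \bigcup_t (if asbool (box t `<=` U) then box t else set0)).
  apply: countable_bigcupT_measurable => // t.
  by case: asboolP => _; [exact: measurableX|exact: measurable0].
apply/seteqP; split => [x Ux|x [t _]]; last by case: asboolP => // tU /tU.
have [e /= e0 eU] : exists2 e : R, 0 < e & ball x e `<=` U.
  by move: oU; rewrite openE => /(_ x Ux)/nbhs_ballP[e e0 eU]; exists e.
(* The centre lies within [e / 4] of [x] and the radius between [e / 4] and [e / 2]: the square
   contains [x] and stays within [3 e / 4] of it. *)
have [|rho] := @rat_in_itvoo _ (e / 4) (e / 2); first by lra.
rewrite in_itv/= => /andP[h1 h2].
have close (u : R) : exists q : rat, u - e / 4 < ratr q /\ ratr q < u + e / 4.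
  have [|q] := @rat_in_itvoo _ (u - e / 4) (u + e / 4); first by lra.
  by rewrite in_itv/= => /andP[? ?]; exists q.
have [q1 [q11 q12]] := close x.1; have [q2 [q21 q22]] := close x.2.
exists (q1, q2, rho) => //; case: asboolP => [_|].
  by split; rewrite /= in_itv/=; apply/andP; split; lra.
case=> -[u v] [] /=; rewrite !in_itv/= => /andP[a1 a2] /andP[b1 b2].
by apply: eU; split; rewrite /ball/= ltr_norml; apply/andP; split; lra.
Qed.

Lemma measurable_lattice_sub N (B : set (R * R)) : B `<=` @lattice R N -> measurable B.
Proof.
move=> BN; apply: countable_measurable.
  move=> [u v]; rewrite (_ : [set (u, v)] = [set u] `*` [set v]).
    exact: measurableX.
  by apply/seteqP; split => -[a b] /= [-> ->].
apply: (sub_countable (subset_card_le BN)).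
have -> : @lattice R N = (fun k : int * int => (k.1%:~R * N%:R, k.2%:~R * N%:R)) @` setT.
  apply/seteqP; split => x /=; first by move=> [m [n ->]]; exists (m, n).
  by move=> [[m n] _ <-]; exists m, n.
exact: (sub_countable (card_image_le _ _)).
Qed.

(** Values on the lattice are arbitrary, but the lattice is countable: the preimage of an open ray
    is its interior together with some lattice points. *)
Lemma measurable_fun_off_lattice N (E : R * R -> R) :
  (forall x, ~ @lattice R N x -> {for x, continuous E}) -> measurable_fun setT E.
Proof.
move=> cE; apply: (measurability _ (RGenOInfty.measurableE R)) => //.
move=> /= _ [_ [a ->] <-]; rewrite setTI.
set B := _ @^-1` _.
rewrite (_ : B = B° `|` (B `&` @lattice R N)).
  apply: measurableU; first by apply: open_plane_measurable; exact: open_interior.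
  by apply: (@measurable_lattice_sub N) => x [].
apply/seteqP; split => x; last by move=> [/interior_subset|[]].
move=> Bx; have [Nx|Nx] := pselect (@lattice R N x); [by right|left].
move: Bx; rewrite /B/= in_itv/= andbT => ax.
have H : nbhs (E x) `]a, +oo[%classic.
  by apply: open_nbhs_nbhs; split; [exact: interval_open|rewrite /= in_itv/= ax].
exact: (cE x Nx _ H).
Qed.

End PlaneMeasurability.

Section IntegralComparison.
Context d (T : measurableType d) (R : realType) (m : {measure set T -> \bar R}).

(** The integral of a nonnegative function is a supremum over the simple functions below it, hence
    monotone without further structure. The larger function will be the squared complex modulus in
    [is_E]. *)
Lemma ge0_le_integral_nonmeasurable (D : set T) (f h : T -> \bar R) :
  (forall x, D x -> 0 <= f x)%E -> (forall x, D x -> f x <= h x)%E ->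
  (\int[m]_(x in D) f x <= \int[m]_(x in D) h x)%E.
Proof.
move=> f0 fh; rewrite integral_mkcond [leRHS]integral_mkcond.
have fhD x : ((f \_ D) x <= (h \_ D) x)%E.
  by rewrite !patchE; case: ifP => //; rewrite inE; exact: fh.
have f0D x : (0 <= (f \_ D) x)%E.
  by rewrite !patchE; case: ifP => //; rewrite inE; exact: f0.
rewrite !ge0_integralTE//; last by move=> x; exact: le_trans (fhD x).
apply: le_ereal_sup => _ [k kf <-]; exists k => // x.
exact: le_trans (kf x) (fhD x).
Qed.

Lemma integral_sqrD_le (D : set T) (u v w : T -> R) : measurable D ->
  measurable_fun setT u -> measurable_fun setT v -> measurable_fun setT w ->
  (forall x, w x = u x + v x) ->
  (\int[m]_(x in D) (w x ^+ 2)%:E <= 2%:E * \int[m]_(x in D) (u x ^+ 2)%:E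
   + 2%:E * \int[m]_(x in D) (v x ^+ 2)%:E)%E.
Proof.
move=> mD mu1 mv mw wE.
have mu2 : measurable_fun D (fun x => (u x ^+ 2)%:E).
  by apply/measurable_funTS/measurable_EFinP; apply: measurable_funX.
have mv2 : measurable_fun D (fun x => (v x ^+ 2)%:E).
  by apply/measurable_funTS/measurable_EFinP; apply: measurable_funX.
have p2 (k : T -> R) x : D x -> (0 <= (k x ^+ 2)%:E)%E by rewrite lee_fin sqr_ge0.
have m2 (k : T -> R) : measurable_fun D (fun x => (k x ^+ 2)%:E) ->
    measurable_fun D (fun x => 2%:E * (k x ^+ 2)%:E)%E.
  by move=> mk; exact: measurable_funeM.
have p22 (k : T -> R) x : D x -> (0 <= 2%:E * (k x ^+ 2)%:E)%E.
  by rewrite -EFinM lee_fin mulr_ge0// sqr_ge0.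
rewrite -!ge0_integralZl//; [|exact: p2|exact: p2].
rewrite -ge0_integralD//; [|exact: p22|exact: m2|exact: p22|exact: m2].
apply: ge0_le_integral => //; [exact: p2| | |].
- by apply/measurable_funTS/measurable_EFinP; apply: measurable_funX.
- by apply: emeasurable_funD; exact: m2.
- move=> x _; rewrite -!EFinM -EFinD lee_fin wE.
  have := sqr_ge0 (u x - v x); rewrite sqrrB sqrrD; lra.
Qed.

End IntegralComparison.

(** * Mean-square approximation of [E_N], uniformly in [N] *)

Section GreenApproximation.
Context {R : realType}.
Local Notation mu := (@lebesgue_measure R).
Local Notation leb2 := (mu \xs mu)%E.
Implicit Types (x y z : R * R) (N M : nat).

Variable E : nat -> R * R -> R.
Hypothesis hE : forall N, (1 <= N)%N -> is_E N (E N).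

Lemma measurable_green N : (0 < N)%N -> measurable_fun setT (E N).
Proof. by move=> N0; have [_ cE _] := hE N0; exact: (measurable_fun_off_lattice cE). Qed.

(** The squared L2 error. At [N = 1] it is the [delta_M] of the final bound; it takes extended
    values, since finiteness is known only for large [M], from the convergence. *)
Definition green_error N M : \bar R :=
  (\int[leb2]_(x in @square R N) ((E N x - trig_sum N M x) ^+ 2)%:E)%E.

Lemma green_error_ge0 N M : (0 <= green_error N M)%E.
Proof. by apply: integral_ge0 => x _; rewrite lee_fin sqr_ge0. Qed.

Let mE2 N M : (0 < N)%N -> measurable_fun setT (fun x => ((E N x - trig_sum N M x) ^+ 2)%:E).
Proof.
move=> N0; apply/measurable_EFinP; apply: measurable_funX; apply: measurable_funB.
  exact: measurable_green.
exact: measurable_trig_sum.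
Qed.

Lemma green_error_cvg0 N : (0 < N)%N -> green_error N @ \oo --> 0%E.
Proof.
move=> N0; have [_ _ cvE] := hE N0.
apply: (squeeze_cvge _ (cvg_cst _) cvE).
near=> M; rewrite green_error_ge0 andTb.
apply: ge0_le_integral_nonmeasurable => x _; rewrite lee_fin ?sqr_ge0//.
rewrite normc_def -Re_E_partial_sum [complex.Re _%:C%C]/= sqr_sqrtr ?addr_ge0 ?sqr_ge0//.
by rewrite [complex.Re (_ - _)]raddfB/= lerDl sqr_ge0.
Unshelve. all: by end_near.
Qed.

(** [E N] and the rescaled [E 1] are L2 limits of the same sums [trig_sum N K], so they agree almost
    everywhere on the square ([D0]); the error of the rescaled function picks up the area [N^2]. The
    factor 2 comes from [(u + v)^2 <= 2 u^2 + 2 v^2]. *)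
Lemma green_error_scale N M : (0 < N)%N ->
  (green_error N M <= (2 * N%:R ^+ 2)%:E * green_error 1 M)%E.
Proof.
move=> N0.
pose e x := E 1 (x.1 / N%:R, x.2 / N%:R).
have m1 : measurable_fun setT (fun z : R * R => z.1) by exact: measurable_fst.
have m2 : measurable_fun setT (fun z : R * R => z.2) by exact: measurable_snd.
have me : measurable_fun setT e.
  apply: (measurableT_comp (measurable_green (ltn0Sn 0))).
  by apply: measurable_fun_pair; apply: measurable_funM.
have mE := measurable_green N0; have ms K := @measurable_trig_sum R N K.
have mEe : measurable_fun setT (fun x => E N x - e x) by exact: measurable_funB.
have mEs K : measurable_fun setT (fun x => E N x - trig_sum N K x) by exact: measurable_funB.
have mes K : measurable_fun setT (fun x => e x - trig_sum N K x) by exact: measurable_funB.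
have mse K : measurable_fun setT (fun x => trig_sum N K x - e x) by exact: measurable_funB.
have eS K : (\int[leb2]_(x in @square R N) ((e x - trig_sum N K x) ^+ 2)%:E
    = (N%:R ^+ 2)%:E * green_error 1 K)%E.
  rewrite /green_error -(ge0_integral_square_scale N0)//.
  - by apply: eq_integral => x _; rewrite [in LHS]trig_sum_scale.
  - exact: mE2.
  - by move=> z; rewrite lee_fin sqr_ge0.
have D0 : (\int[leb2]_(x in @square R N) ((E N x - e x) ^+ 2)%:E = 0)%E.
  set c := (X in X = _).
  have c0 : (0 <= c)%E by apply: integral_ge0 => x _; rewrite lee_fin sqr_ge0.
  have ub K : (c <= 2%:E * green_error N K + 2%:E * ((N%:R ^+ 2)%:E * green_error 1 K))%E.
    have := @integral_sqrD_le _ _ R leb2 _ _ _ _ (@measurable_square R N) (mEs K) (mse K) mEe.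
    rewrite -eS (_ : (\int[leb2]_(x in square N) ((e x - trig_sum N K x) ^+ 2)%:E =
      \int[leb2]_(x in square N) ((trig_sum N K x - e x) ^+ 2)%:E)%E); last first.
      by apply: eq_integral => x _; rewrite -sqrrN opprB.
    by apply => x; rewrite addrA subrK.
  have cv : (fun K => 2%:E * green_error N K + 2%:E * ((N%:R ^+ 2)%:E * green_error 1 K))%E
      @ \oo --> 0%E.
    rewrite -[X in _ --> X](_ : (2%:E * 0 + 2%:E * ((N%:R ^+ 2)%:E * 0) = 0 :> \bar R)%E); last first.
      by rewrite !mule0 adde0.
    apply: cvgeD; first by rewrite !mule0.
      by apply: cvgeZl => //; exact: green_error_cvg0.
    by apply: cvgeZl => //; apply: cvgeZl => //; exact: green_error_cvg0.
  have cc : (fun _ : nat => c) @ \oo --> 0%E.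
    apply: (squeeze_cvge _ (cvg_cst _) cv).
    by near=> K; rewrite c0/=; exact: ub.
  exact: (cvg_unique _ (cvg_cst c) cc).
have := @integral_sqrD_le _ _ R leb2 _ _ _ _ (@measurable_square R N) mEe (mes M) (mEs M).
rewrite D0 mule0 add0e eS muleA -EFinM; apply => x.
by rewrite addrA subrK.
Unshelve. all: by end_near.
Qed.

(** A sum over ordered pairs does not see the odd part of [E]. Symmetrizing makes the pair kernel
    exactly symmetric, whatever values [E] takes on the lattice. *)
Definition green_sym N x : R := (E N x + E N (- x)) / 2.

Lemma green_symN N x : green_sym N (- x) = green_sym N x.
Proof. by rewrite /green_sym opprK addrC. Qed.

Lemma green_sym_periodic N x l : (0 < N)%N -> @lattice R N l ->
  green_sym N (x + l) = green_sym N x.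
Proof.
move=> N0 Nl; have [pE _ _] := hE N0; rewrite /green_sym pE// opprD pE//.
by case: Nl => m [n ->]; exists (- m), (- n); rewrite !mulrNz !mulNr.
Qed.

Lemma measurable_green_sym N : (0 < N)%N -> measurable_fun setT (green_sym N).
Proof.
move=> N0; have mE := measurable_green N0.
apply: measurable_funM => //; apply: measurable_funD => //.
apply: (measurableT_comp mE).
by apply: measurable_fun_pair; apply: measurable_funN;
  [exact: measurable_fst|exact: measurable_snd].
Qed.

(** Trigonometric sums are even, so the error is the average of the errors of [E] at [x] and [- x],
    which have the same norm by periodicity; nothing is lost because [2 (1/4 + 1/4) = 1]. *)
Lemma green_sym_error N M : (0 < N)%N ->
  (\int[leb2]_(x in @square R N) ((green_sym N x - trig_sum N M x) ^+ 2)%:E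
   <= green_error N M)%E.
Proof.
move=> N0; have mE := measurable_green N0; have ms := @measurable_trig_sum R N M.
have mN : measurable_fun setT (fun x : R * R => - x).
  by apply: measurable_fun_pair; apply: measurable_funN;
    [exact: measurable_fst|exact: measurable_snd].
have m1 : measurable_fun setT (fun x => 2^-1 * (E N x - trig_sum N M x)).
  by apply: measurable_funM => //; exact: measurable_funB.
have m2 : measurable_fun setT (fun x => 2^-1 * (E N (- x) - trig_sum N M (- x))).
  exact: (measurableT_comp m1 mN).
have m3 : measurable_fun setT (fun x => green_sym N x - trig_sum N M x).
  by apply: measurable_funB => //; exact: measurable_green_sym.
have := @integral_sqrD_le _ _ R leb2 _ _ _ _ (@measurable_square R N) m1 m2 m3.
have half (h : R * R -> R) : measurable_fun setT (fun x => h x ^+ 2) ->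
   (2%:E * \int[leb2]_(x in square N) ((2^-1 * h x) ^+ 2)%:E
    = 2^-1%:E * \int[leb2]_(x in square N) (h x ^+ 2)%:E)%E.
  move=> mh; rewrite -!ge0_integralZl//.
  - by apply: eq_integral => x _; rewrite -!EFinM; congr EFin; field.
  - exact: measurable_square.
  - by apply/measurable_funTS/measurable_EFinP.
  - by move=> x _; rewrite lee_fin sqr_ge0.
  - exact: measurable_square.
  - apply/measurable_funTS/measurable_EFinP; rewrite (_ : (fun _ => _) = (fun x => 2^-1 ^+ 2 * h x ^+ 2)).
      exact: measurable_funM.
    by apply/funext => x; rewrite exprMn.
  - by move=> x _; rewrite lee_fin sqr_ge0.
have mh : measurable_fun setT (fun x => (E N x - trig_sum N M x) ^+ 2).
  by apply: measurable_funX; exact: measurable_funB.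
rewrite (half (fun x => E N x - trig_sum N M x))// (half (fun x => E N (- x) - trig_sum N M (- x))); last first.
  exact: (measurableT_comp mh mN).
have -> : (\int[leb2]_(x in square N) ((E N (- x) - trig_sum N M (- x)) ^+ 2)%:E = green_error N M)%E.
  rewrite /green_error -(@ge0_integral_square_periodic _ N 0 (fun z => ((E N z - trig_sum N M z) ^+ 2)%:E))//.
  - by apply: eq_integral => x _; congr EFin; rewrite (add0r (- x)).
  - exact/measurable_EFinP.
  - by move=> z; rewrite lee_fin sqr_ge0.
  - by move=> z l Nl; have [pE _ _] := hE N0; rewrite pE// trig_sum_periodic.
move=> H; apply: le_trans (H _) _.
  by move=> x; rewrite trig_sumN /green_sym; field.
rewrite -/(green_error N M) -ge0_muleDl ?green_error_ge0// .
  by rewrite -EFinD (_ : 2^-1 + 2^-1 = 1 :> R) ?mul1e//; field.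
Qed.

End GreenApproximation.

(** * The variance of a centred pair statistic *)

Ltac measurability :=
  lazymatch goal with
  | |- measurable_fun _ (fun z => z) => exact: measurable_id
  | |- measurable_fun _ id => exact: measurable_id
  | |- measurable_fun _ fst => exact: measurable_fst
  | |- measurable_fun _ snd => exact: measurable_snd
  | |- measurable_fun _ (pair _) => apply: measurable_fun_pair; measurability
  | |- measurable_fun _ (fun z => (_, _)) =>
      apply: measurable_fun_pair; measurability
  | |- measurable_fun _ (fun z => fst z) => exact: measurable_fst
  | |- measurable_fun _ (fun z => snd z) => exact: measurable_snd
  | |- measurable_fun _ (fun z => fst _) =>
      apply: (measurableT_comp measurable_fst); measurability
  | |- measurable_fun _ (fun z => snd _) =>
      apply: (measurableT_comp measurable_snd); measurability
  | |- measurable_fun _ (fun z => _ * _) => apply: measurable_funM; measurability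
  | |- measurable_fun _ (fun z => _ - _) => apply: measurable_funB; measurability
  | |- measurable_fun _ (fun z => _ + _) => apply: measurable_funD; measurability
  | |- measurable_fun _ (fun z => _ ^+ _) => apply: measurable_funX; measurability
  | H : measurable_fun _ ?r |- measurable_fun _ ?r => exact: H
  | H : measurable_fun _ ?r |- measurable_fun _ (fun z => ?r z) => exact: H
  | H : measurable_fun _ ?r |- measurable_fun _ (fun z => ?r _) =>
      apply: (measurableT_comp H); measurability
  | |- measurable_fun _ _ => first
      [ exact: measurable_cst
      | match goal with H : forall x, measurable_fun _ _ |- _ => exact: H end ]
  | |- _ => idtac
  end.

Section UStatistic.
Context d (T : measurableType d) (R : realType).
Variable mu : {sigma_finite_measure set T -> \bar R}.
Local Notation mu2 := (mu \xs mu)%E.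
Local Notation mu3 := (mu \xs mu2)%E.
Local Notation mu4 := (mu2 \xs mu2)%E.

(** In the application [r ^+ 8] is the squared modulus of the kernel and [r ^+ 4] the modulus. The
    lower powers are the room for trading decay along a cycle against decay between the two points
    of [f]. *)
Variables (f r : T * T -> R) (A : set T) (F Fr C : R).
Hypothesis mf : measurable_fun setT f.
Hypothesis fC : forall x y, f (x, y) = f (y, x).
Hypothesis mA : measurable A.
Hypothesis Aoo : (mu A < +oo)%E.
Hypothesis fA : forall x y, ~ (A x /\ A y) -> f (x, y) = 0.
Hypothesis f2oo : forall x, (\int[mu]_y (f (x, y) ^+ 2)%:E < +oo)%E.
Hypothesis f2F : (\int[mu2]_z (f z ^+ 2)%:E = F%:E)%E.
Hypothesis f0 : forall x, \int[mu]_y f (x, y) = 0.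
Hypothesis mr : measurable_fun setT r.
Hypothesis rC : forall x y, r (x, y) = r (y, x).
Hypothesis r_ge0 : forall z, 0 <= r z.
Hypothesis r_le1 : forall z, r z <= 1.
Hypothesis r_tri : forall x y z, r (x, z) ^+ 2 * r (z, y) ^+ 2 <= r (x, y).
Hypothesis C0 : 0 <= C.
Hypothesis r2C : forall x, (\int[mu]_y (r (x, y) ^+ 2)%:E <= C%:E)%E.
Hypothesis r81 : forall x, (\int[mu]_y (r (x, y) ^+ 8)%:E <= 1)%E.
Hypothesis f2r : (\int[mu2]_z (f z ^+ 2 * r z)%:E = Fr%:E)%E.

Lemma integrable_f2 : mu2.-integrable setT (EFin \o (fun z => f z ^+ 2)).
Proof.
apply: ge0_integrable_prod; [by measurability|by move=> z; exact: sqr_ge0|].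
by rewrite f2F ltry.
Qed.

Let mf1 x : measurable_fun setT (fun y => f (x, y)).
Proof. by measurability. Qed.

(** The domination is [|f| <= 1_A + f^2]: on a set of finite measure a square integrable function is
    integrable. *)
Lemma integrable_f1 x : mu.-integrable setT (EFin \o (fun y => f (x, y))).
Proof.
have A1 : mu.-integrable setT (EFin \o (\1_A : T -> R)).
  by apply/integrableP; split; [exact/measurable_EFinP|
    under eq_integral => y _ do rewrite /= ger0_norm//;
    rewrite integral_indic// setIT].
have F2 : mu.-integrable setT (EFin \o (fun y => f (x, y) ^+ 2)).
  apply/integrableP; split; first by apply/measurable_EFinP; measurability.
  by under eq_integral => y _ do rewrite /= ger0_norm ?sqr_ge0//.
apply: (le_integrable _ _ _ (integrableD measurableT A1 F2)) => //.
  exact/measurable_EFinP.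
move=> y _ /=; rewrite lee_fin [leRHS]ger0_norm ?addr_ge0 ?sqr_ge0//.
rewrite indicE; case: (boolP (y \in A)) => [_|/negP]; last first.
  by rewrite inE => Ay; rewrite fA ?normr0 ?addr_ge0 ?sqr_ge0// => -[].
have := sqr_ge0 (`|f (x, y)| - 1); rewrite sqrrB real_normK ?num_real//= => h.
by rewrite -[_%:R]/1; have := normr_ge0 (f (x, y)); lra.
Qed.

Lemma integrable_f : mu2.-integrable setT (EFin \o f).
Proof.
have A1 : mu2.-integrable setT (EFin \o (\1_(A `*` A) : T * T -> R)).
  apply: ge0_integrable_prod => //.
    exact: (measurable_indic (measurableX mA mA)).
  rewrite integral_indic//; last exact: measurableX.
  rewrite setIT -[X in (X < _)%E]/((mu \x mu)%E (A `*` A)) product_measure1E//.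
  by rewrite lte_mul_pinfty// ge0_fin_numE.
apply: (le_integrable _ _ _ (integrableD measurableT A1 integrable_f2)) => //.
  exact/measurable_EFinP.
move=> [x y] _ /=; rewrite lee_fin [leRHS]ger0_norm ?addr_ge0 ?sqr_ge0//.
rewrite indicE; case: (boolP ((x, y) \in _)) => [_|/negP]; last first.
  by rewrite inE => Ay; rewrite fA ?normr0 ?addr_ge0 ?sqr_ge0.
have := sqr_ge0 (`|f (x, y)| - 1); rewrite sqrrB real_normK ?num_real//= => h.
by rewrite -[_%:R]/1; have := normr_ge0 (f (x, y)); lra.
Qed.

Lemma Rintegral_f1l (phi : T -> R) (M : R) : measurable_fun setT phi ->
  (forall x, `|phi x| <= M) -> \int[mu2]_z (f z * phi z.1) = 0.
Proof.
move=> mphi phiM; apply: Rintegral_prod_eq0l.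
- by apply: (integrable_mul_bounded integrable_f) => [|z]; [measurability|exact: phiM].
- move=> x /=; rewrite RintegralZr//; last exact: integrable_f1.
  by rewrite f0 mul0r.
- by move=> x /=; apply: (integrable_mul_bounded (integrable_f1 x)); [measurability|].
Qed.

Lemma Rintegral_f1r (phi : T -> R) (M : R) : measurable_fun setT phi ->
  (forall x, `|phi x| <= M) -> \int[mu2]_z (f z * phi z.2) = 0.
Proof.
move=> mphi phiM; apply: Rintegral_prod_eq0r.
- by apply: (integrable_mul_bounded integrable_f) => [|z]; [measurability|exact: phiM].
- move=> y /=; under eq_Rintegral => x _ do rewrite fC.
  rewrite RintegralZr//; last exact: integrable_f1.
  by rewrite f0 mul0r.
- move=> y; have fi := integrable_f1 y.
  rewrite (_ : (fun x => f (y, x)) = (fun x => f (x, y))) in fi; last exact/funext.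
  by apply: (integrable_mul_bounded fi); [measurability|].
Qed.

Let f4 (v : (T * T) * (T * T)) := f v.1 * f v.2.

Lemma integrable_f4 : mu4.-integrable setT (EFin \o f4).
Proof.
have H := (integrable_prod_mul integrable_f integrable_f).
exact: H. Qed.

Let mf4 : measurable_fun setT f4.
Proof. by rewrite /f4; measurability. Qed.

(** The fourth point occurs only in [f v.2], so integrating it first gives zero by [f0]; boundedness
    of [phi] justifies Fubini. The next three lemmas do the same for the other points. *)
Lemma Rintegral_f4_free4 (phi : T * (T * T) -> R) (M : R) :
  measurable_fun setT phi -> (forall x, `|phi x| <= M) ->
  \int[mu4]_v (f4 v * phi (v.1.1, (v.1.2, v.2.1))) = 0.
Proof.
move=> mphi phiM; apply: Rintegral_prod_eq0l.
- by apply: (integrable_mul_bounded integrable_f4) => [|z]; [measurability|exact: phiM].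
- move=> x; rewrite /f4/=; under eq_Rintegral => z _ do rewrite -mulrA.
  rewrite RintegralZl//; last first.
    apply: (integrable_mul_bounded integrable_f) => [|z]; last exact: phiM.
    by measurability.
  by rewrite (@Rintegral_f1l (fun t => phi (x.1, (x.2, t))) M) ?mulr0//; measurability.
- move=> x; rewrite /f4/=.
  rewrite (_ : _ \o _ = EFin \o (fun z => f z * (f x * phi (x.1, (x.2, z.1))))); last first.
    by apply/funext => z /=; congr EFin; ring.
  apply: (@integrable_mul_bounded _ _ _ _ _ _ (`|f x| * M) integrable_f) => [|z].
    by measurability.
  by rewrite normrM ler_wpM2l.
Qed.

Lemma Rintegral_f4_free3 (phi : T * (T * T) -> R) (M : R) :
  measurable_fun setT phi -> (forall x, `|phi x| <= M) ->
  \int[mu4]_v (f4 v * phi (v.1.1, (v.1.2, v.2.2))) = 0.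
Proof.
move=> mphi phiM; apply: Rintegral_prod_eq0l.
- by apply: (integrable_mul_bounded integrable_f4) => [|z]; [measurability|exact: phiM].
- move=> x; rewrite /f4/=; under eq_Rintegral => z _ do rewrite -mulrA.
  rewrite RintegralZl//; last first.
    apply: (integrable_mul_bounded integrable_f) => [|z]; last exact: phiM.
    by measurability.
  by rewrite (@Rintegral_f1r (fun t => phi (x.1, (x.2, t))) M) ?mulr0//; measurability.
- move=> x; rewrite /f4/=.
  rewrite (_ : _ \o _ = EFin \o (fun z => f z * (f x * phi (x.1, (x.2, z.2))))); last first.
    by apply/funext => z /=; congr EFin; ring.
  apply: (@integrable_mul_bounded _ _ _ _ _ _ (`|f x| * M) integrable_f) => [|z].
    by measurability.
  by rewrite normrM ler_wpM2l.
Qed.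

Lemma Rintegral_f4_free2 (phi : T * (T * T) -> R) (M : R) :
  measurable_fun setT phi -> (forall x, `|phi x| <= M) ->
  \int[mu4]_v (f4 v * phi (v.1.1, (v.2.1, v.2.2))) = 0.
Proof.
move=> mphi phiM; apply: Rintegral_prod_eq0r.
- by apply: (integrable_mul_bounded integrable_f4) => [|z]; [measurability|exact: phiM].
- move=> x; rewrite /f4/=; under eq_Rintegral => z _ do rewrite mulrAC.
  rewrite RintegralZr//; last first.
    apply: (integrable_mul_bounded integrable_f) => [|z]; last exact: phiM.
    by measurability.
  by rewrite (@Rintegral_f1l (fun t => phi (t, (x.1, x.2))) M) ?mul0r//; measurability.
- move=> x; rewrite /f4/=.
  rewrite (_ : _ \o _ = EFin \o (fun z => f z * (f x * phi (z.1, (x.1, x.2))))); last first.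
    by apply/funext => z /=; congr EFin; ring.
  apply: (@integrable_mul_bounded _ _ _ _ _ _ (`|f x| * M) integrable_f) => [|z].
    by measurability.
  by rewrite normrM ler_wpM2l.
Qed.

Lemma Rintegral_f4_free1 (phi : T * (T * T) -> R) (M : R) :
  measurable_fun setT phi -> (forall x, `|phi x| <= M) ->
  \int[mu4]_v (f4 v * phi (v.1.2, (v.2.1, v.2.2))) = 0.
Proof.
move=> mphi phiM; apply: Rintegral_prod_eq0r.
- by apply: (integrable_mul_bounded integrable_f4) => [|z]; [measurability|exact: phiM].
- move=> x; rewrite /f4/=; under eq_Rintegral => z _ do rewrite mulrAC.
  rewrite RintegralZr//; last first.
    apply: (integrable_mul_bounded integrable_f) => [|z]; last exact: phiM.
    by measurability.
  by rewrite (@Rintegral_f1r (fun t => phi (t, (x.1, x.2))) M) ?mul0r//; measurability.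
- move=> x; rewrite /f4/=.
  rewrite (_ : _ \o _ = EFin \o (fun z => f z * (f x * phi (z.2, (x.1, x.2))))); last first.
    by apply/funext => z /=; congr EFin; ring.
  apply: (@integrable_mul_bounded _ _ _ _ _ _ (`|f x| * M) integrable_f) => [|z].
    by measurability.
  by rewrite normrM ler_wpM2l.
Qed.

Variables (rho3 : T * (T * T) -> R) (rho4 : (T * T) * (T * T) -> R).
Hypothesis mrho3 : measurable_fun setT rho3.
Hypothesis mrho4 : measurable_fun setT rho4.

Let q z := r z ^+ 8.
Let p z := r z ^+ 4.

Hypothesis rho3E : forall x y z,
  `|rho3 (x, (y, z)) - (1 - q (x, y) - q (x, z) - q (y, z))|
  <= 2 * (p (x, y) * p (y, z) * p (z, x)).

Let p4 (v : (T * T) * (T * T)) : R :=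
  p (v.1.1, v.1.2) * p (v.1.2, v.2.1) * p (v.2.1, v.2.2) * p (v.2.2, v.1.1)
  + p (v.1.1, v.1.2) * p (v.1.2, v.2.2) * p (v.2.2, v.2.1) * p (v.2.1, v.1.1)
  + p (v.1.1, v.2.1) * p (v.2.1, v.1.2) * p (v.1.2, v.2.2) * p (v.2.2, v.1.1).

Let phi123 (v : T * (T * T)) := rho3 v - 3 + q (v.1, v.2.1) + q (v.1, v.2.2) + q (v.2.1, v.2.2).
Let phi124 (v : T * (T * T)) := rho3 v + q (v.1, v.2.2) + q (v.2.1, v.2.2).
Let phi134 (v : T * (T * T)) := rho3 v + q (v.2.1, v.2.2).
Let phi234 (v : T * (T * T)) := rho3 v.

(* Each [phi] ignores one of the four points, so it integrates to zero against [f4]. *)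
Hypothesis rho4E : forall v,
  `|rho4 v - (phi123 (v.1.1, (v.1.2, v.2.1)) + phi124 (v.1.1, (v.1.2, v.2.2))
     + phi134 (v.1.1, (v.2.1, v.2.2)) + phi234 (v.1.2, (v.2.1, v.2.2))
     + q v.1 * q v.2 + q (v.1.1, v.2.1) * q (v.1.2, v.2.2)
     + q (v.1.1, v.2.2) * q (v.1.2, v.2.1))| <= 2 * p4 v.

Let rX_ge0 n z : 0 <= r z ^+ n. Proof. by rewrite exprn_ge0. Qed.
Let rX_le1 n z : r z ^+ n <= 1. Proof. by rewrite exprn_ile1. Qed.
Let rX_le m n z : (n <= m)%N -> r z ^+ m <= r z ^+ n.
Proof. by move=> nm; rewrite ler_wiXn2l. Qed.

Let q_ge0 z : 0 <= q z. Proof. exact: rX_ge0. Qed.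
Let q_le1 z : q z <= 1. Proof. exact: rX_le1. Qed.
Let p_ge0 z : 0 <= p z. Proof. exact: rX_ge0. Qed.
Let p_le1 z : p z <= 1. Proof. exact: rX_le1. Qed.
Let p_le_r2 z : p z <= r z ^+ 2. Proof. exact: rX_le. Qed.
Let p_le_r z : p z <= r z. Proof. by rewrite -[leRHS]expr1; exact: rX_le. Qed.

(** Half of the exponents pays for [r (x, y)] through [r_tri]; of the other half only the factor in
    [(z, y)] is kept. *)
Let p_tri x y z : p (x, z) * p (z, y) <= r (x, y) * r (z, y) ^+ 2.
Proof.
rewrite /p (_ : r (x, z) ^+ 4 * r (z, y) ^+ 4
  = (r (x, z) ^+ 2 * r (z, y) ^+ 2) * (r (x, z) ^+ 2 * r (z, y) ^+ 2)); last by ring.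
apply: ler_pM => //; try by rewrite mulr_ge0.
by rewrite -[leRHS]mul1r ler_pM.
Qed.

Let pC x y : p (x, y) = p (y, x). Proof. by rewrite /p rC. Qed.

Let prod4_le (a b c e a' b' c' : R) : 0 <= a -> a <= a' -> 0 <= b -> b <= b' ->
  0 <= c -> c <= c' -> 0 <= e -> e <= 1 -> a * b * c * e <= a' * (b' * c').
Proof.
move=> a0 aa b0 bb c0 cc e0 e1.
by rewrite -[leRHS]mulr1 [a' * _]mulrA !ler_pM ?mulr_ge0.
Qed.

(** [rho3] lies within 2 of [1 - q - q - q]. The value 12 is generous: boundedness serves only for
    integrability. *)
Let phiM (phi : T * (T * T) -> R) : (forall v, phi v = phi123 v) \/
  (forall v, phi v = phi124 v) \/ (forall v, phi v = phi134 v) \/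
  (forall v, phi v = phi234 v) -> forall v, `|phi v| <= 12.
Proof.
move=> H [x [y z]].
have := rho3E x y z; rewrite ler_norml => /andP[h1 h2].
have h3 : p (x, y) * p (y, z) * p (z, x) <= 1.
  by rewrite !mulr_ile1 ?mulr_ge0.
have := rX_ge0 8 (x, y); have := rX_ge0 8 (x, z); have := rX_ge0 8 (y, z).
have := rX_le1 8 (x, y); have := rX_le1 8 (x, z); have := rX_le1 8 (y, z).
rewrite -!/(q _) => ? ? ? ? ? ?.
by rewrite ler_norml; case: H => [|[|[|]]] ->;
  rewrite /phi123/phi124/phi134/phi234/=; apply/andP; split; lra.
Qed.

Let mr1 x : measurable_fun setT (fun y => r (x, y)).
Proof. by measurability. Qed.

Let int_r2 x : integral_le mu (fun y => r (x, y) ^+ 2) C.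
Proof. by split => //; measurability. Qed.

Let int_q x : integral_le mu (fun y => q (x, y)) 1.
Proof. by split => //; rewrite /q; measurability. Qed.

(** Each of the two pairings integrates to at most 1. Each of the three 4-cycles is at most
    [r (x, y)] times two factors [r ^+ 2], which are integrated out one after the other at the price
    [C ^+ 2]. *)
Let int_U (z : T * T) : integral_le mu2
  (fun w => q (z.1, w.1) * q (z.2, w.2) + q (z.1, w.2) * q (z.2, w.1) + 2 * p4 (z, w))
  (2 + 6 * C ^+ 2 * r z).
Proof.
case: z => x y /=.
have H1 : integral_le mu2 (fun w => q (x, w.1) * q (y, w.2)) (1 * 1).
  apply: (@integral_le_mul _ _ _ _ _ mu mu (fun w => q (x, w)) (fun w => q (y, w.2))) => //.
  by rewrite /q; measurability.
have H2 : integral_le mu2 (fun w => q (y, w.1) * q (x, w.2)) (1 * 1).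
  apply: (@integral_le_mul _ _ _ _ _ mu mu (fun w => q (y, w)) (fun w => q (x, w.2))) => //.
  by rewrite /q; measurability.
have H3 u : integral_le mu2 (fun w => r (u, w.1) ^+ 2 * r (w.1, w.2) ^+ 2) (C * C).
  apply: (@integral_le_mul _ _ _ _ _ mu mu (fun w => r (u, w) ^+ 2) (fun w => r (w.1, w.2) ^+ 2)) => //.
  by measurability.
have H4 : integral_le mu2 (fun w => r (x, w.1) ^+ 2 * r (x, w.2) ^+ 2) (C * C).
  apply: (@integral_le_mul _ _ _ _ _ mu mu (fun w => r (x, w) ^+ 2) (fun w => r (x, w.2) ^+ 2)) => //.
  by measurability.
have r0 : 0 <= 2 * r (x, y) by rewrite mulr_ge0.
have := integral_leD (integral_leD H1 H2) (integral_leZ r0 (integral_leD (integral_leD (H3 y) (H3 x)) H4)).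
rewrite (_ : _ + _ * (_ + C * C) = 2 + 6 * C ^+ 2 * r (x, y)); last by ring.
apply: integral_le_le.
- by rewrite /q /p4 /p; measurability.
- by move=> w; rewrite /p4 !addr_ge0 ?mulr_ge0 ?addr_ge0 ?mulr_ge0.
move=> -[u v] /=; rewrite [q (y, u) * _]mulrC lerD2l -mulrA ler_pM2l//.
rewrite !mulrDr /p4/=; apply: lerD; first apply: lerD.
- by apply: prod4_le.
- rewrite [p (v, u)]pC [p (u, x)]pC.
  rewrite (_ : _ * _ = p (x, y) * p (x, u) * p (u, v) * p (y, v)); last by ring.
  by apply: prod4_le.
(* In this cycle [x] and [y] are opposite and no factor [p (x, y)] is present; the path through [v]
   supplies [r (x, y)] by [p_tri]. *)
- rewrite (_ : _ * _ = (p (y, v) * p (v, x)) * p (x, u) * p (u, y)); last by ring.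
  rewrite (_ : r (x, y) * _ = (r (y, x) * r (v, x) ^+ 2) * r (x, u) ^+ 2 * 1); last first.
    by rewrite (rC y x) (rC v x); ring.
  apply: ler_pM => //; first by rewrite !mulr_ge0.
  by apply: ler_pM => //; first [exact: p_tri|rewrite mulr_ge0].
Qed.

Let mphi123 : measurable_fun setT phi123. Proof. by rewrite /phi123 /q; measurability. Qed.
Let mphi124 : measurable_fun setT phi124. Proof. by rewrite /phi124 /q; measurability. Qed.
Let mphi134 : measurable_fun setT phi134. Proof. by rewrite /phi134 /q; measurability. Qed.
Let mphi234 : measurable_fun setT phi234. Proof. by rewrite /phi234 /q; measurability. Qed.
Let mq : measurable_fun setT q. Proof. by rewrite /q; measurability. Qed.
Let mp : measurable_fun setT p. Proof. by rewrite /p; measurability. Qed.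

(** A majorant of what remains of [rho4] once the terms annihilated by [f4] and the disconnected
    product [q v.1 * q v.2] are removed. *)
Let U (v : (T * T) * (T * T)) : R :=
  q (v.1.1, v.2.1) * q (v.1.2, v.2.2) + q (v.1.1, v.2.2) * q (v.1.2, v.2.1) + 2 * p4 v.

Let mU : measurable_fun setT U.
Proof. by rewrite /U /p4; measurability. Qed.

Let U_ge0 v : 0 <= U v.
Proof. by rewrite /U /p4 !addr_ge0 ?mulr_ge0 ?addr_ge0 ?mulr_ge0. Qed.

Let U_le8 v : U v <= 8.
Proof.
have qq (z z' : T * T) : q z * q z' <= 1 by apply: mulr_ile1.
have pp z1 z2 z3 z4 : p z1 * p z2 * p z3 * p z4 <= 1 by rewrite !mulr_ile1 ?mulr_ge0.
rewrite /U /p4.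
have := qq (v.1.1, v.2.1) (v.1.2, v.2.2).
have := qq (v.1.1, v.2.2) (v.1.2, v.2.1).
have := pp (v.1.1, v.1.2) (v.1.2, v.2.1) (v.2.1, v.2.2) (v.2.2, v.1.1).
have := pp (v.1.1, v.1.2) (v.1.2, v.2.2) (v.2.2, v.2.1) (v.2.1, v.1.1).
have := pp (v.1.1, v.2.1) (v.2.1, v.1.2) (v.1.2, v.2.2) (v.2.2, v.1.1).
lra.
Qed.

Let U_sym v : U (v.2, v.1) = U v.
Proof.
case: v => -[x y] [u v]; rewrite /U /p4/=.
have qC a b : q (a, b) = q (b, a) by rewrite /q rC.
rewrite (qC u x) (qC v y) (qC u y) (qC v x).
rewrite (pC u v) (pC v x) (pC x y) (pC y u) (pC v y) (pC u x).
ring.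
Qed.

Let f2_le : integral_le mu2 (fun z => f z ^+ 2) F.
Proof.
by split; [measurability|move=> z; exact: sqr_ge0|rewrite f2F].
Qed.

Let f2r_le : integral_le mu2 (fun z => f z ^+ 2 * r z) Fr.
Proof.
split; [by measurability| |by rewrite f2r].
by move=> z; rewrite mulr_ge0// sqr_ge0.
Qed.

Let f2U1 : integral_le mu4 (fun v => f v.1 ^+ 2 * U v) (2 * F + 6 * C ^+ 2 * Fr).
Proof.
apply: (@integral_le_prod _ _ _ _ _ mu2 mu2 _ (fun z => 2 * f z ^+ 2 + (6 * C ^+ 2) * (f z ^+ 2 * r z))).
- by measurability.
- move=> z /=; rewrite (_ : 2 * _ + _ = f z ^+ 2 * (2 + 6 * C ^+ 2 * r z)); last by ring.
  by apply: integral_leZ; [exact: sqr_ge0|exact: int_U].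
- apply: integral_leD; apply: integral_leZ => //.
  by rewrite mulr_ge0// sqr_ge0.
Qed.

(** Since [|f v.1 * f v.2|] is at most half the sum of the squares and [U] is symmetric, only one of
    the two squares has to be integrated. *)
Let f2U : integral_le mu4 (fun v => 2^-1 * (f v.1 ^+ 2 * U v + f v.2 ^+ 2 * U v))
  (2 * F + 6 * C ^+ 2 * Fr).
Proof.
have f2U2 : integral_le mu4 (fun v => f v.2 ^+ 2 * U v) (2 * F + 6 * C ^+ 2 * Fr).
  rewrite (_ : (fun v => _) = (fun v => (fun v => f v.1 ^+ 2 * U v) (v.2, v.1))).
    exact: (@integral_le_swap _ _ _ mu2 _ _ f2U1).
  by apply/funext => v /=; rewrite U_sym.
have := integral_leZ (_ : 0 <= 2^-1) (integral_leD f2U1 f2U2).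
rewrite (_ : _^-1 * (_ + _ + _) = 2 * F + 6 * C ^+ 2 * Fr); last by field.
by apply; rewrite invr_ge0.
Qed.

Let rest4 v := rho4 v - (phi123 (v.1.1, (v.1.2, v.2.1)) + phi124 (v.1.1, (v.1.2, v.2.2))
     + phi134 (v.1.1, (v.2.1, v.2.2)) + phi234 (v.1.2, (v.2.1, v.2.2)) + q v.1 * q v.2).

Let mrest4 : measurable_fun setT rest4.
Proof. by rewrite /rest4; measurability. Qed.

Let rest4U v : `|rest4 v| <= U v.
Proof.
rewrite -[rest4 v](subrK (q (v.1.1, v.2.1) * q (v.1.2, v.2.2)
     + q (v.1.1, v.2.2) * q (v.1.2, v.2.1))) /U addrC.
apply: (le_trans (ler_normD _ _)); rewrite [`|_ + _|]ger0_norm ?addr_ge0 ?mulr_ge0// lerD2l.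
apply: le_trans (rho4E v); rewrite le_eqVlt; apply/orP; left; apply/eqP; congr `|_|.
by rewrite /rest4; ring.
Qed.

Let f4M (g : (T * T) * (T * T) -> R) M : measurable_fun setT g ->
  (forall v, `|g v| <= M) -> mu4.-integrable setT (EFin \o (fun v => f4 v * g v)).
Proof. by move=> mg gM; exact: (integrable_mul_bounded integrable_f4 mg gM). Qed.

(** The product [q v.1 * q v.2] factorizes into the square of [\int f q]; it is kept exactly,
    because it cancels the squared mean. *)
Lemma integrable_f4_rho4 : mu4.-integrable setT (EFin \o (fun v => f4 v * rho4 v)) /\
  \int[mu4]_v (f4 v * rho4 v) <= (\int[mu2]_z (f z * q z)) ^+ 2 + (2 * F + 6 * C ^+ 2 * Fr).
Proof.
have phiM1 := phiM (or_introl (fun _ => erefl)).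
have phiM2 := phiM (or_intror (or_introl (fun _ => erefl))).
have phiM3 := phiM (or_intror (or_intror (or_introl (fun _ => erefl)))).
have phiM4 := phiM (or_intror (or_intror (or_intror (fun _ => erefl)))).
have i1 : mu4.-integrable setT (EFin \o (fun v => f4 v * phi123 (v.1.1, (v.1.2, v.2.1)))).
  by apply: (@f4M _ 12) => [|v]; [measurability|exact: phiM1].
have i2 : mu4.-integrable setT (EFin \o (fun v => f4 v * phi124 (v.1.1, (v.1.2, v.2.2)))).
  by apply: (@f4M _ 12) => [|v]; [measurability|exact: phiM2].
have i3 : mu4.-integrable setT (EFin \o (fun v => f4 v * phi134 (v.1.1, (v.2.1, v.2.2)))).
  by apply: (@f4M _ 12) => [|v]; [measurability|exact: phiM3].
have i4 : mu4.-integrable setT (EFin \o (fun v => f4 v * phi234 (v.1.2, (v.2.1, v.2.2)))).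
  by apply: (@f4M _ 12) => [|v]; [measurability|exact: phiM4].
have fq : mu2.-integrable setT (EFin \o (fun z => f z * q z)).
  apply: (@integrable_mul_bounded _ _ _ _ _ _ 1 integrable_f) => // z.
  by rewrite ger0_norm ?q_le1 ?q_ge0.
have i5 : mu4.-integrable setT (EFin \o (fun v => (f v.1 * q v.1) * (f v.2 * q v.2))).
  exact: (integrable_prod_mul fq fq).
have i6 : mu4.-integrable setT (EFin \o (fun v => f4 v * rest4 v)).
  by apply: (@f4M _ 8) => // v; exact: le_trans (rest4U v) (U_le8 v).
have i12 := integrableD measurableT i1 i2.
have i13 := integrableD measurableT i12 i3.
have i14 := integrableD measurableT i13 i4.
have i15 := integrableD measurableT i14 i5.
have i16 := integrableD measurableT i15 i6.
have E : (fun v => f4 v * rho4 v) = (fun v => f4 v * phi123 (v.1.1, (v.1.2, v.2.1))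
   + f4 v * phi124 (v.1.1, (v.1.2, v.2.2)) + f4 v * phi134 (v.1.1, (v.2.1, v.2.2))
   + f4 v * phi234 (v.1.2, (v.2.1, v.2.2)) + (f v.1 * q v.1) * (f v.2 * q v.2)
   + f4 v * rest4 v).
  by apply/funext => v; rewrite /rest4 /f4; ring.
rewrite E; split; first exact: i16.
rewrite (RintegralD measurableT i15 i6) (RintegralD measurableT i14 i5).
rewrite (RintegralD measurableT i13 i4) (RintegralD measurableT i12 i3).
rewrite (RintegralD measurableT i1 i2).
rewrite (Rintegral_f4_free4 mphi123 phiM1) (Rintegral_f4_free3 mphi124 phiM2).
rewrite (Rintegral_f4_free2 mphi134 phiM3) (Rintegral_f4_free1 mphi234 phiM4).
rewrite !add0r (Rintegral_prod_mul fq fq) -expr2 lerD2l.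
apply: (le_trans _ (integral_le_Rintegral f2U)).
apply: le_Rintegral => //; first exact: integral_le_integrable f2U.
move=> v _; apply: le_trans (ler_norm _) _; rewrite normrM.
apply: le_trans (ler_wpM2l (normr_ge0 _) (rest4U v)) _.
rewrite -mulrDl mulrA ler_wpM2r// /f4 normrM.
have := sqr_ge0 (`|f v.1| - `|f v.2|).
by rewrite sqrrB !real_normK ?num_real//; lra.
Qed.

Let f3 (v : T * (T * T)) := f (v.1, v.2.1) * f (v.1, v.2.2).

Let mf3 : measurable_fun setT f3.
Proof. by rewrite /f3; measurability. Qed.

(** A product of two values of [f] is dominated by their squares, and the indicator of [A] in the
    point missing from each square keeps it integrable. *)
Lemma integrable_f3 : mu3.-integrable setT (EFin \o f3).
Proof.
pose h (v : T * (T * T)) := f (v.1, v.2.1) ^+ 2 * \1_A v.2.2.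
have mA1 : measurable_fun setT (\1_A : T -> R) by exact: measurable_indic.
have mh : measurable_fun setT h by rewrite /h; measurability.
have h1 : integral_le mu3 h (fine (mu A) * F).
  apply: (@integral_le_triple _ _ _ _ _ (fun z => fine (mu A) * f z ^+ 2)) => //.
    move=> x y; rewrite /h/= [fine _ * _]mulrC; apply: integral_leZ; first exact: sqr_ge0.
    split => //; rewrite integral_indic// setIT fineK//.
    by rewrite ge0_fin_numE.
  by apply: integral_leZ => //; exact: fine_ge0.
have h2 := integral_le_triple_swap h1.
apply: (le_integrable _ _ _ (integral_le_integrable (integral_leD h1 h2))) => //.
  exact/measurable_EFinP.
move=> [x [y z]] _ /=; rewrite lee_fin [leRHS]ger0_norm; last first.
  by apply: addr_ge0; apply: mulr_ge0; rewrite ?sqr_ge0 ?indicE ?ler0n.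
rewrite /f3 /h/= !indicE.
case: (boolP (y \in A)) => [_|/negP]; last first.
  rewrite inE => Ay; rewrite [f (x, y)]fA ?mul0r ?normr0 ?mulr0 ?addr0 ?mulr_ge0 ?sqr_ge0//.
  by case.
case: (boolP (z \in A)) => [_|/negP]; last first.
  rewrite inE => Az; rewrite [f (x, z)]fA ?mulr0 ?normr0 ?add0r ?mulr_ge0 ?sqr_ge0//.
  by case.
rewrite !mulr1 normrM.
have := sqr_ge0 (`|f (x, y)| - `|f (x, z)|).
have := sqr_ge0 (f (x, y)); have := sqr_ge0 (f (x, z)).
by rewrite sqrrB !real_normK ?num_real//; lra.
Qed.

Let f2p1 : integral_le mu3 (fun v => f (v.1, v.2.1) ^+ 2 *
  (p (v.1, v.2.1) * p (v.2.1, v.2.2) * p (v.2.2, v.1))) (C * Fr).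
Proof.
apply: (@integral_le_triple _ _ _ _ _ (fun z => C * (f z ^+ 2 * r z))).
- by measurability.
- move=> x y /=.
  apply: (@integral_le_le _ _ _ _ _ (fun z => (f (x, y) ^+ 2 * r (x, y)) * r (y, z) ^+ 2)).
  + by measurability.
  + by move=> z; rewrite mulr_ge0 ?sqr_ge0// !mulr_ge0.
  + move=> z; rewrite -[_ * r (x, y) * _]mulrA ler_wpM2l ?sqr_ge0// -[leRHS]mulr1.
    by rewrite ler_pM ?mulr_ge0// ler_pM.
  + rewrite [C * _]mulrC; apply: integral_leZ => //.
    by rewrite mulr_ge0 ?sqr_ge0.
- exact: integral_leZ.
Qed.

Let f2p : integral_le mu3 (fun v => (f (v.1, v.2.1) ^+ 2 + f (v.1, v.2.2) ^+ 2) *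
  (p (v.1, v.2.1) * p (v.2.1, v.2.2) * p (v.2.2, v.1))) (2 * (C * Fr)).
Proof.
have := integral_leD f2p1 (integral_le_triple_swap f2p1).
rewrite -mulr2n mulr_natl; congr integral_le; apply/funext => -[x [y z]] /=.
by rewrite mulrDl (pC x z) (pC z y) (pC y x); congr (_ + _); ring.
Qed.

Let rest3 (v : T * (T * T)) := rho3 v - (1 - q (v.1, v.2.1) - q (v.1, v.2.2) - q (v.2.1, v.2.2)).

Let f3M (g : T * (T * T) -> R) M : measurable_fun setT g ->
  (forall v, `|g v| <= M) -> mu3.-integrable setT (EFin \o (fun v => f3 v * g v)).
Proof. by move=> mg gM; exact: (integrable_mul_bounded integrable_f3 mg gM). Qed.

Lemma integrable_f3_q : mu3.-integrable setT (EFin \o (fun v => f3 v * q (v.2.1, v.2.2))).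
Proof.
by apply: (@f3M _ 1) => [|v]; [measurability|rewrite ger0_norm ?q_le1 ?q_ge0].
Qed.

(** For fixed [x] the integral over [(y, z)] factorizes, and its factor in [z] is
    [\int f (x, z) = 0]. *)
Let f3_free3 : \int[mu3]_v (f3 v * (1 - q (v.1, v.2.1))) = 0 /\
  mu3.-integrable setT (EFin \o (fun v => f3 v * (1 - q (v.1, v.2.1)))).
Proof.
have q1 z : `|1 - q z| <= 1.
  by rewrite ler_norml; have := q_ge0 z; have := q_le1 z => ? ?; apply/andP; split; lra.
have i : mu3.-integrable setT (EFin \o (fun v => f3 v * (1 - q (v.1, v.2.1)))).
  by apply: (@f3M _ 1) => [|v]; [measurability|exact: q1].
have j x : mu.-integrable setT (EFin \o (fun y => f (x, y) * (1 - q (x, y)))).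
  by apply: (integrable_mul_bounded (integrable_f1 x)) => [|z]; [measurability|exact: q1].
split => //; apply: Rintegral_prod_eq0l => // x; rewrite /f3/=.
- under eq_Rintegral => z _ do rewrite mulrAC.
  by rewrite (Rintegral_prod_mul (j x) (integrable_f1 x)) f0 mulr0.
- have := integrable_prod_mul (j x) (integrable_f1 x).
  by congr (_.-integrable _ _); apply/funext => z /=; congr EFin; ring.
Qed.

Let f3_free2 : \int[mu3]_v (f3 v * q (v.1, v.2.2)) = 0 /\
  mu3.-integrable setT (EFin \o (fun v => f3 v * q (v.1, v.2.2))).
Proof.
have q1 z : `|q z| <= 1 by rewrite ger0_norm ?q_le1 ?q_ge0.
have i : mu3.-integrable setT (EFin \o (fun v => f3 v * q (v.1, v.2.2))).
  by apply: (@f3M _ 1) => [|v]; [measurability|exact: q1].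
have j x : mu.-integrable setT (EFin \o (fun y => f (x, y) * q (x, y))).
  by apply: (integrable_mul_bounded (integrable_f1 x)) => [|z]; [measurability|exact: q1].
split => //; apply: Rintegral_prod_eq0l => // x; rewrite /f3/=.
- under eq_Rintegral => z _ do rewrite -mulrA.
  by rewrite (Rintegral_prod_mul (integrable_f1 x) (j x)) f0 mul0r.
- have := integrable_prod_mul (integrable_f1 x) (j x).
  by congr (_.-integrable _ _); apply/funext => z /=; congr EFin; ring.
Qed.

(** Among the terms of [1 - q (x, y) - q (x, z) - q (y, z)] only the last one couples [y] with [z]
    and survives; the 3-cycle is absorbed in [\int f^2 r]. *)
Lemma integrable_f3_rho3 : mu3.-integrable setT (EFin \o (fun v => f3 v * rho3 v)) /\
  \int[mu3]_v (f3 v * rho3 v) <= - (\int[mu3]_v (f3 v * q (v.2.1, v.2.2))) + 2 * (C * Fr).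
Proof.
have [z3 i3] := f3_free3; have [z2 i2] := f3_free2; have iq := integrable_f3_q.
have mrest3 : measurable_fun setT rest3 by rewrite /rest3; measurability.
have rest3p v : `|rest3 v| <= 2 * (p (v.1, v.2.1) * p (v.2.1, v.2.2) * p (v.2.2, v.1)).
  by case: v => x [y z]; exact: rho3E.
have ir : mu3.-integrable setT (EFin \o (fun v => f3 v * rest3 v)).
  apply: (@f3M _ 2) => // v; apply: le_trans (rest3p v) _.
  by rewrite -[leRHS]mulr1 ler_pM2l// !mulr_ile1 ?mulr_ge0.
have i32 := integrableB measurableT i3 i2.
have i32q := integrableB measurableT i32 iq.
have i := integrableD measurableT i32q ir.
have E : (fun v => f3 v * rho3 v) = (fun v => f3 v * (1 - q (v.1, v.2.1))
   - f3 v * q (v.1, v.2.2) - f3 v * q (v.2.1, v.2.2) + f3 v * rest3 v).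
  by apply/funext => v; rewrite /rest3; ring.
rewrite E; split; first exact: i.
rewrite (RintegralD measurableT i32q ir) (RintegralB measurableT i32 iq).
rewrite (RintegralB measurableT i3 i2) z3 z2 subr0 sub0r lerD2l.
apply: (le_trans _ (integral_le_Rintegral f2p)).
apply: le_Rintegral => //; first exact: integral_le_integrable f2p.
move=> v _; apply: le_trans (ler_norm _) _; rewrite normrM.
apply: le_trans (ler_wpM2l (normr_ge0 _) (rest3p v)) _.
rewrite [`|f3 v| * _]mulrA ler_wpM2r ?mulr_ge0// /f3 normrM.
have := sqr_ge0 (`|f (v.1, v.2.1)| - `|f (v.1, v.2.2)|).
by rewrite sqrrB !real_normK ?num_real//; lra.
Qed.

(** The mean is [- \int f q], so its square is the disconnected part of the [rho4] integral. *)
Lemma integrable_f_rho2 : mu2.-integrable setT (EFin \o (fun z => f z * (1 - q z))) /\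
  \int[mu2]_z (f z * (1 - q z)) = - \int[mu2]_z (f z * q z).
Proof.
have fq : mu2.-integrable setT (EFin \o (fun z => f z * q z)).
  apply: (@integrable_mul_bounded _ _ _ _ _ _ 1 integrable_f) => // z.
  by rewrite ger0_norm ?q_le1 ?q_ge0.
have E : (fun z => f z * (1 - q z)) = (fun z => f z - f z * q z).
  by apply/funext => z; ring.
have i := integrableB measurableT integrable_f fq.
rewrite E; split; first exact: i.
rewrite (RintegralB measurableT integrable_f fq).
have := @Rintegral_f1l (fun _ => 1) 1; under eq_Rintegral => z _ do rewrite mulr1.
by move=> -> //; rewrite ?sub0r// => _; rewrite normr1.
Qed.

Lemma integrable_f2_rho2 : mu2.-integrable setT (EFin \o (fun z => f z ^+ 2 * (1 - q z))) /\
  \int[mu2]_z (f z ^+ 2 * (1 - q z)) <= F.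
Proof.
have m2 : measurable_fun setT (fun z => f z ^+ 2 * (1 - q z)) by measurability.
have H : integral_le mu2 (fun z => f z ^+ 2 * (1 - q z)) F.
  apply: (integral_le_le _ _ _ f2_le) => //.
  - by move=> z; rewrite mulr_ge0 ?sqr_ge0// subr_ge0.
  - by move=> z; rewrite -[leRHS]mulr1 ler_wpM2l ?sqr_ge0// gerBl.
by split; [exact: integral_le_integrable H|exact: integral_le_Rintegral H].
Qed.

(* [rho4] contributes [2 F] through the pairings across the two factors of [f4], the diagonal another [2 F], and [rho3] the compensating [- 4 \int f3 q]. *)
Lemma ustatistic_variance_le :
  (\int[mu4]_v (f4 v * rho4 v)) + 4 * (\int[mu3]_v (f3 v * rho3 v))
  + 2 * (\int[mu2]_z (f z ^+ 2 * (1 - q z))) - (\int[mu2]_z (f z * (1 - q z))) ^+ 2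
  <= 4 * (F - (\int[mu3]_v (f3 v * q (v.2.1, v.2.2)))) + (6 * C ^+ 2 + 8 * C) * Fr.
Proof.
have [_ h4] := integrable_f4_rho4; have [_ h3] := integrable_f3_rho3.
have [_ h2] := integrable_f2_rho2; have [_ ->] := integrable_f_rho2.
rewrite sqrrN.
move: h4 h3 h2; set I4 := Rintegral mu4 _ _; set I3 := Rintegral mu3 _ _.
set I2 := Rintegral mu2 _ _; set J := Rintegral mu2 _ _; set J3 := Rintegral mu3 _ _.
move=> h4 h3 h2.
have -> : (6 * C ^+ 2 + 8 * C) * Fr = 6 * C ^+ 2 * Fr + 8 * (C * Fr) by ring.
lra.
Qed.

Lemma ustatistic_moments :
  [/\ mu4.-integrable setT (EFin \o (fun v => f v.1 * f v.2 * rho4 v)),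
      mu3.-integrable setT (EFin \o (fun v => f (v.1, v.2.1) * f (v.1, v.2.2) * rho3 v)),
      mu2.-integrable setT (EFin \o (fun z => f z ^+ 2 * (1 - r z ^+ 8))),
      mu2.-integrable setT (EFin \o (fun z => f z * (1 - r z ^+ 8))) &
  (\int[mu4]_v (f v.1 * f v.2 * rho4 v))
  + 4 * (\int[mu3]_v (f (v.1, v.2.1) * f (v.1, v.2.2) * rho3 v))
  + 2 * (\int[mu2]_z (f z ^+ 2 * (1 - r z ^+ 8))) - (\int[mu2]_z (f z * (1 - r z ^+ 8))) ^+ 2
  <= 4 * (F - (\int[mu3]_v (f (v.1, v.2.1) * f (v.1, v.2.2) * r (v.2.1, v.2.2) ^+ 8)))
    + (6 * C ^+ 2 + 8 * C) * Fr].
Proof.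
split; [exact: integrable_f4_rho4.1|exact: integrable_f3_rho3.1|
  exact: integrable_f2_rho2.1|exact: integrable_f_rho2.1|exact: ustatistic_variance_le].
Qed.

End UStatistic.

(** * The pair interaction restricted to the square *)

Lemma ge0_integral_triple d (T : measurableType d) (R : realType)
    (m : {sigma_finite_measure set T -> \bar R}) (h : T * (T * T) -> \bar R) :
  measurable_fun setT h -> (forall v, 0 <= h v)%E ->
  (\int[m \xs (m \xs m)]_v h v
   = \int[m \xs m]_z \int[m]_y h (z.1, (z.2, y)))%E.
Proof.
move=> mh h0.
have m1 : measurable_fun setT (fun v : (T * T) * T => h (v.1.1, (v.1.2, v.2))).
  apply: (measurableT_comp mh); apply: measurable_fun_pair.
    exact: (measurableT_comp measurable_fst measurable_fst).
  apply: measurable_fun_pair => //.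
  exact: (measurableT_comp measurable_snd measurable_fst).
have mF := measurable_fun_fubini_tonelli_F (m2 := m) (fun v => h (v.1.1, (v.1.2, v.2))) m1 (fun v => h0 _).
rewrite fubini_tonelli1// [RHS]fubini_tonelli1//; last first.
  by move=> z; exact: integral_ge0.
apply: eq_integral => x _; rewrite /fubini_F fubini_tonelli1//.
by apply: (measurableT_comp mh); apply: measurable_fun_pair.
Qed.

Lemma ge0_integral_triple_swap d (T : measurableType d) (R : realType)
    (m : {sigma_finite_measure set T -> \bar R}) (h : T * (T * T) -> \bar R) :
  measurable_fun setT h -> (forall v, 0 <= h v)%E ->
  (\int[m \xs (m \xs m)]_v h (v.1, (v.2.2, v.2.1))
   = \int[m \xs (m \xs m)]_v h v)%E.
Proof.
move=> mh h0.
rewrite (fubini_tonelli1 (fun v => h (v.1, (v.2.2, v.2.1))))//; last first.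
  apply: (measurableT_comp mh); apply: measurable_fun_pair => //.
  apply: measurable_fun_pair.
    exact: (measurableT_comp measurable_snd measurable_snd).
  exact: (measurableT_comp measurable_fst measurable_snd).
apply: esym; apply: (etrans (fubini_tonelli1 h mh h0)); apply: esym.
apply: eq_integral => x _.
rewrite /fubini_F/= (@ge0_integral_prod_swap _ _ _ m (fun z => h (x, z)))//.
by apply: (measurableT_comp mh); apply: measurable_fun_pair.
Qed.

(** The difference of the two sides is a multiple of [(t - |u|)^2]; the weight [t] is tuned later to
    balance the two terms. *)
Lemma normr_le_young (R : realFieldType) (t u : R) :
  0 < t -> `|u| <= t / 2 + (2 * t)^-1 * u ^+ 2.
Proof.
move=> t0; rewrite -(real_normK (num_real u)); move: `|u| => v.
have -> : t / 2 + (2 * t)^-1 * v ^+ 2 = v + (2 * t)^-1 * (t - v) ^+ 2.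
  by field; rewrite gt_eqF.
by rewrite lerDl mulr_ge0 ?sqr_ge0// invr_ge0 mulr_ge0// ltW.
Qed.

(** [g1 - g2] is telescoped through [s1] and [s2], and 3 is the cost of squaring a sum of three
    terms. On the right each term drops one indicator, so that the freed point can be integrated
    over the whole plane. *)
Lemma kernel_difference_le (R : realFieldType) (X Y Z Q c d G s1 s2 g1 g2 : R) :
  X = 1 \/ X = 0 -> Y = 1 \/ Y = 0 -> Z = 1 \/ Z = 0 ->
  0 <= Q -> 0 <= c -> 0 <= G -> Q * (c * d) <= c * G -> (s1 - s2) ^+ 2 <= c * d ->
  X * Y * Z * (g1 - g2) ^+ 2 * Q <=
  3 * (X * (Y * (g1 - s1) ^+ 2) * Q + X * (Z * (g2 - s2) ^+ 2) * Q + X * Y * (c * G)).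
Proof.
move=> x01 y01 z01 Q0 c0 G0 qG lip.
have key : (g1 - g2) ^+ 2 <= 3 * ((g1 - s1) ^+ 2 + (g2 - s2) ^+ 2 + (s1 - s2) ^+ 2).
  have := sqr_ge0 ((g1 - s1) + (g2 - s2)); have := sqr_ge0 ((g1 - s1) - (s1 - s2)).
  have := sqr_ge0 ((g2 - s2) + (s1 - s2)); nra.
have key2 : Q * (g1 - g2) ^+ 2 <= 3 * (Q * (g1 - s1) ^+ 2 + Q * (g2 - s2) ^+ 2 + c * G).
  apply: le_trans (ler_wpM2l Q0 key) _.
  rewrite mulrCA ler_wpM2l// !mulrDr lerD2l; apply: le_trans qG.
  exact: ler_wpM2l.
have a0 := mulr_ge0 Q0 (sqr_ge0 (g1 - s1)); have b0 := mulr_ge0 Q0 (sqr_ge0 (g2 - s2)).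
have d0 := mulr_ge0 c0 G0.
have -> : X * Y * Z * (g1 - g2) ^+ 2 * Q = X * Y * Z * (Q * (g1 - g2) ^+ 2) by ring.
have -> : X * (Y * (g1 - s1) ^+ 2) * Q = X * Y * (Q * (g1 - s1) ^+ 2) by ring.
have -> : X * (Z * (g2 - s2) ^+ 2) * Q = X * Z * (Q * (g2 - s2) ^+ 2) by ring.
move: (Q * (g1 - g2) ^+ 2) (Q * (g1 - s1) ^+ 2) (Q * (g2 - s2) ^+ 2) (c * G) key2 a0 b0 d0.
move=> A1 A2 A3 A4; clear Q0 c0 G0 qG lip key => h1 h2 h3 h4; case: x01 => ->; case: y01 => ->; case: z01 => ->; lra.
Qed.

(** This is [2 a b = a^2 + b^2 - (a - b)^2], with indicators equal to their squares. *)
Lemma polarization_indicator (R : realFieldType) (X Y Z Q g1 g2 : R) :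
  X = 1 \/ X = 0 -> Y = 1 \/ Y = 0 -> Z = 1 \/ Z = 0 ->
  X * Y * g1 * (X * Z * g2) * Q = 2^-1 * ((X * Y * g1) ^+ 2 * (Z * Q)
    + (X * Z * g2) ^+ 2 * (Y * Q) - X * Y * Z * (g1 - g2) ^+ 2 * Q).
Proof. by case=> ->; case=> ->; case=> ->; field. Qed.

Lemma defect_le (R : realFieldType) (a b c w u v : R) :
  a <= b + w -> c <= 3 * (2 * u + 4 * v) -> a - 2^-1 * (2 * b - c) <= w + 3 * u + 6 * v.
Proof. lra. Qed.

Section TorusKernel.
Context {R : realType}.
Local Notation mu := (@lebesgue_measure R).
Local Notation leb2 := (mu \xs mu)%E.
Implicit Types (x y : R * R) (M : nat).

Variables (N : nat) (g : R * R -> R).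
Hypothesis N0 : (0 < N)%N.
Hypothesis mg : measurable_fun setT g.
Hypothesis gN : forall x, g (- x) = g x.
Hypothesis gP : forall x l, @lattice R N l -> g (x + l) = g x.
Hypothesis g_approx : forall e : R, 0 < e -> exists M,
  (\int[leb2]_(x in @square R N) ((g x - trig_sum N M x) ^+ 2)%:E <= e%:E)%E.

Let sq : R * R -> R := \1_(@square R N).

Let sq01 x : sq x = 1 \/ sq x = 0.
Proof. by rewrite /sq indicE; case: (_ \in _); [left|right]. Qed.

Let msq : measurable_fun setT sq.
Proof. by apply: measurable_indic; exact: measurable_square. Qed.

Let sq_ge0 x : 0 <= sq x. Proof. by case: (sq01 x) => ->. Qed.
Let sq_le1 x : sq x <= 1. Proof. by case: (sq01 x) => ->. Qed.

Lemma integral_squareE (h : R * R -> R) :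
  (\int[leb2]_(x in @square R N) (h x)%:E = \int[leb2]_x (sq x * h x)%:E)%E.
Proof.
rewrite integral_mkcond; apply: eq_integral => x _; rewrite patchE /sq indicE.
by case: (_ \in _); rewrite ?mul1r ?mul0r.
Qed.

Lemma integral_le_square_sub (h : R * R -> R) (a : R) x :
  measurable_fun setT h -> (forall y, 0 <= h y) ->
  (forall y l, @lattice R N l -> h (y + l) = h y) ->
  (\int[leb2]_(y in @square R N) (h y)%:E <= a%:E)%E ->
  integral_le leb2 (fun y => sq y * h (x - y)) a.
Proof.
move=> mh h0 hP ha; split.
- apply: measurable_funM => //.
  exact: (measurableT_comp mh (measurable_plane_sub x)).
- by move=> y; rewrite mulr_ge0.
- rewrite -(integral_squareE (fun y => h (x - y))).
  rewrite (@ge0_integral_square_periodic _ N x (EFin \o h))//.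
  + exact/measurable_EFinP.
  + by move=> z l Nl /=; rewrite hP.
Qed.

Definition torus_kernel (z : (R * R) * (R * R)) : R := sq z.1 * sq z.2 * g (z.1 - z.2).

Local Notation f := torus_kernel.

Lemma measurable_torus_kernel : measurable_fun setT f.
Proof.
have ms := measurable_gauss2_sub.
apply: measurable_funM; first apply: measurable_funM.
- exact: (measurableT_comp msq measurable_fst).
- exact: (measurableT_comp msq measurable_snd).
apply: (measurableT_comp mg); apply: measurable_fun_pair; apply: measurable_funB.
- exact: (measurableT_comp measurable_fst measurable_fst).
- exact: (measurableT_comp measurable_fst measurable_snd).
- exact: (measurableT_comp measurable_snd measurable_fst).
- exact: (measurableT_comp measurable_snd measurable_snd).
Qed.

Lemma torus_kernelC x y : f (x, y) = f (y, x).
Proof. by rewrite /torus_kernel/= -gN opprB [sq x * _]mulrC. Qed.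

Lemma torus_kernel0 x y : ~ (@square R N x /\ @square R N y) -> f (x, y) = 0.
Proof.
move=> /not_andP[h|h]; rewrite /torus_kernel /sq/= !indicE.
  by rewrite [x \in _]memNset// !mul0r.
by rewrite [y \in _]memNset// mulr0 mul0r.
Qed.

(* Shifting by half a period in a coordinate with nonzero frequency changes the sign of the wave. *)
Lemma Rintegral_wave (m n : int) x : (m, n) != (0, 0) ->
  \int[leb2]_y (sq y * wave N m n (x - y)) = 0.
Proof.
move=> mn.
have N0' : N%:R != 0 :> R by rewrite pnatr_eq0 -lt0n.
have [a aE] : exists a : R * R, forall z, wave N m n (a + z) = - wave N m n z.
  have H (k : int) : k != 0 -> (k%:~R : R) != 0 by rewrite intr_eq0.
  case: (eqVneq m 0) => [m0|/H m0]; last first.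
    exists (N%:R / (2 * m%:~R), 0) => z; rewrite /wave/= add0r -cosDpi; congr cos.
    by field; rewrite N0'.
  have /H n0 : n != 0 by move: mn; rewrite m0 xpair_eqE eqxx.
  exists (0, N%:R / (2 * n%:~R)) => z; rewrite /wave/= add0r -cosDpi; congr cos.
  by field; rewrite N0'.
(* Adding 1 makes the integrand nonnegative, as [ge0_integral_square_periodic] requires; the
   constant cancels in the comparison [key]. *)
pose h z : R := 1 + wave N m n z.
have mh : measurable_fun setT h by apply: measurable_funD => //; exact: measurable_wave.
have h0 z : 0 <= h z.
  by have := wave_le1 N m n z; rewrite ler_norml /h => /andP[]; lra.
have hP z l : @lattice R N l -> h (z + l) = h z by move=> ?; rewrite /h wave_periodic.
have isq := integral_le_integrable (@integral_le_square R N).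
have iw y : leb2.-integrable setT (EFin \o (fun z => sq z * wave N m n (y - z))).
  apply: (@integrable_mul_bounded _ _ _ _ _ _ 1 isq) => [|z]; last exact: wave_le1.
  exact: (measurableT_comp (measurable_wave N m n) (measurable_plane_sub y)).
have hE y : \int[leb2]_z (sq z * h (y - z)) = \int[leb2]_z sq z + \int[leb2]_z (sq z * wave N m n (y - z)).
  rewrite -(RintegralD measurableT isq (iw y)).
  by apply: eq_Rintegral => z _; rewrite /h mulrDr mulr1.
have hc y : \int[leb2]_z (sq z * h (y - z)) = \int[leb2]_z (sq z * h z).
  rewrite /Rintegral; congr fine.
  rewrite -(integral_squareE (fun z => h (y - z))) -(integral_squareE h).
  rewrite (@ge0_integral_square_periodic _ N y (EFin \o h))//.
  - exact/measurable_EFinP.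
  - by move=> z l Nl /=; rewrite hP.
have key (b c e e' : R) : b = c + e -> b = c + e' -> e' = - e -> e = 0.
  by move=> *; lra.
have := hE x; have := hE (a + x); rewrite !hc => h1 h2; apply: (key _ _ _ _ h2 h1).
have : \int[leb2]_z (sq z * wave N m n (a + x - z)) = - (\int[leb2]_z (sq z * wave N m n (x - z))).
  rewrite -[RHS]mulN1r -RintegralZl//; apply: eq_Rintegral => z _.
  by rewrite -addrA aE mulN1r mulrN.
by [].
Qed.

Lemma Rintegral_sum_eq0 d (T : measurableType d) (m : {measure set T -> \bar R})
    (I : Type) (s : seq I) (P : pred I) (F : I -> T -> R) :
  (forall i, P i -> m.-integrable setT (EFin \o F i) /\ \int[m]_t F i t = 0) ->
  m.-integrable setT (EFin \o (fun t => \sum_(i <- s | P i) F i t)) /\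
  \int[m]_t (\sum_(i <- s | P i) F i t) = 0.
Proof.
move=> HF; elim: s => [|i s [IH1 IH2]].
  under eq_Rintegral do rewrite big_nil; split; last first.
    by rewrite /Rintegral integral0.
  rewrite (_ : _ \o _ = cst 0%E); first exact: integrable0.
  by apply/funext => t; rewrite /= big_nil.
case: (boolP (P i)) => Pi; last first.
  have E : (fun t => \sum_(j <- i :: s | P j) F j t) = (fun t => \sum_(j <- s | P j) F j t).
    by apply/funext => t; rewrite big_cons (negbTE Pi).
  by rewrite E.
have E : (fun t => \sum_(j <- i :: s | P j) F j t) = (fun t => F i t + \sum_(j <- s | P j) F j t).
  by apply/funext => t; rewrite big_cons Pi.
have [h1 h2] := HF i Pi; rewrite E; split.
  exact: (integrableD measurableT h1 IH1).
by rewrite (RintegralD measurableT h1 IH1) h2 IH2 addr0.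
Qed.

Lemma Rintegral_trig_sum M x : \int[leb2]_y (sq y * trig_sum N M (x - y)) = 0.
Proof.
rewrite /trig_sum; under eq_Rintegral => y _ do rewrite mulr_sumr.
apply: (Rintegral_sum_eq0 _ _).2 => i _.
rewrite (_ : (fun y => _) = (fun y => \sum_(j < M.*2.+1 | (i%:Z - M%:Z, j%:Z - M%:Z) != (0, 0))
   (sq y * (wave N (i%:Z - M%:Z) (j%:Z - M%:Z) (x - y) * wave_weight (i%:Z - M%:Z) (j%:Z - M%:Z))))); last first.
  by apply/funext => y; rewrite mulr_sumr.
apply: Rintegral_sum_eq0 => j ij.
have iw : leb2.-integrable setT (EFin \o (fun z => sq z * wave N (i%:Z - M%:Z) (j%:Z - M%:Z) (x - z))).
  apply: (@integrable_mul_bounded _ _ _ _ _ _ 1 (integral_le_integrable (@integral_le_square R N))) => [|z].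
    exact: (measurableT_comp (measurable_wave N _ _) (measurable_plane_sub x)).
  exact: wave_le1.
rewrite (_ : (fun y => _) = (fun y => (sq y * wave N (i%:Z - M%:Z) (j%:Z - M%:Z) (x - y)) * wave_weight (i%:Z - M%:Z) (j%:Z - M%:Z))); last first.
  by apply/funext => y; rewrite mulrA.
split; first exact: (integrableZr measurableT _ iw).
by rewrite RintegralZr// Rintegral_wave// mul0r.
Qed.

Let m2sub M : measurable_fun setT (fun x => (g x - trig_sum N M x) ^+ 2).
Proof. by apply: measurable_funX; apply: measurable_funB => //; exact: measurable_trig_sum. Qed.

Let sub_le M e x : (\int[leb2]_(x in @square R N) ((g x - trig_sum N M x) ^+ 2)%:E <= e%:E)%E ->
  integral_le leb2 (fun y => sq y * (g (x - y) - trig_sum N M (x - y)) ^+ 2) e.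
Proof.
move=> He; apply: (@integral_le_square_sub (fun x => (g x - trig_sum N M x) ^+ 2)) => //.
- by move=> y; exact: sqr_ge0.
- by move=> y l Nl; rewrite gP// trig_sum_periodic.
Qed.

Let g2_le M e x : (\int[leb2]_(x in @square R N) ((g x - trig_sum N M x) ^+ 2)%:E <= e%:E)%E ->
  integral_le leb2 (fun y => sq y * g (x - y) ^+ 2) (2 * e + 2 * ((trig_bound M : R) ^+ 2 * N%:R ^+ 2)).
Proof.
move=> He; have h1 := integral_leZ (_ : 0 <= 2) (sub_le x He).
have h2 := integral_leZ (_ : 0 <= 2) (integral_leZ (sqr_ge0 ((trig_bound M : R))) (@integral_le_square R N)).
apply: (integral_le_le _ _ _ (integral_leD (h1 _) (h2 _))) => //.
- apply: measurable_funM => //; apply: measurable_funX.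
  exact: (measurableT_comp mg (measurable_plane_sub x)).
- by move=> y; rewrite mulr_ge0// sqr_ge0.
- move=> y; case: (sq01 y) => yE; rewrite -/(sq y) yE; last by rewrite !(mul0r, mulr0, addr0).
  rewrite !mul1r mulr1.
  have := trig_sum_le N M (x - y); move: (trig_sum _ _ _) (g _) => s u hs.
  have : s ^+ 2 <= (trig_bound M : R) ^+ 2.
    by rewrite -real_normK ?num_real// lerXn2r ?nnegrE// (le_trans _ hs).
  have := sqr_ge0 (u - 2 * s); nra.
Qed.

(** Trigonometric sums without constant term integrate to exactly zero, so the integral of [g]
    equals that of [g] minus such a sum, which is arbitrarily small in L2. *)
Lemma Rintegral_torus_kernel x : \int[leb2]_y f (x, y) = 0.
Proof.
rewrite /torus_kernel/=; case: (sq01 x) => xE; last first.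
  by rewrite xE; under eq_Rintegral do rewrite !mul0r; rewrite /Rintegral integral0.
rewrite xE; under eq_Rintegral => y _ do rewrite mul1r.
have isq := integral_le_integrable (@integral_le_square R N).
have mgx : measurable_fun setT (fun y => g (x - y)).
  exact: (measurableT_comp mg (measurable_plane_sub x)).
have [M1 h1] := g_approx ltr01.
have ig : leb2.-integrable setT (EFin \o (fun y => sq y * g (x - y))).
  apply: (le_integrable _ _ _ (integrableD measurableT isq (integral_le_integrable (g2_le x h1)))) => //.
    by apply/measurable_EFinP; exact: measurable_funM.
  move=> y _ /=; rewrite lee_fin; case: (sq01 y) => yE; rewrite -/(sq y) yE; last first.
    by rewrite !mul0r normr0 normr_ge0.
  rewrite !mul1r [leRHS]ger0_norm ?addr_ge0 ?sqr_ge0//.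
  by rewrite -(real_normK (num_real (g _))); have := sqr_ge0 (`|g (x - y)| - 1);
    have := normr_ge0 (g (x - y)); nra.
apply/eqP; rewrite -normr_le0; apply/ler_addgt0Pl => e e0; rewrite addr0.
have N2 : 0 < N%:R ^+ 2 :> R by rewrite exprn_gt0// ltr0n.
(* With this weight and squared L2 error [e * t], both terms of Young's inequality integrate to at
   most [e / 2]. *)
pose t := e / N%:R ^+ 2; have t0 : 0 < t by rewrite divr_gt0.
have [M hM] := g_approx (mulr_gt0 e0 t0).
have is_ : leb2.-integrable setT (EFin \o (fun y => sq y * trig_sum N M (x - y))).
  apply: (@integrable_mul_bounded _ _ _ _ _ _ ((trig_bound M : R)) isq) => [|z]; last exact: trig_sum_le.
  exact: (measurableT_comp (measurable_trig_sum N M) (measurable_plane_sub x)).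
have -> : \int[leb2]_y (sq y * g (x - y)) =
   \int[leb2]_y (sq y * (g (x - y) - trig_sum N M (x - y))).
  rewrite -[LHS]subr0 -(Rintegral_trig_sum M x) -(RintegralB measurableT ig is_).
  by apply: eq_Rintegral => y _; rewrite mulrBr.
have id : leb2.-integrable setT (EFin \o (fun y => sq y * (g (x - y) - trig_sum N M (x - y)))).
  rewrite (_ : _ \o _ = (fun y => (sq y * g (x - y))%:E - (sq y * trig_sum N M (x - y))%:E)%E).
    exact: integrableB.
  by apply/funext => y /=; rewrite mulrBr.
apply: (le_trans (le_normr_Rintegral measurableT id)).
have t20 : 0 <= t / 2 by rewrite divr_ge0// ltW.
have t21 : 0 <= (2 * t)^-1 by rewrite invr_ge0 mulr_ge0// ltW.
have hh := integral_leD (integral_leZ t20 (@integral_le_square R N)) (integral_leZ t21 (sub_le x hM)).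
have -> : e = t / 2 * N%:R ^+ 2 + (2 * t)^-1 * (e * t).
  have N' : N%:R != 0 :> R by rewrite pnatr_eq0 -lt0n.
  have e' : e != 0 by rewrite gt_eqF.
  by rewrite /t; field; rewrite ?N' ?e'.
apply: (integral_le_Rintegral (integral_le_le _ _ _ hh)) => //.
- apply: measurableT_comp => //; apply: measurable_funM => //; apply: measurable_funB => //.
  exact: (measurableT_comp (measurable_trig_sum N M) (measurable_plane_sub x)).
- move=> y; rewrite -/(sq y); case: (sq01 y) => ->; rewrite !(mul0r, mulr0, mul1r, mulr1, normr0, addr0)//.
  exact: normr_le_young.
Qed.

Section Approximated.
Variables (M : nat) (e : R).
Hypothesis He :
  (\int[leb2]_(x in @square R N) ((g x - trig_sum N M x) ^+ 2)%:E <= e%:E)%E.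

Local Notation mu2 := (leb2 \xs leb2)%E.
Local Notation mu3 := (leb2 \xs mu2)%E.
Local Notation S := (trig_bound M : R).
Local Notation L := (trig_lip M : R).
Local Notation n := (N%:R : R).
(** Bounds the integral of [g^2] over any translate of the reflected square: the approximation
    error, plus the supremum of the partial sum times the area. *)
Let H := 2 * e + 2 * (S ^+ 2 * n ^+ 2).
Let mf := measurable_torus_kernel.

Let e_ge0 : 0 <= e.
Proof.
by rewrite -lee_fin; apply: le_trans He; apply: integral_ge0 => x _; rewrite lee_fin sqr_ge0.
Qed.

Let H_ge0 : 0 <= H.
Proof. by rewrite /H; have := mulr_ge0 (sqr_ge0 S) (sqr_ge0 n); have := e_ge0; lra. Qed.

Let sqr_torus_kernel z : f z ^+ 2 = sq z.1 * (sq z.2 * g (z.1 - z.2) ^+ 2).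
Proof.
by rewrite /torus_kernel; case: (sq01 z.1) => ->; case: (sq01 z.2) => ->; ring.
Qed.

Let r c (z : (R * R) * (R * R)) := gauss2 c (z.1 - z.2).
Let mr c : measurable_fun setT (r c) := measurable_gauss2_sub c.
Let r_ge0 c z : 0 <= r c z. Proof. exact: gauss2_ge0. Qed.

Let sq_int : integral_le leb2 sq (n ^+ 2). Proof. exact: integral_le_square. Qed.

Let scale_sq c : 0 <= c -> integral_le leb2 (fun x => sq x * c) (n ^+ 2 * c).
Proof.
move=> c0; have := integral_leZ c0 sq_int.
by rewrite [c * _]mulrC; congr integral_le; apply/funext => x; rewrite mulrC.
Qed.

Lemma torus_kernel_sqr_inner x : integral_le leb2 (fun y => f (x, y) ^+ 2) (sq x * H).
Proof.
have := integral_leZ (sq_ge0 x) (g2_le x He).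
by congr integral_le; apply/funext => y; rewrite sqr_torus_kernel.
Qed.

Lemma torus_kernel_sqr : integral_le mu2 (fun z => f z ^+ 2) (n ^+ 2 * H).
Proof.
apply: (@integral_le_prod _ _ _ _ _ leb2 leb2 _ (fun x => sq x * H)).
- exact: measurable_funX.
- exact: torus_kernel_sqr_inner.
- exact: scale_sq.
Qed.

Let msubs : measurable_fun setT (fun z : (R * R) * (R * R) =>
  (g (z.1 - z.2) - trig_sum N M (z.1 - z.2)) ^+ 2).
Proof.
apply: (measurableT_comp (m2sub M)); apply: measurable_fun_pair; apply: measurable_funB.
- exact: (measurableT_comp measurable_fst measurable_fst).
- exact: (measurableT_comp measurable_fst measurable_snd).
- exact: (measurableT_comp measurable_snd measurable_fst).
- exact: (measurableT_comp measurable_snd measurable_snd).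
Qed.

Let g_split (u s : R) : `|s| <= S -> u ^+ 2 <= 2 * (u - s) ^+ 2 + 2 * S ^+ 2.
Proof.
move=> hs; have : s ^+ 2 <= S ^+ 2.
  by rewrite -real_normK ?num_real// lerXn2r ?nnegrE// (le_trans _ hs).
have := sqr_ge0 (u - 2 * s); nra.
Qed.

(** The bounded part of [g] now meets [\int r = 8] in place of the area, which lowers its
    contribution from order [N^4] to order [N^2]; the L2 error is estimated with [r <= 1]. *)
Lemma torus_kernel_sqr_gauss : integral_le mu2 (fun z => f z ^+ 2 * r (pi / 8) z)
  (n ^+ 2 * (2 * e + 16 * S ^+ 2)).
Proof.
have c0 : 0 <= 2 * e + 16 * S ^+ 2 by have := sqr_ge0 S; have := e_ge0; lra.
apply: (@integral_le_prod _ _ _ _ _ leb2 leb2 _ (fun x => sq x * (2 * e + 16 * S ^+ 2))).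
- by apply: measurable_funM; [exact: measurable_funX|exact: mr].
- move=> x.
  have p8 : 0 < pi / 8 :> R by rewrite divr_gt0// pi_gt0.
  have h1 := integral_leZ (_ : 0 <= 2) (sub_le x He).
  have h2 := integral_leZ (_ : 0 <= 2 * S ^+ 2) (@integral_le_gauss2 R (pi / 8) x p8).
  have pE : pi / (pi / 8) = 8 :> R.
    by rewrite invfM invrK mulrA divff ?mul1r// gt_eqF ?pi_gt0.
  have := integral_leZ (sq_ge0 x) (integral_leD (h1 _) (h2 _)).
  rewrite pE (_ : 2 * e + _ = 2 * e + 16 * S ^+ 2); last by ring.
  move=> h; apply: (integral_le_le _ _ _ (h _ _)) => //.
  + apply: measurable_funM; first by case: (torus_kernel_sqr_inner x).
    by case: (@integral_le_gauss2 R (pi / 8) x p8).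
  + by move=> y; rewrite mulr_ge0 ?sqr_ge0 ?r_ge0.
  + move=> y; rewrite sqr_torus_kernel/= -mulrA ler_wpM2l// -/(sq y).
    have r1 : gauss2 (pi / 8) (x - y) <= 1 by apply: gauss2_le1; exact: ltW.
    have r0 := gauss2_ge0 (pi / 8) (x - y).
    rewrite /r/=; case: (sq01 y) => ->; last first.
      rewrite !mul0r mulr0 add0r; apply: mulr_ge0 => //.
      by apply: mulr_ge0 => //; exact: sqr_ge0.
    rewrite !mul1r; apply: le_trans (ler_wpM2r r0 (g_split _ (trig_sum_le N M (x - y)))) _.
    rewrite mulrDl lerD2r ler_piMr//; apply: mulr_ge0 => //; exact: sqr_ge0.
  + by apply: mulr_ge0 => //; exact: sqr_ge0.
- exact: scale_sq.
Qed.

Let q := r pi.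
Let G := r (pi / 2).

Let q_int x : integral_le leb2 (fun y => q (x, y)) 1.
Proof.
have := @integral_le_gauss2 R pi x (pi_gt0 R).
by rewrite divff ?gt_eqF ?pi_gt0.
Qed.

Let G_int x : integral_le leb2 (fun y => G (x, y)) 2.
Proof.
have p2 : 0 < pi / 2 :> R by rewrite divr_gt0 ?pi_gt0.
have := integral_le_gauss2 x p2.
by rewrite invfM invrK mulrA divff ?mul1r// gt_eqF ?pi_gt0.
Qed.

Let mq : measurable_fun setT q := mr _.
Let mG : measurable_fun setT G := mr _.
Let mb := @measurable_edge_weight R N.

(** [u] is a square produced by polarization, [w] the price of the indicator of the third point in
    it, and [beta] the squared difference. *)
Let u (v : (R * R) * ((R * R) * (R * R))) := f (v.1, v.2.1) ^+ 2 * (sq v.2.2 * q (v.2.1, v.2.2)).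
Let w (v : (R * R) * ((R * R) * (R * R))) := f (v.1, v.2.1) ^+ 2 * (edge_weight N v.2.1 * G (v.2.1, v.2.2)).
Let beta (v : (R * R) * ((R * R) * (R * R))) :=
  sq v.1 * sq v.2.1 * sq v.2.2 * (g (v.1 - v.2.1) - g (v.1 - v.2.2)) ^+ 2 * q (v.2.1, v.2.2).

Let w_int : integral_le mu3 w (16 * n * H).
Proof.
have h1 : integral_le mu2 (fun z => f z ^+ 2 * edge_weight N z.1) (8 * n * H).
  apply: (@integral_le_prod _ _ _ _ _ leb2 leb2 _ (fun x => H * (sq x * edge_weight N x))).
  - by measurability.
  - move=> x /=.
    have := integral_leZ (edge_weight_ge0 N x) (torus_kernel_sqr_inner x).
    rewrite (_ : edge_weight N x * _ = H * (sq x * edge_weight N x)); last by ring.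
    by congr integral_le; apply/funext => y; rewrite mulrC.
  - by rewrite [_ * H]mulrC; apply: integral_leZ => //; exact: integral_edge_weight.
have h2 : integral_le mu2 (fun z => 2 * (f z ^+ 2 * edge_weight N z.2)) (16 * n * H).
  have := integral_leZ (_ : 0 <= 2) (integral_le_swap h1).
  rewrite (_ : 2 * (8 * n * H) = 16 * n * H); last by ring.
  move=> /(_ (ler0n _ _)); congr integral_le; apply/funext => -[x y] /=.
  by rewrite torus_kernelC.
apply: (integral_le_triple _ _ h2); first by rewrite /w; measurability.
move=> x y; rewrite /w/=.
have c0 : 0 <= f (x, y) ^+ 2 * edge_weight N y by rewrite mulr_ge0 ?sqr_ge0 ?edge_weight_ge0.
have := integral_leZ c0 (G_int y).
by rewrite [_ * 2]mulrC; congr integral_le; apply/funext => z; rewrite mulrA.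
Qed.

Let mgd : measurable_fun setT (fun v : (R * R) * (R * R) => g (v.1 - v.2)).
Proof.
apply: (measurableT_comp mg); apply: measurable_fun_pair; apply: measurable_funB.
- exact: (measurableT_comp measurable_fst measurable_fst).
- exact: (measurableT_comp measurable_fst measurable_snd).
- exact: (measurableT_comp measurable_snd measurable_fst).
- exact: (measurableT_comp measurable_snd measurable_snd).
Qed.

Let mgv (a b : (R * R) * ((R * R) * (R * R)) -> R * R) : measurable_fun setT a ->
  measurable_fun setT b -> measurable_fun setT (fun v => g (a v - b v)).
Proof.
move=> ma mb'; have := measurable_fun_pair ma mb'.
exact: (measurableT_comp mgd).
Qed.

Let mbeta : measurable_fun setT beta.
Proof.
have h1 := @mgv (fun v => v.1) (fun v => v.2.1) measurable_fst (measurableT_comp measurable_fst measurable_snd).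
have h2 := @mgv (fun v => v.1) (fun v => v.2.2) measurable_fst (measurableT_comp measurable_snd measurable_snd).
have ms1 : measurable_fun setT (fun v : (R * R) * ((R * R) * (R * R)) => sq v.1 * sq v.2.1 * sq v.2.2) by measurability.
have mq1 : measurable_fun setT (fun v : (R * R) * ((R * R) * (R * R)) => q (v.2.1, v.2.2)) by measurability.
by rewrite /beta; apply: measurable_funM => //; apply: measurable_funM => //;
  apply: measurable_funX; apply: measurable_funB.
Qed.

Let T1_int : integral_le mu3 (fun v => sq v.1 * (sq v.2.1 *
   (g (v.1 - v.2.1) - trig_sum N M (v.1 - v.2.1)) ^+ 2) * q (v.2.1, v.2.2)) (n ^+ 2 * e).
Proof.
have h : integral_le mu2 (fun z => sq z.1 * (sq z.2 *
   (g (z.1 - z.2) - trig_sum N M (z.1 - z.2)) ^+ 2)) (n ^+ 2 * e).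
  apply: (@integral_le_prod _ _ _ _ _ leb2 leb2 _ (fun x => sq x * e)).
  - by apply: measurable_funM; [measurability|apply: measurable_funM => //; measurability].
  - by move=> x /=; exact: (integral_leZ (sq_ge0 x) (sub_le x He)).
  - exact: scale_sq.
apply: (integral_le_triple _ _ h).
  have mm := measurableT_comp msubs (_ : measurable_fun setT (fun v : (R * R) * ((R * R) * (R * R)) => (v.1, v.2.1))).
  have mm' := mm _.
  apply: measurable_funM; last by measurability.
  apply: measurable_funM; first by measurability.
  apply: measurable_funM; first by measurability.
  by apply: mm'; measurability.
move=> x y /=.
have c0 : 0 <= sq x * (sq y * (g (x - y) - trig_sum N M (x - y)) ^+ 2).
  by apply: mulr_ge0 => //; apply: mulr_ge0 => //; exact: sqr_ge0.
by have := integral_leZ c0 (q_int y); rewrite mulr1.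
Qed.

(** The constant collects [2 (L / n)^2] from the Lipschitz bound, 2 from [\int G], and [n^4] from
    two points free in the square. *)
Let T3_int : integral_le mu3 (fun v => sq v.1 * sq v.2.1 * (2 * (L / n) ^+ 2 * G (v.2.1, v.2.2)))
  (4 * L ^+ 2 * n ^+ 2).
Proof.
have n0 : n != 0 by rewrite pnatr_eq0 -lt0n.
have h : integral_le mu2 (fun z => (4 * (L / n) ^+ 2) * (sq z.1 * sq z.2)) (4 * L ^+ 2 * n ^+ 2).
  rewrite (_ : 4 * L ^+ 2 * n ^+ 2 = (4 * (L / n) ^+ 2) * (n ^+ 2 * n ^+ 2)); last by field.
  apply: integral_leZ; first by rewrite mulr_ge0 ?sqr_ge0.
  apply: (@integral_le_mul _ _ _ _ _ leb2 leb2 sq (fun z => sq z.2)) => //.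
  by measurability.
apply: (integral_le_triple _ _ h); first by measurability.
move=> x y /=.
have c0 : 0 <= sq x * sq y * (2 * (L / n) ^+ 2).
  by apply: mulr_ge0; [exact: mulr_ge0|apply: mulr_ge0 => //; exact: sqr_ge0].
have := integral_leZ c0 (G_int y).
rewrite (_ : _ * 2 = 4 * (L / n) ^+ 2 * (sq x * sq y)); last by ring.
by congr integral_le; apply/funext => z; exact/esym/mulrA.
Qed.

(* Replacing [g] by a trigonometric sum costs two L2 errors; the sum is Lipschitz with constant [L / n], and the factor |y - z|^2 turns [q] into at most [G]. *)
Let beta_int : integral_le mu3 beta (3 * (2 * (n ^+ 2 * e) + 4 * L ^+ 2 * n ^+ 2)).
Proof.
have h := integral_leZ (ler0n R 3) (integral_leD (integral_leD T1_int (integral_le_triple_swap T1_int)) T3_int).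
rewrite (_ : n ^+ 2 * e + n ^+ 2 * e = 2 * (n ^+ 2 * e)) in h; last by ring.
apply: (integral_le_le _ _ _ h) => //.
  move=> v; apply: mulr_ge0; last exact: r_ge0.
  apply: mulr_ge0; last exact: sqr_ge0.
  by apply: mulr_ge0 => //; exact: mulr_ge0.
move=> [x [y z]]; rewrite /beta/=.
have c0 : 0 <= 2 * (L / n) ^+ 2 by apply: mulr_ge0 => //; exact: sqr_ge0.
have qG : q (y, z) * (2 * (L / n) ^+ 2 * ((y - z).1 ^+ 2 + (y - z).2 ^+ 2)) <= 2 * (L / n) ^+ 2 * G (y, z).
  rewrite mulrCA; apply: ler_wpM2l => //; rewrite mulrC /q /G /r/=.
  have := @gauss2_sqr_le R (pi / 2) (y - z); rewrite (_ : 2 * (pi / 2) = pi)//; last by field.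
  apply.
  by rewrite ler_pdivlMr// mul1r pi_ge2.
have qC : q (z, y) = q (y, z) by rewrite /q /r/= gauss2C.
have q0 : 0 <= q (y, z) by exact: r_ge0.
have G0 : 0 <= G (y, z) by exact: r_ge0.
have := sq01 z; have := sq01 y; have := sq01 x => x01 y01 z01.
have := trig_sum_lipschitz M (x - y) (x - z) N0.
have -> : (x - y - (x - z)).1 ^+ 2 + (x - y - (x - z)).2 ^+ 2 = (y - z).1 ^+ 2 + (y - z).2 ^+ 2.
  by rewrite /=; ring.
move: qG; rewrite qC.
move=> qG lip; exact: (kernel_difference_le _ _ x01 y01 z01 q0 c0 G0 qG lip).
Qed.

Let mf' (a b : (R * R) * ((R * R) * (R * R)) -> R * R) : measurable_fun setT a ->
  measurable_fun setT b -> measurable_fun setT (fun v => f (a v, b v)).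
Proof.
move=> ma mb'; exact: (measurableT_comp mf (measurable_fun_pair ma mb')).
Qed.

Let m31 : measurable_fun setT (fun v : (R * R) * ((R * R) * (R * R)) => v.1).
Proof. exact: measurable_fst. Qed.
Let m32 : measurable_fun setT (fun v : (R * R) * ((R * R) * (R * R)) => v.2.1).
Proof. exact: (measurableT_comp measurable_fst measurable_snd). Qed.
Let m33 : measurable_fun setT (fun v : (R * R) * ((R * R) * (R * R)) => v.2.2).
Proof. exact: (measurableT_comp measurable_snd measurable_snd). Qed.

Let f2q_int : (\int[mu3]_v (f (v.1, v.2.1) ^+ 2 * q (v.2.1, v.2.2))%:E
  = \int[mu2]_z (f z ^+ 2)%:E)%E.
Proof.
have p := pi_gt0 R.
rewrite (@ge0_integral_triple _ _ _ leb2 (fun v => (f (v.1, v.2.1) ^+ 2 * q (v.2.1, v.2.2))%:E)); last 2 first.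
- apply/measurable_EFinP; apply: measurable_funM; first by apply: measurable_funX; exact: mf'.
  by measurability.
- by move=> v; rewrite lee_fin mulr_ge0 ?sqr_ge0 ?r_ge0.
apply: eq_integral => -[x y] _ /=.
under eq_integral => z _ do rewrite EFinM.
rewrite ge0_integralZl//; last 3 first.
- by apply/measurable_EFinP; case: (integral_le_gauss2 y p).
- by move=> z _; rewrite lee_fin r_ge0.
- by rewrite lee_fin sqr_ge0.
by rewrite (integral_gauss2_sub y p) divff ?gt_eqF// mule1.
Qed.

Let f2q_le : integral_le mu3 (fun v => f (v.1, v.2.1) ^+ 2 * q (v.2.1, v.2.2)) (n ^+ 2 * H).
Proof.
split; last by rewrite f2q_int; case: torus_kernel_sqr.
- apply: measurable_funM; first by apply: measurable_funX; exact: mf'.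
  by measurability.
- by move=> v; rewrite mulr_ge0 ?sqr_ge0 ?r_ge0.
Qed.

Let u_le : integral_le mu3 u (n ^+ 2 * H).
Proof.
apply: (integral_le_le _ _ _ f2q_le).
- rewrite /u; apply: measurable_funM; first by apply: measurable_funX; exact: mf'.
  by measurability.
- by move=> v; apply: mulr_ge0; [exact: sqr_ge0|rewrite mulr_ge0 ?r_ge0].
- move=> v; rewrite /u ler_wpM2l ?sqr_ge0// -[leRHS]mul1r ler_wpM2r ?r_ge0//.
Qed.

Let u_swap : \int[mu3]_v (u (v.1, (v.2.2, v.2.1))) = \int[mu3]_v (u v).
Proof.
have [mu_ u0 _] := u_le; have mE : measurable_fun setT (EFin \o u) by exact/measurable_EFinP.
have E0 v : (0 <= (EFin \o u) v)%E by rewrite lee_fin.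
exact: (congr1 fine (@ge0_integral_triple_swap _ _ _ leb2 _ mE E0)).
Qed.

(* The mass that [q (y, .)] puts outside the square is what makes [\int u] smaller than [\int f^2]. *)
Let F_le : \int[mu2]_z (f z ^+ 2) <= \int[mu3]_v (u v) + 16 * n * H.
Proof.
have -> : \int[mu2]_z (f z ^+ 2) = \int[mu3]_v (f (v.1, v.2.1) ^+ 2 * q (v.2.1, v.2.2)).
  by congr fine; rewrite f2q_int.
have iu := integral_le_integrable u_le; have iw := integral_le_integrable w_int.
apply: (le_trans _ (lerD (lexx _) (integral_le_Rintegral w_int))).
rewrite -(RintegralD measurableT iu iw).
apply: (le_Rintegral measurableT (integral_le_integrable f2q_le) (integrableD measurableT iu iw)).
move=> [x [y z]] _; rewrite /u /w/= -mulrDr.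
case: (pselect (@square R N y)) => [yN|yN].
  by apply: ler_wpM2l; [exact: sqr_ge0|exact: gauss2_pi_le_edge].
have f0 : f (x, y) = 0 by apply: torus_kernel0 => -[].
by rewrite f0 expr0n !mul0r.
Qed.

(** By polarization and the exchange of [y] and [z], the product integral is
    [\int u - (1/2) \int beta], while [F_le] bounds [\int f^2 - \int u] by the edge effect. *)
Lemma torus_kernel_defect :
  \int[mu2]_z (f z ^+ 2)
   - (\int[mu3]_v (f (v.1, v.2.1) * f (v.1, v.2.2) * q (v.2.1, v.2.2)))
   <= 16 * n * H + 3 * n ^+ 2 * e + 6 * L ^+ 2 * n ^+ 2.
Proof.
have iu := integral_le_integrable u_le.
have iu' := integral_le_integrable (integral_le_triple_swap u_le).
have ib := integral_le_integrable beta_int.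
have i2 := integrableD measurableT iu iu'.
have i3 := integrableB measurableT i2 ib.
have E : \int[mu3]_v (f (v.1, v.2.1) * f (v.1, v.2.2) * q (v.2.1, v.2.2))
    = 2^-1 * (2 * (\int[mu3]_v (u v)) - \int[mu3]_v (beta v)).
  transitivity (\int[mu3]_v (2^-1 * (u v + u (v.1, (v.2.2, v.2.1)) - beta v))).
    apply: eq_Rintegral => -[x [y z]] _; rewrite /u /beta /torus_kernel/=.
    have -> : q (z, y) = q (y, z) by rewrite /q /r/= gauss2C.
    exact: polarization_indicator.
  rewrite (RintegralZl _ measurableT i3) (RintegralB measurableT i2 ib).
  rewrite (RintegralD measurableT iu iu') u_swap.
  by move: (\int[mu3]_v (u v)) (\int[mu3]_v (beta v)) => a b; ring.
have := integral_le_Rintegral beta_int; have := F_le; rewrite E.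
move: (\int[mu2]_z _) (\int[mu3]_v (u v)) (\int[mu3]_v (beta v)) => a b c h1.
by rewrite -(mulrA 4) -(mulrA 3) -(mulrA 6); exact: defect_le.
Qed.

End Approximated.

End TorusKernel.

(** * Sums over distinct points of the process *)

Lemma big_tuple_recl (T : finType) (V : nmodType) (k : nat)
    (P : pred (k.+1.-tuple T)) (F : k.+1.-tuple T -> V) :
  \sum_(t | P t) F t = \sum_x \sum_(t : k.-tuple T | P [tuple of x :: t]) F [tuple of x :: t].
Proof.
rewrite pair_big_dep/= (reindex (fun p : T * k.-tuple T => [tuple of p.1 :: p.2]))//=.
exists (fun t : k.+1.-tuple T => (thead t, [tuple of behead t])) => [[x t] _|t _] /=.
  by congr (_, _); apply/val_inj.
by rewrite -tuple_eta.
Qed.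

Lemma big_tuple0 (T : finType) (V : nmodType) (P : pred (0.-tuple T))
    (F : 0.-tuple T -> V) :
  \sum_(t | P t) F t = if P [tuple] then F [tuple] else 0.
Proof.
rewrite (eq_bigl (fun t => (t == [tuple]) && P t)); last first.
  by move=> t; rewrite [t]tuple0 eqxx.
case: ifPn => P0; last by rewrite big_pred0// => t; rewrite [t]tuple0 eqxx (negbTE P0).
by rewrite (big_pred1 [tuple])// => t; rewrite [t]tuple0 eqxx P0.
Qed.

Section PairSums.
Context {R : comRingType} {I : finType}.
Variable B : I -> I -> R.
Hypothesis BC : forall i j, B i j = B j i.
Hypothesis B0 : forall i, B i i = 0.

Lemma sum_pair_split i j : i != j ->
  \sum_k \sum_l B k l = 2 * B i j
    + 2 * (\sum_(k | (k != i) && (k != j)) (B i k + B j k))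
    + \sum_(k | (k != i) && (k != j)) \sum_(l | (l != i) && (l != j)) B k l.
Proof.
move=> ij.
have split (c : I -> R) : \sum_k c k = c i + c j + \sum_(k | (k != i) && (k != j)) c k.
  by rewrite (bigD1 i)//= (bigD1 j)/= ?addrA// eq_sym.
rewrite split.
under [X in _ + X]eq_bigr => k _ do rewrite split (BC k i) (BC k j).
rewrite (split (B i)) (split (B j)) !B0.
by rewrite !big_split/= (BC j i); ring.
Qed.

(** Terms are sorted by the indices common to [(i, j)] and [(k, l)]: one common index can be placed
    in four ways, a common pair in two. *)
Lemma sum_pair_sqr :
  (\sum_i \sum_j B i j) ^+ 2 =
  \sum_i \sum_j \sum_(k | (k != i) && (k != j)) \sum_(l | (l != i) && (l != j)) B i j * B k l
  + 4 * (\sum_i \sum_j \sum_(k | (k != i) && (k != j)) B i j * B i k)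
  + 2 * (\sum_i \sum_j B i j ^+ 2).
Proof.
have E : \sum_i \sum_j \sum_(k | (k != i) && (k != j)) B i j * B j k
       = \sum_i \sum_j \sum_(k | (k != i) && (k != j)) B i j * B i k.
  rewrite exchange_big/=; apply: eq_bigr => i _; apply: eq_bigr => j _.
  by apply: eq_big => k; [rewrite andbC|rewrite BC].
rewrite expr2 {1}mulr_suml.
transitivity (\sum_i \sum_j (\sum_(k | (k != i) && (k != j)) \sum_(l | (l != i) && (l != j)) B i j * B k l
  + 2 * (\sum_(k | (k != i) && (k != j)) B i j * B i k)
  + 2 * (\sum_(k | (k != i) && (k != j)) B i j * B j k) + 2 * B i j ^+ 2)).
  apply: eq_bigr => i _; rewrite mulr_suml; apply: eq_bigr => j _.
  have [->|ij] := eqVneq i j.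
    rewrite !B0 mul0r expr0n/= mulr0 addr0.
    under eq_bigr => k _ do (under eq_bigr do rewrite mul0r; rewrite big1_eq).
    rewrite big1_eq add0r.
    under eq_bigr => k _ do rewrite mul0r.
    by rewrite big1_eq !mulr0 addr0.
  rewrite (sum_pair_split ij) !mulrDr.
  under [X in _ = X + _ + _ + _]eq_bigr => k _ do rewrite -mulr_sumr.
  by rewrite -!mulr_sumr big_split/=; ring.
rewrite (eq_bigr (fun i => \sum_j \sum_(k | (k != i) && (k != j)) \sum_(l | (l != i) && (l != j)) B i j * B k l
  + 2 * (\sum_j \sum_(k | (k != i) && (k != j)) B i j * B i k)
  + 2 * (\sum_j \sum_(k | (k != i) && (k != j)) B i j * B j k) + 2 * \sum_j B i j ^+ 2)).
  by rewrite !big_split/= -!mulr_sumr E; ring.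
by move=> i _; rewrite !big_split/= -!mulr_sumr.
Qed.

End PairSums.

Section DistinctTuples.
Context {R : realType}.

(* The weight [w i] in {0, 1} selects the indices that carry a point. *)
Definition distinct_sum (n k : nat) (w : nat -> R) (T : Type) (p : nat -> T)
    (F : k.-tuple T -> R) : R :=
  \sum_(t : k.-tuple 'I_n | uniq t)
     (\prod_(i <- t) w i) * F [tuple of [seq p (val i) | i <- t]].

Variables (n : nat) (w : nat -> R) (T : Type) (p : nat -> T).
Hypothesis w01 : forall i, w i = 1 \/ w i = 0.
Local Notation S k := (@distinct_sum n k w T p).

Lemma distinct_sum_pair (G : 2.-tuple T -> R) : S 2 G =
  \sum_(i < n) \sum_(j < n) (if i != j then w i * w j * G [tuple p i; p j] else 0).
Proof.
rewrite /distinct_sum big_tuple_recl; apply: eq_bigr => i _.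
rewrite big_tuple_recl; apply: eq_bigr => j _.
rewrite big_tuple0/= inE andbT; case: ifP => // _.
rewrite !big_cons big_nil mulr1; congr (_ * _ * G _); exact/val_inj.
Qed.

Let triple_tuple (G : 3.-tuple T -> R) : S 3 G =
  \sum_(i < n) \sum_(j < n) \sum_(k < n)
   (if uniq [:: i; j; k] then w i * (w j * w k) * G [tuple p i; p j; p k] else 0).
Proof.
rewrite /distinct_sum big_tuple_recl; apply: eq_bigr => i _.
rewrite big_tuple_recl; apply: eq_bigr => j _.
rewrite big_tuple_recl; apply: eq_bigr => k _.
rewrite big_tuple0/=; case: ifP => // _.
rewrite !big_cons big_nil mulr1; congr (_ * (_ * _) * G _); exact/val_inj.
Qed.

Let quadruple_tuple (G : 4.-tuple T -> R) : S 4 G =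
  \sum_(i < n) \sum_(j < n) \sum_(k < n) \sum_(l < n)
   (if uniq [:: i; j; k; l]
    then w i * (w j * (w k * w l)) * G [tuple p i; p j; p k; p l] else 0).
Proof.
rewrite /distinct_sum big_tuple_recl; apply: eq_bigr => i _.
rewrite big_tuple_recl; apply: eq_bigr => j _.
rewrite big_tuple_recl; apply: eq_bigr => k _.
rewrite big_tuple_recl; apply: eq_bigr => l _.
rewrite big_tuple0/=; case: ifP => // _.
rewrite !big_cons big_nil mulr1; congr (_ * (_ * (_ * _)) * G _); exact/val_inj.
Qed.

(** A common index carries its weight twice in the product; weights in {0, 1} are idempotent, which
    restores the weights of the triple and pair sums. *)
Lemma distinct_sum_sqr (f : T * T -> R) : (forall x y, f (x, y) = f (y, x)) ->
  S 2 (fun t => f (tnth t 0, tnth t 1)) ^+ 2 =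
  S 4 (fun t => f (tnth t 0, tnth t 1) * f (tnth t 2%R, tnth t 3%R))
  + 4 * S 3 (fun t => f (tnth t 0, tnth t 1) * f (tnth t 0, tnth t 2%R))
  + 2 * S 2 (fun t => f (tnth t 0, tnth t 1) ^+ 2).
Proof.
move=> fC; rewrite !distinct_sum_pair triple_tuple quadruple_tuple.
have w2 i : w i * w i = w i by case: (w01 i) => ->; rewrite ?mulr1// mulr0.
have := @sum_pair_sqr R 'I_n (fun i j => if i != j then w i * w j * f (p i, p j) else 0).
move=> /(_ _ _)->; last 2 first.
- by move=> i j; rewrite eq_sym fC [w j * _]mulrC.
- by move=> i; rewrite eqxx.
congr (_ + 4 * _ + 2 * _).
- apply: eq_bigr => i _; apply: eq_bigr => j _.
  rewrite big_mkcond/=; apply: eq_bigr => k _; case: ifPn => [/andP[ki kj]|kij].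
    rewrite big_mkcond/=; apply: eq_bigr => l _.
    rewrite !inE !negb_or !andbT [i == k]eq_sym [j == k]eq_sym [i == l]eq_sym [j == l]eq_sym ki kj /=.
    rewrite [k == l]eq_sym.
    case: (eqVneq i j) => ij/=; first by rewrite mul0r if_same.
    by case: (l == i) => //=; case: (l == j) => //=; case: (l == k) => //=; rewrite ?mulr0//; ring.
  rewrite big1// => l _; rewrite !inE !negb_or !andbT [i == k]eq_sym [j == k]eq_sym.
  by move: kij; case: (k != i) => /= [/negbTE ->|_]; rewrite ?andbF.
- apply: eq_bigr => i _; apply: eq_bigr => j _.
  rewrite big_mkcond/=; apply: eq_bigr => k _.
  rewrite !inE !negb_or !andbT [i == k]eq_sym [j == k]eq_sym.
  case: (eqVneq i j) => ij/=; first by rewrite mul0r if_same.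
  case: (eqVneq k i) => ki //=; case: (eqVneq k j) => kj //=.
  by rewrite -[in RHS](w2 i) /tnth/=; ring.
- apply: eq_bigr => i _; apply: eq_bigr => j _.
  case: (eqVneq i j) => ij/=; first by rewrite expr0n.
  by rewrite /tnth/= -{2}(w2 i) -{2}(w2 j); ring.
Qed.

End DistinctTuples.

Lemma esum_finite_support (R : realType) (T : choiceType) (D : set T) (r : seq T)
    (a : T -> R) :
  uniq r -> [set` r] `<=` D -> (forall i, D i -> i \notin r -> a i = 0) ->
  (forall i, 0 <= a i) ->
  (\esum_(i in D) (a i)%:E = (\sum_(i <- r) a i)%:E)%E.
Proof.
move=> ur rD ar a0.
have -> : (\esum_(i in D) (a i)%:E = \esum_(i in [set` r]) (a i)%:E)%E.
  rewrite esum_mkcond [RHS]esum_mkcond; congr esum; apply/funext => i.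
  case: ifPn => [/set_mem iD|iD]; case: ifPn => [/set_mem/= ir|ir] //.
    by rewrite ar//; apply/negP => ir'; move/negP: ir; apply; exact/mem_set.
  by move/negP: iD => []; exact/mem_set/rD.
rewrite esum_fset//; last by move=> i _; rewrite lee_fin.
by rewrite -fsbig_seq// sumEFin.
Qed.

Section ProcessSums.
Context (R : realType) (d : measure_display) (Omega : measurableType d).
Variable X : point_process R Omega.
Implicit Types (omega : Omega) (k N : nat).

Definition distinct_indices k omega : set (k.-tuple nat) :=
  [set i : k.-tuple nat | uniq i /\ forall j, pp_dom X (tnth i j) omega].

Definition points k omega (t : k.-tuple nat) : k.-tuple (R * R) :=
  [tuple pp_pt X (tnth t j) omega | j < k].

Definition process_sum k (F : k.-tuple (R * R) -> R) omega : R :=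
  \sum_(t \in distinct_indices omega) F (points omega t).

Definition supported_in_square N k (F : k.-tuple (R * R) -> R) :=
  forall x, F x != 0 -> forall j, square N (tnth x j).

Lemma finite_points_in_square N omega :
  finite_set [set i | pp_dom X i omega /\ square N (pp_pt X i omega)].
Proof.
(* Points of the square have modulus at most [sqrt 2 N], hence lie in the disc of radius [2 N]. *)
apply: sub_finite_set (pp_locally_finite X omega (2 * N%:R)) => i [iX]; split => //.
move: b; rewrite /square/= => -[/andP[a1 a2] /andP[b1 b2]].
rewrite normc_def lecR /toC/=.
have : 0 <= 2 * N%:R :> R by rewrite mulr_ge0.
move=> /ger0_norm <-; rewrite -sqrtr_sqr ler_sqrt ?sqr_ge0//.
by move: a1 a2 b1 b2; move: (N%:R : R) => n; nra.
Qed.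

Let weight omega i : R := \1_(pp_dom X i) omega.

(** An explicit list of the admissible tuples with entries below [n], through which [esum], the
    finitely supported sum and the truncated sum are compared. *)
Let index_seq n k omega : seq (k.-tuple nat) :=
  [seq map_tuple val t | t : k.-tuple 'I_n <- enum {: k.-tuple 'I_n} & uniq t && all (fun i : 'I_n => omega \in pp_dom X i) t].

Let index_seqE n k omega (F : k.-tuple (R * R) -> R) :
  \sum_(t <- index_seq n k omega) F (points omega t)
  = distinct_sum n (weight omega) (fun i => pp_pt X i omega) F.
Proof.
rewrite big_map big_filter big_enum_cond/= /distinct_sum.
rewrite [RHS](bigID (fun t : k.-tuple 'I_n => all (fun i : 'I_n => omega \in pp_dom X i) t))/=.
rewrite [X in _ + X]big1 ?addr0.
  apply: eq_bigr => t /andP[_ /allP h].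
  rewrite big_seq big1 ?mul1r; last by move=> i /h iX; rewrite /weight indicE iX.
  congr (F _); apply: eq_from_tnth => j.
  by rewrite !tnth_mktuple !tnth_map.
move=> t /andP[_ /allPn[i it iX]].
by rewrite (big_rem i)//= /weight indicE (negbTE iX) !mul0r.
Qed.

Let index_seq_uniq n k omega : uniq (index_seq n k omega).
Proof.
rewrite map_inj_uniq; first exact/filter_uniq/enum_uniq.
by move=> s t /(congr1 val)/= /(inj_map val_inj)/val_inj.
Qed.

Let index_seq_sub n k omega : [set` index_seq n k omega] `<=` distinct_indices omega.
Proof.
move=> s /= /mapP[t + ->]; rewrite mem_filter => /andP[/andP[ut /allP aX] _].
split; first by rewrite map_inj_uniq//; exact: val_inj.
by move=> j; rewrite tnth_map; apply/set_mem/aX/mem_tnth.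
Qed.

Let index_seq_support N omega : exists n0, forall n, (n0 <= n)%N ->
  forall k (F : k.-tuple (R * R) -> R), supported_in_square N F ->
  forall t, distinct_indices omega t -> t \notin index_seq n k omega ->
    F (points omega t) = 0.
Proof.
have [n0 hn0] : exists n0, forall i, pp_dom X i omega -> square N (pp_pt X i omega) -> (i < n0)%N.
  have fin := finite_points_in_square N omega.
  exists (\max_(i <- finmap.enum_fset (fset_set [set i | pp_dom X i omega /\ square N (pp_pt X i omega)])) i).+1.
  move=> i iX iN; rewrite ltnS; apply: leq_bigmax_seq => //.
  by rewrite in_fset_set//; exact/mem_set.
exists n0 => n n0n k F FN t [ut tX]; apply: contraNeq => /FN tN.
have lt j : (tnth t j < n)%N.
  by apply: leq_trans n0n; apply: hn0 => //; have := tN j; rewrite tnth_mktuple.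
have tE : t = map_tuple val [tuple Ordinal (lt j) | j < k].
  by apply: eq_from_tnth => j; rewrite tnth_map tnth_mktuple.
rewrite tE; apply/map_f; rewrite mem_filter mem_enum andbT.
rewrite -(map_inj_uniq val_inj) [uniq _](_ : _ = uniq t); last by rewrite [in RHS]tE.
rewrite ut/=; apply/allP => x /mapP[j _ ->] /=; exact/mem_set.
Qed.

(** The threshold depends on the configuration and the square, not on [k] or [F]: identities between
    truncated sums of different arities transfer at a common [n]. *)
Lemma process_sumE N omega : exists n0, forall n, (n0 <= n)%N ->
  forall k (F : k.-tuple (R * R) -> R), supported_in_square N F ->
  process_sum F omega = distinct_sum n (weight omega) (fun i => pp_pt X i omega) F.
Proof.
have [n0 h] := index_seq_support N omega; exists n0 => n /h {}h k F FN.
rewrite /process_sum (fsbigE (index_seq n k omega)); last 3 first.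
- exact: index_seq_uniq.
- exact: index_seq_sub.
- exact: h.
rewrite -index_seqE big_seq_cond [RHS]big_seq.
apply: eq_bigl => t; case: (boolP (t \in index_seq _ _ _)) => //= /index_seq_sub tD.
exact/mem_set.
Qed.

Lemma esum_process_sum N k (F : k.-tuple (R * R) -> R) omega :
  supported_in_square N F -> (forall x, 0 <= F x) ->
  (\esum_(t in distinct_indices omega) (F (points omega t))%:E
   = (process_sum F omega)%:E)%E.
Proof.
move=> FN F0; have [n1 h1] := process_sumE N omega.
have [n2 h2] := index_seq_support N omega.
rewrite (h1 (maxn n1 n2) (leq_maxl _ _) _ _ FN) -index_seqE.
apply: esum_finite_support => //.
- exact: index_seq_uniq.
- exact: index_seq_sub.
- exact: (h2 _ (leq_maxr _ _) _ _ FN).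
Qed.

Lemma measurable_points k (t : k.-tuple nat) : measurable_fun setT (fun omega => points omega t).
Proof.
apply/measurable_fun_tnthP => j.
rewrite (_ : _ \o _ = pp_pt X (tnth t j)); first exact: pp_pt_measurable.
by apply/funext => omega /=; rewrite tnth_mktuple.
Qed.

(** At each [omega] the truncated sums are eventually constant, so the sum is a pointwise limit of
    measurable functions. *)
Lemma measurable_process_sum N k (F : k.-tuple (R * R) -> R) :
  measurable_fun setT F -> supported_in_square N F ->
  measurable_fun setT (process_sum F).
Proof.
move=> mF FN.
apply: (@measurable_fun_cvg _ _ _ _
  (fun n omega => distinct_sum n (weight omega) (fun i => pp_pt X i omega) F)).
  move=> n; rewrite /distinct_sum.
  under eq_fun => omega do rewrite big_mkcond/=.
  apply: (@measurable_sum _ _ _ setT _ _ (fun (t : k.-tuple 'I_n) omega => if uniq t then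
    (\prod_(i <- t) weight omega i) * F [tuple of [seq pp_pt X (val i) omega | i <- t]]
    else 0)) => t.
  case: (uniq t); last exact: measurable_cst.
  apply: measurable_funM.
    by apply: measurable_prod => i _; exact: (measurable_indic (pp_dom_measurable X i)).
  rewrite (_ : (fun x => _) = F \o (fun omega => points omega (map_tuple val t))).
    by apply: measurableT_comp => //; exact: measurable_points.
  apply/funext => omega /=; congr (F _); apply: eq_from_tnth => j.
  by rewrite !tnth_mktuple !tnth_map.
move=> omega _; apply: cvg_near_cst.
have [n0 h] := process_sumE N omega.
by exists n0 => // n /h {}h; apply/eqP; rewrite h.
Qed.

Lemma process_sum_funr N k (F : k.-tuple (R * R) -> R) omega :
  supported_in_square N F ->
  process_sum F omega = process_sum F^\+ omega - process_sum F^\- omega.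
Proof.
move=> FN; have [n0 h] := process_sumE N omega.
rewrite !(h n0 (leqnn _))//.
- by rewrite /distinct_sum -sumrB; apply: eq_bigr => t _; rewrite -mulrBr -{1}(funrposBneg F).
- by move=> x /= x0; apply: FN; apply: contraNN x0 => /eqP Fx; rewrite /funrneg Fx oppr0 maxxx.
- by move=> x /= x0; apply: FN; apply: contraNN x0 => /eqP Fx; rewrite /funrpos Fx maxxx.
Qed.

End ProcessSums.

(** * Expectations of sums over distinct points *)

Section Correlation.
Context (R : realType) (d : measure_display) (Omega : measurableType d).
Variables (P : probability Omega R) (X : point_process R Omega).
Variables (k : nat) (rho : k.-tuple (R * R) -> R).
Hypothesis hrho : is_correlation_function P X rho.
Context (dT : measure_display) (T : measurableType dT).
(** These recode tuples of points as nested pairs with a product measure, the setting of the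
    estimates on [f]. *)
Variables (nu : {measure set T -> \bar R}) (enc : T -> k.-tuple (R * R)).
Hypothesis menc : measurable_fun setT enc.
Hypothesis nuE : forall G : k.-tuple (R * R) -> \bar R,
  measurable_fun setT G -> (forall x, 0 <= G x)%E ->
  (integral_plane_pow G = \int[nu]_z G (enc z))%E.
Variables (N : nat) (F : k.-tuple (R * R) -> R).
Hypothesis mF : measurable_fun setT F.
Hypothesis FN : supported_in_square N F.

Lemma ge0_integral_process_sum : (forall x, 0 <= F x) ->
  (\int[P]_omega (process_sum X F omega)%:E
   = \int[nu]_z (F (enc z) * rho (enc z))%:E)%E.
Proof.
move=> F0; have [mrho rho0 H] := hrho.
transitivity (integral_plane_pow (fun x => (F x)%:E * (rho x)%:E)%E).
  rewrite -H; [|exact/measurable_EFinP|by move=> x; rewrite lee_fin].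
  by apply: eq_integral => omega _; rewrite -(@esum_process_sum _ _ _ X N).
rewrite nuE//.
- by apply: emeasurable_funM; exact/measurable_EFinP.
- by move=> x; rewrite mule_ge0 ?lee_fin.
Qed.

End Correlation.

(** Correlation functions are characterized on nonnegative functions only; the identity is applied
    to the positive and negative parts of [F], both dominated by [|F|], and the results are
    subtracted. *)
Lemma integrable_process_sum (R : realType) (d : measure_display) (Omega : measurableType d)
    (P : probability Omega R) (X : point_process R Omega)
    (k : nat) (rho : k.-tuple (R * R) -> R) (hrho : is_correlation_function P X rho)
    (dT : measure_display) (T : measurableType dT)
    (nu : {measure set T -> \bar R}) (enc : T -> k.-tuple (R * R)) (N : nat)
    (F : k.-tuple (R * R) -> R) (h : T -> R) :
  nu.-integrable setT (EFin \o h) -> measurable_fun setT enc ->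
  (forall G : k.-tuple (R * R) -> \bar R,
    measurable_fun setT G -> (forall x, 0 <= G x)%E ->
    (integral_plane_pow G = \int[nu]_z G (enc z))%E) ->
  measurable_fun setT F -> supported_in_square N F ->
  (forall z, F (enc z) * rho (enc z) = h z) ->
  P.-integrable setT (EFin \o process_sum X F) /\
  \int[P]_omega process_sum X F omega = \int[nu]_z h z.
Proof.
move=> + menc nuE mF FN /funext hE; rewrite -hE => iF; have [mrho rho0 _] := hrho.
pose G z := F (enc z) * rho (enc z).
have sup (f : k.-tuple (R * R) -> R) : (forall x, F x = 0 -> f x = 0) -> supported_in_square N f.
  by move=> f0 x fx; apply: FN; apply: contraNN fx => /eqP/f0 ->.
have key (f : k.-tuple (R * R) -> R) : measurable_fun setT f -> (forall x, 0 <= f x) ->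
    (forall x, f x <= `|F x|) ->
    [/\ P.-integrable setT (EFin \o process_sum X f),
        nu.-integrable setT (EFin \o (fun z => f (enc z) * rho (enc z))) &
        \int[P]_omega process_sum X f omega = \int[nu]_z (f (enc z) * rho (enc z))].
  move=> mf f0 fF.
  have fN : supported_in_square N f.
    by apply: sup => x Fx; apply/eqP; rewrite eq_le f0 andbT (le_trans (fF x))// Fx normr0.
  have ifr : nu.-integrable setT (EFin \o (fun z => f (enc z) * rho (enc z))).
    apply: (le_integrable _ _ _ iF) => //.
      apply/measurable_EFinP; apply: measurable_funM.
        exact: (measurableT_comp mf menc).
      exact: (measurableT_comp mrho menc).
    move=> z _ /=; rewrite lee_fin !normrM ler_wpM2r// ger0_norm//.
  have E := ge0_integral_process_sum hrho nuE mf fN f0.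
  split => //; last by rewrite /Rintegral E.
  apply/integrableP; split.
    by apply/measurable_EFinP; exact: (measurable_process_sum X mf fN).
  have -> : (\int[P]_x `|(EFin \o process_sum X f) x| = \int[P]_x (process_sum X f x)%:E)%E.
    apply: eq_integral => omega _ /=; rewrite ger0_norm//.
    by rewrite -lee_fin -(esum_process_sum X omega fN f0) esum_ge0// => i _; rewrite lee_fin.
  rewrite E; have /integrableP[_] := ifr; apply: le_lt_trans.
  rewrite le_eqVlt; apply/orP; left; apply/eqP; apply: eq_integral => z _ /=.
  by rewrite ger0_norm// mulr_ge0.
have [i1 j1 e1] := key F^\+ (measurable_funrpos mF) (funrpos_ge0 F)
  (fun x => ltac:(by rewrite /funrpos ge_max ler_norm normr_ge0)).
have [i2 j2 e2] := key F^\- (measurable_funrneg mF) (funrneg_ge0 F)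
  (fun x => ltac:(by rewrite /funrneg ge_max -[X in _ <= X]normrN ler_norm normr_ge0)).
have E : process_sum X F = (fun omega => process_sum X F^\+ omega - process_sum X F^\- omega).
  by apply/funext => omega; exact: (process_sum_funr X omega FN).
split.
  by rewrite E; exact: (integrableB measurableT i1 i2).
rewrite E (RintegralB measurableT i1 i2) e1 e2 -(RintegralB measurableT j1 j2).
by apply: eq_Rintegral => z _; rewrite -mulrBl -{3}(funrposBneg F).
Qed.

Section PlanePowers.
Context {R : realType}.
Local Notation mu := (@lebesgue_measure R).
Local Notation leb2 := (mu \xs mu)%E.
Local Notation leb22 := (leb2 \xs leb2)%E.

Let mcons d (T : measurableType d) k (x : T -> R * R) (t : T -> k.-tuple (R * R)) :
  measurable_fun setT x -> measurable_fun setT t ->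
  measurable_fun setT (fun z => [tuple of x z :: t z]).
Proof. exact: measurable_cons. Qed.

Let mnil d (T : measurableType d) :
  measurable_fun setT (fun _ : T => [tuple] : 0.-tuple (R * R)).
Proof. exact: measurable_cst. Qed.

Lemma measurable_pair_tuple : measurable_fun setT
  (fun z : (R * R) * (R * R) => [tuple z.1; z.2]).
Proof. by apply: mcons => //; apply: mcons => //; exact: mnil. Qed.

Lemma measurable_triple_tuple : measurable_fun setT
  (fun z : (R * R) * ((R * R) * (R * R)) => [tuple z.1; z.2.1; z.2.2]).
Proof.
apply: mcons => //; apply: mcons; first exact: (measurableT_comp measurable_fst measurable_snd).
apply: mcons; first exact: (measurableT_comp measurable_snd measurable_snd).
exact: mnil.
Qed.

Lemma measurable_quadruple_tuple : measurable_fun setT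
  (fun z : ((R * R) * (R * R)) * ((R * R) * (R * R)) => [tuple z.1.1; z.1.2; z.2.1; z.2.2]).
Proof.
apply: mcons; first exact: (measurableT_comp measurable_fst measurable_fst).
apply: mcons; first exact: (measurableT_comp measurable_snd measurable_fst).
apply: mcons; first exact: (measurableT_comp measurable_fst measurable_snd).
apply: mcons; first exact: (measurableT_comp measurable_snd measurable_snd).
exact: mnil.
Qed.

Lemma integral_plane_pow2 (G : 2.-tuple (R * R) -> \bar R) :
  measurable_fun setT G -> (forall x, 0 <= G x)%E ->
  (integral_plane_pow G = \int[leb22]_z G [tuple z.1; z.2])%E.
Proof.
move=> mG G0; have mG2 := measurableT_comp mG measurable_pair_tuple.
exact/esym/(@fubini_tonelli1 _ _ _ _ R leb2 leb2 _ mG2 (fun _ => G0 _)).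
Qed.

Lemma integral_plane_pow3 (G : 3.-tuple (R * R) -> \bar R) :
  measurable_fun setT G -> (forall x, 0 <= G x)%E ->
  (integral_plane_pow G = \int[(leb2 \xs leb22)%E]_z G [tuple z.1; z.2.1; z.2.2])%E.
Proof.
move=> mG G0; have mG3 := measurableT_comp mG measurable_triple_tuple.
apply: esym.
apply: etrans (@fubini_tonelli1 _ _ _ _ R leb2 leb22 _ mG3 (fun _ => G0 _)) _.
apply: eq_integral => x _; apply: esym.
apply: (@integral_plane_pow2 (fun t => G [tuple of x :: t])) => //.
by apply: (measurableT_comp mG); apply: mcons => //; exact: measurable_cst.
Qed.

(** The points are grouped in two pairs, to match the product [f v.1 * f v.2]: Tonelli is used
    between the pairs, then inside the first, and [integral_plane_pow2] handles the second. *)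
Lemma integral_plane_pow4 (G : 4.-tuple (R * R) -> \bar R) :
  measurable_fun setT G -> (forall x, 0 <= G x)%E ->
  (integral_plane_pow G
   = \int[(leb22 \xs leb22)%E]_z G [tuple z.1.1; z.1.2; z.2.1; z.2.2])%E.
Proof.
move=> mG G0.
have mG4 := measurableT_comp mG measurable_quadruple_tuple.
have mF := measurable_fun_fubini_tonelli_F (m2 := leb22) _ mG4 (fun _ => G0 _).
apply: esym.
apply: etrans (@fubini_tonelli1 _ _ _ _ R leb22 leb22 _ mG4 (fun _ => G0 _)) _.
have F0 z : (0 <= fubini_F leb22 (G \o (fun z : ((R * R) * (R * R)) * ((R * R) * (R * R)) =>
    [tuple z.1.1; z.1.2; z.2.1; z.2.2])) z)%E by apply: integral_ge0 => ? _; exact: G0.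
have E := @fubini_tonelli1 _ _ _ _ R leb2 leb2 _ mF F0.
apply: (etrans E).
apply: eq_integral => x _; apply: eq_integral => y _; apply: esym.
apply: (@integral_plane_pow2 (fun t => G [tuple of x :: [tuple of y :: t]])) => //.
apply: (measurableT_comp mG); apply: mcons; first exact: measurable_cst.
by apply: mcons => //; exact: measurable_cst.
Qed.

End PlanePowers.

Section EnergySum.
Context (R : realType) (d : measure_display) (Omega : measurableType d).
Variable X : point_process R Omega.
Variables (N : nat) (E : R * R -> R).

Let D omega := [set p : nat * nat |
          [/\ p.1 != p.2,
              pp_dom X p.1 omega /\ square N (pp_pt X p.1 omega) &
              pp_dom X p.2 omega /\ square N (pp_pt X p.2 omega)]].

Let sq : R * R -> R := \1_(@square R N).

Lemma supported_torus_kernel g :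
  supported_in_square N (fun t : 2.-tuple (R * R) => torus_kernel N g (tnth t 0, tnth t 1)).
Proof.
move=> x /eqP f0.
have [x0 x1] : square N (tnth x 0) /\ square N (tnth x 1).
  by apply: contrapT => /torus_kernel0.
by move=> j; case: j => -[|[|//]] j2; [move: x0|move: x1]; congr square; congr tnth; exact/val_inj.
Qed.

(* Swapping the two points replaces [E] by its even part. *)
Lemma energy_sumE omega :
  \sum_(p \in D omega) E (pp_pt X p.1 omega - pp_pt X p.2 omega)
  = process_sum X (fun t : 2.-tuple (R * R) =>
      torus_kernel N (fun x => (E x + E (- x)) / 2) (tnth t 0, tnth t 1)) omega.
Proof.
have [n1 h1] := process_sumE X N omega.
have fin := finite_points_in_square X N omega.
have [n2 h2] : exists n0, forall i, pp_dom X i omega /\ square N (pp_pt X i omega) -> (i < n0)%N.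
  exists (\max_(i <- finmap.enum_fset (fset_set [set i | pp_dom X i omega /\ square N (pp_pt X i omega)])) i).+1.
  move=> i iX; rewrite ltnS; apply: leq_bigmax_seq => //.
  by rewrite in_fset_set//; exact/mem_set.
pose n := maxn n1 n2.
rewrite (h1 n (leq_maxl _ _) _ _ (@supported_torus_kernel _)) distinct_sum_pair.
pose r : seq (nat * nat) := [seq (val p.1, val p.2) | p : 'I_n * 'I_n <- enum {: 'I_n * 'I_n}].
pose w i j : R := if i != j then \1_(pp_dom X i) omega * \1_(pp_dom X j) omega
  * (sq (pp_pt X i omega) * sq (pp_pt X j omega)) else 0.
have wD i j : w i j = if (i, j) \in D omega then 1 else 0.
  rewrite /w /sq !indicE; case: ifPn => [ij|/negPn/eqP <-]; last first.
    by rewrite (memNset)//= => -[]; rewrite eqxx.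
  case: (pselect (pp_dom X i omega)) => hi; last first.
    by rewrite [_ \in pp_dom X i]memNset// !mul0r memNset// => -[_ []].
  case: (pselect (pp_dom X j omega)) => hj; last first.
    by rewrite [_ \in pp_dom X j]memNset// mulr0 !mul0r memNset// => -[_ _ []].
  case: (pselect (square N (pp_pt X i omega))) => si; last first.
    by rewrite [pp_pt X i omega \in _]memNset// mul0r mulr0 memNset// => -[_ []].
  case: (pselect (square N (pp_pt X j omega))) => sj; last first.
    by rewrite [pp_pt X j omega \in _]memNset// !mulr0 memNset// => -[_ _ []].
  by rewrite !mem_set// !mulr1.
transitivity (\sum_(i < n) \sum_(j < n) w i j * E (pp_pt X i omega - pp_pt X j omega)).
  rewrite (fsbigE [seq p <- r | p \in D omega]); first last.
  - move=> [i j] ij; apply: contraNeq => _.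
    rewrite mem_filter mem_set//=; case: (ij) => /= _ iX jX.
    apply/mapP; exists (Ordinal (leq_trans (h2 _ iX) (leq_maxr n1 n2)),
      Ordinal (leq_trans (h2 _ jX) (leq_maxr n1 n2))).
      by rewrite mem_enum.
    by [].
  - by move=> p /=; rewrite mem_filter => /andP[/set_mem].
  - apply: filter_uniq; rewrite map_inj_uniq; first exact: enum_uniq.
    by move=> [i j] [k l] /= [/val_inj -> /val_inj ->].
  rewrite big_filter_cond big_mkcond big_map big_enum [RHS]pair_bigA/=.
  by apply: eq_bigr => -[i j] _ /=; rewrite wD andbb; case: ifP; rewrite ?mul1r ?mul0r.
have wC i j : w i j = w j i.
  by rewrite /w eq_sym; case: ifP => // _; ring.
transitivity (\sum_(i < n) \sum_(j < n) w i j * ((E (pp_pt X i omega - pp_pt X j omega)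
   + E (- (pp_pt X i omega - pp_pt X j omega))) / 2)).
  apply: (@mulfI _ 2) => //.
  set s := (X in 2 * X = _).
  have -> : 2 * s = s + \sum_(i < n) \sum_(j < n) w i j * E (- (pp_pt X i omega - pp_pt X j omega)).
    rewrite mulrDl mul1r; congr (_ + _); rewrite /s exchange_big/=.
    by apply: eq_bigr => i _; apply: eq_bigr => j _; rewrite wC opprB.
  rewrite -big_split mulr_sumr; apply: eq_bigr => i _.
  rewrite -big_split mulr_sumr; apply: eq_bigr => j _ /=.
  by field.
apply: eq_bigr => i _; apply: eq_bigr => j _; rewrite /w -[val _ != val _]/(i != j).
case: ifP => _; last by rewrite mul0r.
by rewrite /torus_kernel /tnth/= !mulrA.
Qed.

End EnergySum.

(** * Variance of the renormalized energy *)

Lemma Lfun2P d (T : measurableType d) (R : realType) (P : probability T R) (Y : T -> R) :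
  measurable_fun setT Y -> P.-integrable setT (EFin \o (fun w => Y w ^+ 2)) ->
  Y \in Lfun P 2%:E.
Proof.
move=> mY /integrableP[_ iY]; rewrite inE; apply/andP; split; rewrite inE//=.
rewrite /finite_norm unlock /Lnorm.
apply: poweR_lty; apply: le_lt_trans iY.
rewrite le_eqVlt; apply/orP; left; apply/eqP; apply: eq_integral => w _ /=.
by rewrite powR_mulrn// normrX.
Qed.

Lemma variance_affine d (T : measurableType d) (R : realType) (P : probability T R)
    (Y : T -> R) (a b : R) :
  P.-integrable setT (EFin \o Y) -> P.-integrable setT (EFin \o (fun w => Y w ^+ 2)) ->
  ('V_P[(fun w => a * Y w + b)%R]
  = (a ^+ 2 * (\int[P]_w (Y w ^+ 2) - (\int[P]_w Y w) ^+ 2))%R%:E)%E.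
Proof.
move=> iY iY2; have mY : measurable_fun setT Y by case/integrableP: iY => /measurable_EFinP.
have Y2 := Lfun2P mY iY2.
have -> : (fun w => a * Y w + b) = (a \o* Y) \+ cst b.
  by apply/funext => w /=; rewrite mulrC.
have aY2 : (a \o* Y) \in Lfun P 2%:E.
  apply: Lfun2P; first exact: measurable_funM.
  rewrite (_ : _ \o _ = EFin \o (fun w => a ^+ 2 * Y w ^+ 2)); last first.
    by apply/funext => w /=; rewrite exprMn mulrC.
  exact: (integrableZl measurableT _ iY2).
rewrite varianceD_cst_r// varianceZ// varianceE// [RHS]EFinM; congr (_ * _)%E.
have fin (Z : T -> R) : P.-integrable setT (EFin \o Z) -> ('E_P[Z] = (\int[P]_w Z w)%:E)%E.
  by move=> iZ; rewrite unlock fineK//; exact: integrable_fin_num.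
rewrite (fin _ iY) -EFin_expe [in RHS]EFinB; congr (_ - _)%E.
by rewrite -(fin _ iY2).
Qed.

Lemma integral_leE d (T : measurableType d) (R : realType) (m : {measure set T -> \bar R})
    (h : T -> R) (a : R) : integral_le m h a ->
  (\int[m]_x (h x)%:E = (\int[m]_x h x)%:E)%E.
Proof. by move=> /integral_le_integrable ih; rewrite fineK//; exact: integrable_fin_num. Qed.

(** * Ginibre correlations up to cycle terms *)

Section CorrelationBounds.
Context {R : realType}.
Local Notation p x y := (gauss2 (pi / 2) (x - y)).
Local Notation K x y := (ginibre_kernel (toC x) (toC y)).
Variable r : (R * R) * (R * R) -> R.
Hypothesis r4 : forall x y, r (x, y) ^+ 4 = p x y.

Let r8 z : r z ^+ 8 = (r z ^+ 4) ^+ 2. Proof. by rewrite -exprM. Qed.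

Local Notation det_kernel k t :=
  (\det (\matrix_(i < k, j < k) K (tnth t i) (tnth t j))).

Lemma ginibre_rho3_approx (rho : R) x y z :
  rho%:C%C = det_kernel 3 [tuple x; y; z] ->
  `|rho - (1 - r (x, y) ^+ 8 - r (x, z) ^+ 8 - r (y, z) ^+ 8)|
    <= 2 * (r (x, y) ^+ 4 * r (y, z) ^+ 4 * r (z, x) ^+ 4).
Proof.
move=> /ginibre_rho3 ->; rewrite !r8 !r4.
set c := cycle3 x y z; have := cycle3_le x y z; rewrite -/c.
move: (1 - _ - _ - _) (p x y * _ * _) => a b h.
by rewrite addrAC subrr add0r normrM ger0_norm// ler_pM2l.
Qed.

(** The four 3-point functions sum to 4, minus each squared modulus twice, plus all the 3-cycles of
    the 4-point function. Subtracting 3 and adding each squared modulus once leaves, besides the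
    three pairings, only 4-cycles. *)
Lemma ginibre_rho4_approx (rho123 rho124 rho134 rho234 rho : R) x y z w :
  rho123%:C%C = det_kernel 3 [tuple x; y; z] ->
  rho124%:C%C = det_kernel 3 [tuple x; y; w] ->
  rho134%:C%C = det_kernel 3 [tuple x; z; w] ->
  rho234%:C%C = det_kernel 3 [tuple y; z; w] ->
  rho%:C%C = det_kernel 4 [tuple x; y; z; w] ->
  `|rho - ((rho123 - 3 + r (x, y) ^+ 8 + r (x, z) ^+ 8 + r (y, z) ^+ 8)
    + (rho124 + r (x, w) ^+ 8 + r (y, w) ^+ 8)
    + (rho134 + r (z, w) ^+ 8) + rho234
    + r (x, y) ^+ 8 * r (z, w) ^+ 8 + r (x, z) ^+ 8 * r (y, w) ^+ 8
    + r (x, w) ^+ 8 * r (y, z) ^+ 8)|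
  <= 2 * (r (x, y) ^+ 4 * r (y, z) ^+ 4 * r (z, w) ^+ 4 * r (w, x) ^+ 4
  + r (x, y) ^+ 4 * r (y, w) ^+ 4 * r (w, z) ^+ 4 * r (z, x) ^+ 4
  + r (x, z) ^+ 4 * r (z, y) ^+ 4 * r (y, w) ^+ 4 * r (w, x) ^+ 4).
Proof.
move=> /ginibre_rho3 -> /ginibre_rho3 -> /ginibre_rho3 -> /ginibre_rho3 -> /ginibre_rho4 ->.
rewrite !r8 !r4.
have := cycle4_le x y z w; have := cycle4_le x y w z; have := cycle4_le x z y w.
move: (cycle4 x y z w) (cycle4 x y w z) (cycle4 x z y w) => c1 c2 c3 h3 h2 h1.
set A := (X in `|X| <= _); have -> : A = - (2 * (c1 + c2 + c3)) by rewrite /A; ring.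
rewrite normrN normrM ger0_norm// ler_pM2l//.
apply: le_trans (ler_normD _ _) _; apply: lerD => //.
by apply: le_trans (ler_normD _ _) _; apply: lerD.
Qed.

End CorrelationBounds.

Section GinibreMoments.
Context (R : realType) (d : measure_display) (Omega : measurableType d).
Variables (P : probability Omega R) (X : point_process R Omega).
Hypothesis hX : determinantal P X (@ginibre_kernel R).
Local Notation mu := (@lebesgue_measure R).
Local Notation leb2 := (mu \xs mu)%E.
Local Notation mu2 := (leb2 \xs leb2)%E.
Local Notation mu3 := (leb2 \xs mu2)%E.
Local Notation mu4 := (mu2 \xs mu2)%E.

Variables (N : nat) (g : R * R -> R).
Hypothesis N0 : (0 < N)%N.
Hypothesis mg : measurable_fun setT g.
Hypothesis gN : forall x, g (- x) = g x.
Hypothesis gP : forall x l, @lattice R N l -> g (x + l) = g x.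
Hypothesis g_approx : forall e : R, 0 < e -> exists M,
  (\int[leb2]_(x in @square R N) ((g x - trig_sum N M x) ^+ 2)%:E <= e%:E)%E.

Let f := torus_kernel N g.
(** The parameter is chosen so that the eighth power is the squared modulus of the kernel. *)
Let r (z : (R * R) * (R * R)) := gauss2 (pi / 8) (z.1 - z.2).

Let F2 (t : 2.-tuple (R * R)) := f (tnth t 0, tnth t 1).
Let F22 (t : 2.-tuple (R * R)) := f (tnth t 0, tnth t 1) ^+ 2.
Let F3 (t : 3.-tuple (R * R)) := f (tnth t 0, tnth t 1) * f (tnth t 0, tnth t 2%R).
Let F4 (t : 4.-tuple (R * R)) := f (tnth t 0, tnth t 1) * f (tnth t 2%R, tnth t 3%R).

Let fC x y : f (x, y) = f (y, x). Proof. exact: torus_kernelC. Qed.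

Let mf : measurable_fun setT f. Proof. exact: measurable_torus_kernel. Qed.

Let mft k (i j : 'I_k) : measurable_fun setT (fun t : k.-tuple (R * R) => f (tnth t i, tnth t j)).
Proof.
apply: (measurableT_comp mf); apply: measurable_fun_pair; exact: measurable_tnth.
Qed.

Let f_square k (t : k.-tuple (R * R)) i j : f (tnth t i, tnth t j) != 0 ->
  square N (tnth t i) /\ square N (tnth t j).
Proof. by move=> /eqP f0; apply: contrapT => h; apply: f0; exact: torus_kernel0. Qed.

Let F22N : supported_in_square N F22.
Proof.
move=> t; rewrite /F22 expf_eq0/= => /f_square[t0 t1].
by case=> -[|[|//]] j2; [move: t0|move: t1]; congr square; congr tnth; exact/val_inj.
Qed.

Let F2N : supported_in_square N F2.
Proof. exact: supported_torus_kernel. Qed.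

Let F3N : supported_in_square N F3.
Proof.
move=> t; rewrite /F3 mulf_eq0 negb_or => /andP[/f_square[t0 t1] /f_square[_ t2]].
by case=> -[|[|[|//]]] j2; [move: t0|move: t1|move: t2]; congr square; congr tnth; exact/val_inj.
Qed.

Let F4N : supported_in_square N F4.
Proof.
move=> t; rewrite /F4 mulf_eq0 negb_or => /andP[/f_square[t0 t1] /f_square[t2 t3]].
by case=> -[|[|[|[|//]]]] j2; [move: t0|move: t1|move: t2|move: t3];
  congr square; congr tnth; exact/val_inj.
Qed.

Let process_sum_sqr omega : process_sum X F2 omega ^+ 2 =
  process_sum X F4 omega + 4 * process_sum X F3 omega + 2 * process_sum X F22 omega.
Proof.
have [n h] := process_sumE X N omega; rewrite !(h n (leqnn _))//.
apply: distinct_sum_sqr => // i; rewrite indicE.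
by case: (_ \in _); [left|right].
Qed.

Let rE c n z : (n%:R * (pi / 8) = c) -> r z ^+ n = gauss2 c (z.1 - z.2).
Proof. by move=> <-; rewrite /r gauss2X. Qed.

Let r4 z : r z ^+ 4 = gauss2 (pi / 2) (z.1 - z.2). Proof. by apply: rE; field. Qed.
Let r8 z : r z ^+ 8 = gauss2 pi (z.1 - z.2). Proof. by apply: rE; field. Qed.
Let r2 z : r z ^+ 2 = gauss2 (pi / 4) (z.1 - z.2). Proof. by apply: rE; field. Qed.

Let r4' x y : r (x, y) ^+ 4 = gauss2 (pi / 2) (x - y). Proof. exact: (r4 (x, y)). Qed.

Let r48 x y : gauss2 (pi / 2) (x - y) ^+ 2 = r (x, y) ^+ 8.
Proof. by rewrite -(r4 (x, y)) -exprM. Qed.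

Section Approximated.
Variables (M : nat) (e : R).
Hypothesis He :
  (\int[leb2]_(x in @square R N) ((g x - trig_sum N M x) ^+ 2)%:E <= e%:E)%E.
Local Notation S := (trig_bound M : R).
Local Notation L := (trig_lip M : R).
Local Notation n := (N%:R : R).

Lemma ginibre_pair_sum_variance :
  [/\ P.-integrable setT (EFin \o process_sum X F2),
      P.-integrable setT (EFin \o (fun omega => process_sum X F2 omega ^+ 2)) &
      \int[P]_omega (process_sum X F2 omega ^+ 2) - (\int[P]_omega process_sum X F2 omega) ^+ 2
      <= 4 * (16 * n * (2 * e + 2 * (S ^+ 2 * n ^+ 2)) + 3 * n ^+ 2 * e + 6 * L ^+ 2 * n ^+ 2)
         + 128 * (n ^+ 2 * (2 * e + 16 * S ^+ 2))].
Proof.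
have [rho2 c2 d2] := hX (isT : (1 <= 2)%N).
have [rho3 c3 d3] := hX (isT : (1 <= 3)%N).
have [rho4 c4 d4] := hX (isT : (1 <= 4)%N).
have [mrho2 _ _] := c2; have [mrho3 _ _] := c3; have [mrho4 _ _] := c4.
pose rh3 (v : (R * R) * ((R * R) * (R * R))) := rho3 [tuple v.1; v.2.1; v.2.2].
pose rh4 (v : ((R * R) * (R * R)) * ((R * R) * (R * R))) := rho4 [tuple v.1.1; v.1.2; v.2.1; v.2.2].
have rho2E z : rho2 [tuple z.1; z.2] = 1 - r z ^+ 8.
  by rewrite (ginibre_rho2 (d2 _)) r48; case: z.
have p0 := pi_gt0 R.
have p8 : 0 < pi / 8 :> R by rewrite divr_gt0.
have mr : measurable_fun setT r := measurable_gauss2_sub (pi / 8).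
have int_r (c : R) (x : R * R) : 0 < c -> (\int[leb2]_y (gauss2 c (x - y))%:E <= (pi / c)%:E)%E.
  by move=> c0; rewrite integral_gauss2_sub.
have hF := torus_kernel_sqr N0 mg gP He.
have hFr := torus_kernel_sqr_gauss N0 mg gP He.
have mrh3 : measurable_fun setT rh3 := measurableT_comp mrho3 measurable_triple_tuple.
have mrh4 : measurable_fun setT rh4 := measurableT_comp mrho4 measurable_quadruple_tuple.
have Aoo : (leb2 (@square R N) < +oo)%E.
  have [_ _ h] := @integral_le_square R N; apply: le_lt_trans (ltry (N%:R ^+ 2)).
  by move: h; rewrite integral_indic ?setIT//; exact: measurable_square.
have f2oo x : (\int[leb2]_y (f (x, y) ^+ 2)%:E < +oo)%E.
  by have [_ _ h] := torus_kernel_sqr_inner N0 mg gP He x; apply: le_lt_trans h (ltry _).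
(* [C = 4] is the integral of the Gaussian of parameter [pi / 4]; it makes the coefficient
   [6 C^2 + 8 C] equal to 128. *)
have r2C x : (\int[leb2]_y (r (x, y) ^+ 2)%:E <= 4%:E)%E.
  under eq_integral do rewrite r2/=.
  rewrite (le_trans (int_r _ _ _))// ?divr_gt0// lee_fin.
  by rewrite invfM invrK mulrA divff ?mul1r// gt_eqF.
have r81 x : (\int[leb2]_y (r (x, y) ^+ 8)%:E <= 1)%E.
  under eq_integral do rewrite r8/=.
  by rewrite (le_trans (int_r _ _ _))// divff// gt_eqF.
have rho3E x y z := ginibre_rho3_approx r4' (d3 [tuple x; y; z]).
have rho4E v : `|rh4 v - ((rh3 (v.1.1, (v.1.2, v.2.1)) - 3 + r (v.1.1, v.1.2) ^+ 8
      + r (v.1.1, v.2.1) ^+ 8 + r (v.1.2, v.2.1) ^+ 8)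
    + (rh3 (v.1.1, (v.1.2, v.2.2)) + r (v.1.1, v.2.2) ^+ 8 + r (v.1.2, v.2.2) ^+ 8)
    + (rh3 (v.1.1, (v.2.1, v.2.2)) + r (v.2.1, v.2.2) ^+ 8) + rh3 (v.1.2, (v.2.1, v.2.2))
    + r v.1 ^+ 8 * r v.2 ^+ 8 + r (v.1.1, v.2.1) ^+ 8 * r (v.1.2, v.2.2) ^+ 8
    + r (v.1.1, v.2.2) ^+ 8 * r (v.1.2, v.2.1) ^+ 8)|
  <= 2 * (r (v.1.1, v.1.2) ^+ 4 * r (v.1.2, v.2.1) ^+ 4 * r (v.2.1, v.2.2) ^+ 4 * r (v.2.2, v.1.1) ^+ 4
  + r (v.1.1, v.1.2) ^+ 4 * r (v.1.2, v.2.2) ^+ 4 * r (v.2.2, v.2.1) ^+ 4 * r (v.2.1, v.1.1) ^+ 4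
  + r (v.1.1, v.2.1) ^+ 4 * r (v.2.1, v.1.2) ^+ 4 * r (v.1.2, v.2.2) ^+ 4 * r (v.2.2, v.1.1) ^+ 4).
  case: v => [[x y] [z w]].
  exact: (ginibre_rho4_approx r4' (d3 [tuple x; y; z]) (d3 [tuple x; y; w])
    (d3 [tuple x; z; w]) (d3 [tuple y; z; w]) (d4 [tuple x; y; z; w])).
have [i4 i3 i22 i2 bound] := @ustatistic_moments _ _ R leb2 f r (@square R N)
  (\int[mu2]_z (f z ^+ 2)) (\int[mu2]_z (f z ^+ 2 * r z)) 4
  mf fC (measurable_square N) Aoo (@torus_kernel0 R N g) f2oo (integral_leE hF)
  (Rintegral_torus_kernel N0 mg gP g_approx) mr (fun x y => gauss2C _ x y) (fun z => gauss2_ge0 _ _)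
  (fun z => gauss2_le1 _ (ltW p8)) (fun x y z => gauss2_triangle _ _ _ (ltW p8)) (ler0n _ _) r2C r81
  (integral_leE hFr) rh3 rh4 mrh3 mrh4 rho3E rho4E.
have [j2 e2] : P.-integrable setT (EFin \o process_sum X F2) /\
    \int[P]_omega process_sum X F2 omega = \int[mu2]_z (f z * (1 - r z ^+ 8)).
  apply: (integrable_process_sum c2 i2 measurable_pair_tuple (@integral_plane_pow2 R) _ F2N _).
    exact: mft.
  by move=> z; rewrite -rho2E; case: z.
have [j22 e22] : P.-integrable setT (EFin \o process_sum X F22) /\
    \int[P]_omega process_sum X F22 omega = \int[mu2]_z (f z ^+ 2 * (1 - r z ^+ 8)).
  apply: (integrable_process_sum c2 i22 measurable_pair_tuple (@integral_plane_pow2 R) _ F22N _).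
    by apply: measurable_funX; exact: mft.
  by move=> z; rewrite -rho2E; case: z.
have [j3 e3] : P.-integrable setT (EFin \o process_sum X F3) /\
    \int[P]_omega process_sum X F3 omega
    = \int[mu3]_v (f (v.1, v.2.1) * f (v.1, v.2.2) * rh3 v).
  apply: (integrable_process_sum c3 i3 measurable_triple_tuple
    (@integral_plane_pow3 R) _ F3N _) => //.
  by apply: measurable_funM; exact: mft.
have [j4 e4] : P.-integrable setT (EFin \o process_sum X F4) /\
    \int[P]_omega process_sum X F4 omega = \int[mu4]_v (f v.1 * f v.2 * rh4 v).
  apply: (integrable_process_sum c4 i4 measurable_quadruple_tuple
    (@integral_plane_pow4 R) _ F4N _).
    by apply: measurable_funM; exact: mft.
  by case=> [[x y] [z w]].
have sqrE : (fun omega => process_sum X F2 omega ^+ 2) = (fun omega =>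
    process_sum X F4 omega + 4 * process_sum X F3 omega + 2 * process_sum X F22 omega).
  by apply/funext => omega; exact: process_sum_sqr.
have j3' := integrableZl measurableT 4 j3; have j22' := integrableZl measurableT 2 j22.
have j43 := integrableD measurableT j4 j3'.
split => //; first by rewrite sqrE; exact: (integrableD measurableT j43 j22').
rewrite sqrE (RintegralD measurableT j43 j22') (RintegralD measurableT j4 j3').
rewrite (RintegralZl _ measurableT j3) (RintegralZl _ measurableT j22) e2 e22 e3 e4.
apply: (le_trans bound).
have := integral_le_Rintegral hFr.
have := torus_kernel_defect N0 mg gN gP He; rewrite -/f.
under [X in _ - X <= _ -> _]eq_Rintegral => v _ do rewrite -r8.
rewrite (_ : 6 * 4 ^+ 2 + 8 * 4 = 128 :> R); last by ring.
move: (\int[mu2]_z (f z ^+ 2)) (\int[mu2]_z (f z ^+ 2 * r z)) (Rintegral mu3 _ _).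
move=> a b c h1 h2; apply: lerD; first by rewrite ler_pM2l.
by rewrite ler_pM2l.
Qed.

End Approximated.

End GinibreMoments.

(** The squared error is set to [2 n^2 dl]. After division by [n^4] the terms in [dl] total
    [24 + 512 + 256 / n <= 792]; the others are at most of order [1 / n], with
    [2176 = 128 + 2048]. *)
Lemma energy_bound (R : realFieldType) (n dl l s : R) :
  1 <= n -> 0 <= dl -> 0 <= l -> 0 <= s ->
  1 / n ^+ 4 * (4 * (16 * n * (2 * (2 * n ^+ 2 * dl) + 2 * (s * n ^+ 2))
    + 3 * n ^+ 2 * (2 * n ^+ 2 * dl) + 6 * l * n ^+ 2)
    + 128 * (n ^+ 2 * (2 * (2 * n ^+ 2 * dl) + 16 * s)))
  <= 792 * dl + (24 * l + 2176 * s) / n.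
Proof.
move=> n1 dl0 l0 s0; have n0 : 0 < n by exact: lt_le_trans n1.
have v0 : 0 <= n^-1 by rewrite invr_ge0 ltW.
have v1 : n^-1 <= 1 by rewrite invf_le1.
rewrite [X in X <= _](_ : _ = (256 * n^-1 + 536) * dl
  + (128 * s * n^-1 + (24 * l + 2048 * s) * (n^-1 * n^-1))); last first.
  by field; rewrite gt_eqF.
move: v0 v1; move: n^-1 => v v0 v1; clear n1 n0.
have vv : v * v <= v by rewrite ler_piMr.
apply: lerD; first by rewrite ler_wpM2r//; lra.
have c0 := addr_ge0 (mulr_ge0 (ler0n R 24) l0) (mulr_ge0 (ler0n R 2048) s0).
have := ler_wpM2l c0 vv.
move: (v * v) => w hw; apply: (le_trans (lerD (lexx _) hw)).
by rewrite le_eqVlt; apply/orP; left; apply/eqP; ring.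
Qed.

Section EnergyVariance.
Context (R : realType) (d : measure_display) (Omega : measurableType d).
Variables (P : probability Omega R) (X : point_process R Omega).
Hypothesis hX : determinantal P X (@ginibre_kernel R).
Variable E : nat -> R * R -> R.
Hypothesis hE : forall N : nat, (1 <= N)%N -> is_E N (E N).

Let green_error_lt N (e : R) : (0 < N)%N -> 0 < e ->
  exists2 M, (green_error E N M \is a fin_num) & fine (green_error E N M) <= e.
Proof.
move=> N0 e0; have /fine_cvgP[fin /cvgrPdist_le/(_ _ e0) small] := green_error_cvg0 hE N0.
have [M _ /(_ M (leqnn M)) [h1 h2]] : \forall M \near \oo,
    green_error E N M \is a fin_num /\ `|0 - fine (green_error E N M)| <= e.
  by near=> M; split; [near: M|near: M].
by exists M => //; apply: le_trans h2; rewrite sub0r normrN ler_norm.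
Unshelve. all: by end_near. Qed.

Lemma renormalized_energyE N omega :
  renormalized_energy X N (E N) omega
  = 1 / (2 * pi * N%:R ^+ 2) * process_sum X (fun t : 2.-tuple (R * R) =>
      torus_kernel N (green_sym E N) (tnth t 0, tnth t 1)) omega
    + ln (N%:R / (2 * pi * complex.Re (dedekind_eta ('i%C : R[i])) ^+ 2)).
Proof. by rewrite /renormalized_energy energy_sumE. Qed.

(** The logarithmic term is deterministic and leaves the variance unchanged; the rest is the pair
    sum estimate, with an L2 error controlled by [green_error_scale]. *)
Lemma renormalized_energy_variance_le N M : (0 < N)%N ->
  green_error E 1 M \is a fin_num ->
  ('V_P[renormalized_energy X N (E N)] <=
   (792 * fine (green_error E 1 M)
    + (24 * trig_lip M ^+ 2 + 2176 * trig_bound M ^+ 2) / N%:R)%:E)%E.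
Proof.
move=> N0 fin; set dl := fine _.
have n0 : 0 < N%:R :> R by rewrite ltr0n.
have n1 : 1 <= N%:R :> R by rewrite ler1n.
have dl0 : 0 <= dl by rewrite fine_ge0// green_error_ge0.
have He : (\int[(lebesgue_measure \xs lebesgue_measure)%E]_(x in @square R N)
    ((green_sym E N x - trig_sum N M x) ^+ 2)%:E <= (2 * N%:R ^+ 2 * dl)%:E)%E.
  apply: le_trans (green_sym_error hE M N0) _.
  by rewrite EFinM fineK//; exact: green_error_scale.
have approx (e : R) : 0 < e -> exists M,
    (\int[(lebesgue_measure \xs lebesgue_measure)%E]_(x in @square R N)
      ((green_sym E N x - trig_sum N M x) ^+ 2)%:E <= e%:E)%E.
  move=> /(green_error_lt N0)[M' fin' le']; exists M'.
  apply: le_trans (green_sym_error hE M' N0) _.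
  by rewrite -(fineK fin') lee_fin.
have [iT iT2] := ginibre_pair_sum_variance hX N0 (measurable_green_sym hE N0)
  (green_symN E N) (fun x l => green_sym_periodic hE x N0) approx He.
have -> : renormalized_energy X N (E N) = (fun omega => 1 / (2 * pi * N%:R ^+ 2) *
    process_sum X (fun t : 2.-tuple (R * R) =>
      torus_kernel N (green_sym E N) (tnth t 0, tnth t 1)) omega
    + ln (N%:R / (2 * pi * complex.Re (dedekind_eta ('i%C : R[i])) ^+ 2))).
  by apply/funext => omega; exact: renormalized_energyE.
rewrite (variance_affine _ _ iT iT2) lee_fin.
move: (_ - _ ^+ 2) => V hV.
have p1 : 1 <= pi :> R by rewrite (le_trans _ (pi_ge2 R))// ler1n.
(* Only [2 pi >= 1] is used; the factor [4 pi^2] is given away. *)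
have a1 : (1 / (2 * pi * N%:R ^+ 2)) ^+ 2 <= 1 / N%:R ^+ 4 :> R.
  rewrite expr_div_n expr1n ler_pM2l// lef_pV2 ?posrE ?exprn_gt0 ?mulr_gt0 ?exprn_gt0//; last lra.
  rewrite exprMn -exprM; apply: ler_peMl; first by rewrite exprn_ge0// ltW.
  by apply: exprn_ege1; lra.
move: hV; set B := (X in V <= X) => hV.
have B0 : 0 <= B.
  rewrite /B; have := sqr_ge0 (trig_bound M : R); have := sqr_ge0 (trig_lip M : R).
  move: (_ ^+ 2) (_ ^+ 2) => l s l0 s0.
  by rewrite !(addr_ge0, mulr_ge0)// ?exprn_ge0 ?ltW.
apply: (@le_trans _ _ (1 / N%:R ^+ 4 * B)).
  apply: (@le_trans _ _ ((1 / (2 * pi * N%:R ^+ 2)) ^+ 2 * B)).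
    by rewrite ler_wpM2l ?sqr_ge0.
  by rewrite ler_wpM2r.
apply: energy_bound => //; exact: sqr_ge0.
Qed.

End EnergyVariance.

Theorem theorem5 (R : realType) (d : measure_display)
    (Omega : measurableType d) (P : probability Omega R)
    (X : point_process R Omega)
    (hX : determinantal P X (@ginibre_kernel R))
    (E : nat -> R * R -> R)
    (hE : forall N : nat, (1 <= N)%N -> is_E N (E N)) :
  (fun N : nat => 'V_P[renormalized_energy X N (E N)]) @ \oo --> 0%E.
Proof.
have small (e : R) : 0 < e -> \forall N \near \oo, ('V_P[renormalized_energy X N (E N)] <= e%:E)%E.
  move=> e0; have [K K0 bound] : exists2 K : R, 0 < K & forall N M, (0 < N)%N ->
      green_error E 1 M \is a fin_num -> ('V_P[renormalized_energy X N (E N)] <=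
      (K * fine (green_error E 1 M)
       + (24 * trig_lip M ^+ 2 + 2176 * trig_bound M ^+ 2) / N%:R)%:E)%E.
    exists 792; first by rewrite ltr0n.
    exact: renormalized_energy_variance_le.
  have e1 : 0 < e / (2 * K) by rewrite divr_gt0// mulr_gt0.
  (* The order of choices matters: [M] is fixed from the error at period 1, which is independent of
     [N], and only then is [N] taken large against the constant [C] of that [M]. *)
  have /fine_cvgP[fin /cvgrPdist_le/(_ _ e1) hsmall] := green_error_cvg0 hE (isT : (0 < 1)%N).
  have [M _ /(_ M (leqnn M)) [h1 h2]] : \forall M \near \oo,
      green_error E 1 M \is a fin_num /\ `|0 - fine (green_error E 1 M)| <= e / (2 * K).
    by near=> M; split; near: M.
  have {}h2 : fine (green_error E 1 M) <= e / (2 * K).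
    by apply: le_trans h2; rewrite sub0r normrN ler_norm.
  set C := 24 * trig_lip M ^+ 2 + 2176 * trig_bound M ^+ 2 : R.
  near=> N.
  have N0 : (0 < N)%N by near: N; exact: nbhs_infty_gt.
  apply: le_trans (bound N M N0 h1) _.
  rewrite lee_fin -/C.
  have n0 : 0 < N%:R :> R by rewrite ltr0n.
  have : C / N%:R <= e / 2.
    rewrite ler_pdivrMr// -ler_pdivrMl ?divr_gt0//.
    by near: N; exact: nbhs_infty_ger.
  have : K * fine (green_error E 1 M) <= e / 2.
    apply: le_trans (ler_wpM2l (ltW K0) h2) _.
    by rewrite le_eqVlt; apply/orP; left; apply/eqP; field; rewrite gt_eqF.
  move: (K * _) (C / _) => a b ha hb; lra.
have V0 N : (0 <= 'V_P[renormalized_energy X N (E N)])%E by exact: variance_ge0.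
(* Convergence of extended reals to 0 is eventual finiteness together with convergence of the real
   parts; finiteness is read off from [small] at level 1. *)
apply/fine_cvgP; split.
  near=> N; rewrite ge0_fin_numE//; apply: (@le_lt_trans _ _ (1%:E)%E); last exact: ltry.
  by near: N; exact: small.
apply/cvgrPdist_le => e e0; near=> N.
rewrite sub0r normrN ger0_norm ?fine_ge0// -lee_fin fineK.
  by near: N; exact: small.
rewrite ge0_fin_numE//; apply: (@le_lt_trans _ _ (1%:E)%E); last exact: ltry.
by near: N; exact: small.
Unshelve. all: by end_near. Qed.
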